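(* For each $\nu>-1$ the radius of convexity $r^c(h_\nu)$ satisfies $r^c(h_\nu)<8(\nu+1)_3$. Moreover, if $\nu>-1$, then $$4(\nu+1)_3<r^c(h_\nu)<\frac{64(\nu+1)_5}{7\nu^2+108\nu+293}$$ and $$16(\nu+1)_3\sqrt{\frac{(\nu+4)_2}{\nu_{15}}}<r^c(h_\nu)<\frac{8(\nu+1)_3(\nu+6)_2\,\nu_{15}}{3\nu_{16}},$$ where $$\nu_{15}=7\nu^2+108\nu+293,\qquad \nu_{16}=3\nu^4+91\nu^3+1059\nu^2+4965\nu+7834.$$
   Context: For $\nu>-1$, with $J_\nu,I_\nu$ the Bessel and modified Bessel functions of the first kind, $$\mathbf{\Phi}_\nu(z)=J_\nu(z)I_\nu'(z)-J_\nu'(z)I_\nu(z)=2\sum_{n\ge0}\frac{(-1)^n(z/2)^{2\nu+4n+1}}{n!\,\Gamma(\nu+n+1)\Gamma(\nu+2n+2)},$$ $$h_\nu(z)=2^{2\nu}z^{-\frac{\nu}{2}+\frac34}\Gamma(\nu+1)\Gamma(\nu+2)\mathbf{\Phi}_\nu(\sqrt[4]{z})=\sum_{n\ge0}\frac{(-1)^n z^{n+1}}{2^{4n}n!\,(\nu+1)_n(\nu+2)_{2n}}.$$ The radius of convexity is $r^c(f)=\sup\{r>0:\operatorname{Re}(1+zf''(z)/f'(z))>0\text{ for all }|z|<r\}$. Pochhammer symbol: $(a)_0=1$, $(a)_n=a(a+1)\cdots(a+n-1)$. *)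

(* Defs.v *)
From Stdlib Require Import Reals Factorial.
From Coquelicot Require Import Coquelicot.
Open Scope R_scope.

(** Rising factorial [(a)_n = a (a+1) ... (a+n-1)]. *)
Fixpoint poch (a : R) (n : nat) : R :=
  match n with
  | O => 1
  | S m => poch a m * (a + INR m)
  end.

(** Euler's integral; it represents the Gamma function for [0 < x] only, which
    covers every argument [nu + n + 1] arising below since [-1 < nu]. *)
Definition Gamma (x : R) : R :=
  RInt_gen (fun t => Rpower t (x - 1) * exp (- t)) (at_right 0) (Rbar_locally p_infty).

(** Principal argument, in [(-PI, PI]]; irrelevant value at [z = 0]. *)
Definition Carg (z : C) : R :=
  if Rle_dec 0 (Im z) then acos (Re z / Cmod z) else - acos (Re z / Cmod z).

(** Principal value of [z ^ a] for a real exponent [a], with [0 ^ 0 = 1] and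
    [0 ^ a = 0] otherwise. *)
Definition Cpower (z : C) (a : R) : C :=
  if Ceq_dec z 0 then (if Req_EM_T a 0 then 1%C else 0%C)
  else (RtoC (Rpower (Cmod z) a) * (cos (a * Carg z), sin (a * Carg z)))%C.

Definition CSeries (u : nat -> C) : C :=
  (Series (fun n => Re (u n)), Series (fun n => Im (u n))).

Definition besselJ (nu : R) (z : C) : C :=
  (Cpower (z / 2) nu *
   CSeries (fun n => RtoC ((-1) ^ n / (INR (fact n) * Gamma (nu + INR n + 1)))
                     * (z / 2) ^ (2 * n)))%C.

Definition besselI (nu : R) (z : C) : C :=
  (Cpower (z / 2) nu *
   CSeries (fun n => RtoC (1 / (INR (fact n) * Gamma (nu + INR n + 1)))
                     * (z / 2) ^ (2 * n)))%C.

(** Cross-product of Bessel functions. *)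
Definition Phi (nu : R) (z : C) : C :=
  (besselJ nu z * C_derive (besselI nu) z - C_derive (besselJ nu) z * besselI nu z)%C.

(** All powers are principal: for [z <> 0] the point [z ^ (1/4)] lies in the
    open right half-plane, where [besselJ nu] and [besselI nu] are holomorphic,
    and the branch factors combine to exactly [z].  At the removable point
    [z = 0] the value is [0]. *)
Definition h (nu : R) (z : C) : C :=
  if Ceq_dec z 0 then 0%C
  else (RtoC (Rpower 2 (2 * nu)) * Cpower z (- nu / 2 + 3 / 4)
        * RtoC (Gamma (nu + 1)) * RtoC (Gamma (nu + 2))
        * Phi nu (Cpower z (1 / 4)))%C.

(** [C_derive] and complex division are total, so the existence of [f'] and
    [f' z <> 0], implicit in the expression [1 + z f''(z) / f'(z)], are required
    explicitly.  The supremum is taken in the extended reals. *)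
Definition radius_of_convexity (f : C -> C) : Rbar :=
  Lub_Rbar (fun r =>
    0 < r /\
    forall z : C, Cmod z < r ->
      ex_derive (K := C_AbsRing) (V := C_NormedModule) f z /\
      C_derive f z <> 0%C /\
      0 < Re (1 + z * C_derive (C_derive f) z / C_derive f z)%C).

Definition nu15 (nu : R) : R := 7 * nu ^ 2 + 108 * nu + 293.

Definition nu16 (nu : R) : R :=
  3 * nu ^ 4 + 91 * nu ^ 3 + 1059 * nu ^ 2 + 4965 * nu + 7834.

(* Main.v *)
Require Import Defs.
From mathcomp Require all_boot all_order all_algebra complex ring lra Rstruct.
From Stdlib Require Import Reals Factorial List Classical Lra Lia.
From Stdlib Require Import FunctionalExtensionality IndefiniteDescription.
From Coquelicot Require Import Coquelicot.
Open Scope R_scope.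

(** Why the theorem is true.  Write [g = h'] for [h = h_nu] and [f = (z h')' = g + z g'],
    so that [1 + z h'' / h' = f / g].

    The function [h] is entire: with [J = p A] and [I = p B], where [p] is a branch of the power
    [z^nu] and [A], [B] are power series, the derivative of [p] cancels in the cross-product
    [J I' - J' I], which becomes [p^2 (A B' - A' B)].  The coefficients of [A B' - A' B] are found
    from the second-order equations of [A] and [B] ([wronskian_step], [bessel_wronskian_coef]),
    and all principal powers recombine to [z] ([h_eq]).  Hence
    [g = sum (-1)^n (n+1) c_n z^n] and [f = sum (-1)^n (n+1)^2 c_n z^n] with
    [c_n = 1 / (16^n n! (nu+1)_n (nu+2)_(2n))].

    Both [g] and [f] are limits, coefficient by coefficient, of products of factors [1 - x z] with
    [x > 0].  Indeed [exp(-z)] is such a limit, the operator [u |-> u + z u' / b] with [b > 0]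
    keeps such products ([prod_coef_euler_op]), and dividing the [n]-th coefficient by [(a)_n] is
    a limit of rescaled compositions of these operators ([laguerre_polya_div_poch]).  No
    zero of [f] or [g] is ever located; only the Newton sums matter, that is the coefficients of
    [- z u' / u], which are the power sums of the numbers [x] before passing to the limit.  They
    are therefore nonnegative, and the Newton sums [sigma_k] of [f] satisfy
    [sigma_(m+n) <= sigma_m sigma_n].

    Lower bounds.  Let [s_k >= 0] be the Newton sums of [g] and [s(z) = sum s_k z^k], so that
    [z h'' / h' = - s(z)] and [f = g (1 - s)].  Comparing power series gives
    [0 <= 1/g <= 1/(1-s)] and [s_1 / (1-s) <= (- z f' / f) / z], coefficient by coefficient
    ([ps_inv_bounds], [ps_inv_le_newton]).  If [sigma_4 r^4 <= 1], submultiplicativity bounds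
    [sigma_k r^k], so for [|z| < r] all these series converge.  Then [g] does not vanish, and
    [(1 - s(t)) * (1 / (1 - s))(t) = 1] at [t = |z|] forces [s(t) < 1], whence
    [Re (1 + z h'' / h') >= 1 - s(t) > 0].  Since [sigma_4 < sigma_2^2] strictly, the radius
    exceeds [sigma_2^(-1/2)], which is the second lower bound and dominates the first,
    [1 / sigma_1].

    Upper bounds.  If [f] vanishes at some [x > 0], then either [h'] vanishes on [(0, x]] or the
    expression [f / g] is zero at [x], so the radius is at most [x].  The alternating series of
    [f] is bounded above by its first five terms, and these add up to a negative number at
    [sigma_2 / sigma_3]; so [f] vanishes to the left of it.  This is the sharpest of the three
    upper bounds. *)

(** * Polynomials with positive reciprocal roots *)

(** Coefficients of the product of the factors [1 - x z], [x] in [l]. *)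
Fixpoint prod_coef (l : list R) (n : nat) : R :=
  match l with
  | nil => match n with O => 1 | S _ => 0 end
  | x :: l' => prod_coef l' n - x * match n with O => 0 | S m => prod_coef l' m end
  end.

Module RealRooted.
Import all_boot all_order all_algebra complex ring lra.
Import Order.TTheory GRing.Theory Num.Theory.
Local Open Scope ring_scope.
Local Open Scope complex_scope.

Section RR.
Variable R : rcfType.
Definition recip_prod (xs : seq R) : {poly R} := \prod_(x <- xs) (1 - x *: 'X).

Local Notation toC := (map_poly (real_complex R)).

Lemma recip_prod_cons x xs :
  recip_prod (x :: xs) = (1 - x *: 'X) * recip_prod xs.
Proof. by rewrite /recip_prod big_cons. Qed.

Lemma recip_prod_horner0 xs : (recip_prod xs).[0] = 1.
Proof.
rewrite /recip_prod horner_prod big1 // => x _.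
by rewrite hornerD hornerN hornerZ hornerX mulr0 subr0 hornerE.
Qed.

Lemma horner_factor x (z : R[i]) : (toC (1 - x *: 'X)).[z] = 1 - x%:C * z.
Proof. by rewrite rmorphB /= rmorph1 map_polyZ /= map_polyX !hornerE. Qed.

Lemma horner_recip_prod (xs : seq R) (z : R[i]) :
  (toC (recip_prod xs)).[z] = \prod_(x <- xs) (1 - x%:C * z).
Proof.
rewrite /recip_prod rmorph_prod horner_prod; apply: eq_bigr => x _.
exact: horner_factor.
Qed.

Lemma horner_deriv_recip_prod (xs : seq R) (z : R[i]) :
  (forall x, x \in xs -> 1 - x%:C * z != 0) ->
  z * (toC (recip_prod xs))^`().[z] =
  (toC (recip_prod xs)).[z] * \sum_(x <- xs) (1 - (1 - x%:C * z)^-1).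
Proof.
elim: xs => [|x xs IH] nz.
  by rewrite /recip_prod !big_nil rmorph1 derivC horner0 !mulr0.
have nzx : 1 - x%:C * z != 0 by apply: nz; rewrite mem_head.
have {}IH := IH (fun y hy => nz y (mem_behead (s := x :: xs) hy)).
rewrite recip_prod_cons rmorphM /= derivM hornerD !hornerM mulrDr.
rewrite big_cons horner_factor [X in _ + X]mulrCA IH deriv_map derivB derivZ derivX.
rewrite -polyC1 derivC sub0r rmorphN /= map_polyZ /= rmorph1 !hornerE.
rewrite /=; move: (toC _).[z] => A; set S := \sum_(_ <- _) _.
by rewrite -!/(GRing.mul _ _); field.
Qed.

Lemma Im_inv_factor x (z : R[i]) :
  complex.Im (1 - (1 - x%:C * z)^-1) =
  - (x * complex.Im z) / ((1 - x * complex.Re z) ^+ 2 + (x * complex.Im z) ^+ 2).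
Proof.
by case: z => a c /=; rewrite !mul0r !addr0 subr0 !sub0r opprK sqrrN mulNr.
Qed.

(** At a root [z] which is not one of the [1/x], the logarithmic derivative gives
    [b + sum (1 - 1 / (1 - x z)) = 0].  The imaginary part of the sum has the sign of
    [- Im z], which forces [z] to be real; and for [z <= 0] all terms of the sum are
    nonnegative, so the left-hand side is positive. *)
Lemma root_real_pos (b : R) (xs : seq R) (z : R[i]) :
  0 < b -> all (fun x => 0 < x) xs ->
  (toC (recip_prod xs)).[z] + (b%:C)^-1 * (z * (toC (recip_prod xs))^`().[z]) = 0 ->
  exists2 x : R, 0 < x & z = x%:C.
Proof.
move=> b0 xs0 eq0.
case: (boolP (all (fun x => 1 - x%:C * z != 0) xs)) => [/allP nz|]; last first.
  case/allPn => x xin; rewrite negbK subr_eq0 => /eqP xz.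
  have x0 := allP xs0 _ xin; exists x^-1; first by rewrite invr_gt0.
  have xC : x%:C != 0 by rewrite fmorph_eq0 gt_eqF.
  by rewrite fmorphV /= -[z](mulKf xC) -xz mulr1.
have bC : b%:C != 0 by rewrite fmorph_eq0 gt_eqF.
have fz : (toC (recip_prod xs)).[z] != 0.
  rewrite horner_recip_prod prodf_seq_neq0; apply/allP => x xin /=.
  exact: nz.
have {eq0} S0 : b%:C + \sum_(x <- xs) (1 - (1 - x%:C * z)^-1) = 0.
  move: eq0; rewrite horner_deriv_recip_prod // mulrCA -{1}[(toC _).[z]]mulr1 -mulrDr.
  move=> /eqP; rewrite mulf_eq0 (negbTE fz) /= => /eqP e.
  have := congr1 (fun u => b%:C * u) e.
  by rewrite mulr0 mulrDr mulr1 mulVKf.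
have ImS : \sum_(x <- xs) (- (x * complex.Im z) / ((1 - x * complex.Re z) ^+ 2 + (x * complex.Im z) ^+ 2)) = 0.
  under eq_bigr => x _ do rewrite -Im_inv_factor.
by have := congr1 (@complex.Im R) S0; rewrite raddfD /= add0r raddf_sum.
have Imz : complex.Im z = 0.
  apply/eqP/negPn/negP => iz.
  have sgn : forall ys : seq R, all (fun x => 0 < x) ys -> ys != [::] ->
     0 < \sum_(x <- ys) (x * (complex.Im z)^+2 / ((1 - x * complex.Re z) ^+ 2 + (x * complex.Im z) ^+ 2)).
    have pos x : 0 < x ->
      0 < x * (complex.Im z)^+2 / ((1 - x * complex.Re z) ^+ 2 + (x * complex.Im z) ^+ 2).
      move=> x0; apply: divr_gt0; first by rewrite mulr_gt0 // exprn_even_gt0.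
      apply: ltr_wpDl; first exact: sqr_ge0.
      by rewrite exprn_even_gt0 //= mulf_neq0 // gt_eqF.
    move=> [//|y ys] /= /andP[y0 ys0] _; rewrite big_cons.
    apply: ltr_wpDr; last exact: pos.
    rewrite big_seq; apply: sumr_ge0 => x xin; apply/ltW/pos.
    exact: (allP ys0).
  case: (altP (xs =P [::])) => [xs_nil|xsn].
    move: S0; rewrite xs_nil big_nil addr0 => /eqP; exact/negP.
  have := sgn _ xs0 xsn; rewrite -[X in _ < X]opprK.
  suff -> : - (\sum_(x <- xs) (x * (complex.Im z)^+2 / ((1 - x * complex.Re z) ^+ 2 + (x * complex.Im z) ^+ 2)))
     = complex.Im z * \sum_(x <- xs) (- (x * complex.Im z) / ((1 - x * complex.Re z) ^+ 2 + (x * complex.Im z) ^+ 2)).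
    by rewrite ImS mulr0 oppr0 ltxx.
  rewrite big_distrr /= -sumrN; apply: eq_bigr => x _.
  by rewrite -mulNr; ring.
have zR : z = (complex.Re z)%:C by case: z Imz {S0 ImS nz fz} => a c /= ->.
exists (complex.Re z) => //; rewrite ltNge; apply/negP => Rz.
have : 0 < b%:C + \sum_(x <- xs) (1 - (1 - x%:C * z)^-1).
  apply: ltr_wpDr; last by rewrite ltcR.
  rewrite big_seq; apply: sumr_ge0 => x xin; have x0 := allP xs0 _ xin.
  have d1 : 1 <= 1 - x * complex.Re z by rewrite lerDl oppr_ge0 pmulr_rle0.
  rewrite zR -rmorphM /= -[1](rmorph1 (real_complex R)) -rmorphB -fmorphV -rmorphB /=.
  rewrite lecR subr_ge0 invf_le1 //; exact: lt_le_trans d1.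
by rewrite S0 ltxx.
Qed.

(** The polynomial splits over the complex numbers, its roots are real and positive by the
    previous lemma, and its constant term is [1]; so it is the product of the factors
    [1 - z / q] over its roots [q]. *)
Lemma recip_prod_euler_op (b : R) (xs : seq R) :
  0 < b -> all (fun x => 0 < x) xs ->
  exists2 ys : seq R, all (fun y => 0 < y) ys &
    recip_prod xs + b^-1 *: ('X * (recip_prod xs)^`()) = recip_prod ys.
Proof.
move=> b0 xs0; set g := (_ + _).
have g0 : g.[0] = 1.
  rewrite /g hornerD hornerZ hornerM hornerX mul0r mulr0 addr0.
  exact: recip_prod_horner0.
have [rs Hrs] := closed_field_poly_normal (toC g).
have rsP z : z \in rs -> exists2 x : R, 0 < x & z = x%:C.
  move=> zin; apply: (@root_real_pos b xs) => //.
  have : (toC g).[z] = 0.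
    rewrite Hrs hornerZ; apply/eqP; rewrite mulf_eq0; apply/orP; right.
    by apply/eqP/rootP; rewrite root_prod_XsubC.
  rewrite /g rmorphD /= map_polyZ /= rmorphM /= map_polyX -deriv_map !hornerE.
  by rewrite fmorphV.
have [qs qs0 Eqs] : exists2 qs : seq R, all (fun x => 0 < x) qs & rs = map (real_complex R) qs.
  elim: rs rsP {Hrs} => [|z rs IH] rsP; first by exists [::].
  have [|qs qs0 ->] := IH; first by move=> y yin; apply: rsP; rewrite inE yin orbT.
  have [x x0 ->] := rsP z (mem_head _ _).
  by exists (x :: qs) => //=; rewrite x0.
have gE : g = lead_coef g *: \prod_(q <- qs) ('X - q%:P).
  apply: (map_poly_inj (real_complex R)); rewrite Hrs Eqs lead_coef_map map_polyZ /=.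
  congr (_ *: _); rewrite rmorph_prod big_map; apply: eq_bigr => q _.
  by rewrite rmorphB /= map_polyX map_polyC.
exists (map (fun q => q^-1) qs); first by rewrite all_map; apply: sub_all qs0 => q /=; rewrite invr_gt0.
have cE : g = (lead_coef g * \prod_(q <- qs) (- q)) *: recip_prod (map (fun q => q^-1) qs).
  rewrite {1}gE -scalerA; congr (_ *: _); rewrite /recip_prod big_map -scaler_prod.
  rewrite big_seq [RHS]big_seq; apply: eq_bigr => q qin.
  have q0 : q != 0 by rewrite gt_eqF // (allP qs0).
  by rewrite scalerBr scalerA mulNr mulfV // scaleN1r opprK addrC -mul_polyC mulr1 polyCN.
have c1 : lead_coef g * \prod_(q <- qs) (- q) = 1.
  by move: g0; rewrite {1}cE hornerZ recip_prod_horner0 mulr1.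
by rewrite cE c1 scale1r.
Qed.
End RR.

Arguments recip_prod {R}.
Arguments recip_prod_cons {R}.
Import Rstruct.
Lemma coef_recip_prod (l : seq R) n : (recip_prod l)`_n = prod_coef l n.
Proof.
elim: l n => [|x l IH] n.
  by rewrite /recip_prod big_nil coef1; case: n.
rewrite recip_prod_cons mulrBl mul1r coefB -scalerAl coefZ coefXM IH /=.
by case: n => [|n] //=; rewrite IH.
Qed.

Lemma all_pos_Forall (l : seq R) : all (fun x => 0 < x) l <-> List.Forall (Rlt (IZR 0)) l.
Proof.
elim: l => [|x l IH]; first by split.
split=> [/= /andP[x0 /IH l0]|H].
  by constructor=> //; apply/RltP.
inversion H; subst; rewrite /=; apply/andP; split; [exact/RltP|exact/IH].
Qed.

Lemma prod_coef_euler_op (b : R) (l : list R) :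
  Rlt (IZR 0) b -> List.Forall (Rlt (IZR 0)) l ->
  exists l' : list R, List.Forall (Rlt (IZR 0)) l' /\
    forall n, prod_coef l' n = Rmult (Rplus (IZR 1) (Rdiv (INR n) b)) (prod_coef l n).
Proof.
move=> b0 /all_pos_Forall l0.
have [|ys ys0 E] := recip_prod_euler_op _ b l _ l0; first exact/RltP.
exists ys; split; first exact/all_pos_Forall.
move=> n; rewrite -!coef_recip_prod -E coefD coefZ coefXM coef_deriv.
rewrite INRE RplusE RmultE RdivE R1E mulrDl mul1r; congr (_ + _).
case: n => [|n]; first by rewrite mulr0 mul0r mul0r.
by rewrite /= -[(_ *+ _)]mulr_natl; ring.
Qed.
End RealRooted.

(** * Formal power series and Newton sums *)

Definition ps_one (n : nat) : R := match n with O => 1 | S _ => 0 end.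
Definition ps_zero (n : nat) : R := 0.
Definition ps_add (a b : nat -> R) (n : nat) : R := a n + b n.
Definition ps_neg (a : nat -> R) (n : nat) : R := - a n.
Definition ps_sub (a b : nat -> R) (n : nat) : R := a n - b n.
Definition ps_tail (a : nat -> R) (n : nat) : R := a (S n).
Definition ps_theta (a : nat -> R) (n : nat) : R := INR n * a n.

Lemma ps_mult_0 (a b : nat -> R) : PS_mult a b 0 = a 0%nat * b 0%nat.
Proof. reflexivity. Qed.

Lemma ps_mult_S (a b : nat -> R) (n : nat) :
  PS_mult a b (S n) = a 0%nat * b (S n) + PS_mult (ps_tail a) b n.
Proof. unfold PS_mult. rewrite decomp_sum by lia. reflexivity. Qed.

Lemma ps_mult_ext (a a' b b' : nat -> R) (n : nat) :
  (forall k, (k <= n)%nat -> a k = a' k) -> (forall k, (k <= n)%nat -> b k = b' k) ->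
  PS_mult a b n = PS_mult a' b' n.
Proof.
intros Ha Hb; unfold PS_mult; apply sum_eq; intros i Hi.
now rewrite Ha, Hb by lia.
Qed.

Lemma ps_mult_add_l (a b c : nat -> R) (n : nat) :
  PS_mult (ps_add a b) c n = PS_mult a c n + PS_mult b c n.
Proof.
unfold PS_mult; rewrite <- plus_sum; apply sum_eq; intros; unfold ps_add; ring.
Qed.

Lemma ps_mult_scal_l (x : R) (a b : nat -> R) (n : nat) :
  PS_mult (fun k => x * a k) b n = x * PS_mult a b n.
Proof.
unfold PS_mult; rewrite scal_sum; apply sum_eq; intros; ring.
Qed.


Lemma ps_mult_0_l (a : nat -> R) (n : nat) : PS_mult ps_zero a n = 0.
Proof.
unfold PS_mult, ps_zero; rewrite (sum_eq _ (fun _ => 0)) by (intros; ring).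
rewrite sum_eq_R0; auto.
Qed.

Lemma ps_mult_1_l (a : nat -> R) (n : nat) : PS_mult ps_one a n = a n.
Proof.
destruct n as [|n]; [rewrite ps_mult_0; simpl; ring|].
rewrite ps_mult_S; change (ps_tail ps_one) with ps_zero.
rewrite ps_mult_0_l; simpl; ring.
Qed.

Lemma ps_mult_S_r (a b : nat -> R) (n : nat) :
  PS_mult a b (S n) = a (S n) * b 0%nat + PS_mult a (ps_tail b) n.
Proof.
unfold PS_mult; rewrite tech5, Nat.sub_diag, Rplus_comm; f_equal.
apply sum_eq; intros i Hi; unfold ps_tail; now replace (S n - i)%nat with (S (n - i)) by lia.
Qed.

Lemma ps_mult_comm (a b : nat -> R) (n : nat) : PS_mult a b n = PS_mult b a n.
Proof.
revert a b; induction n as [|n IH]; intros a b.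
  rewrite !ps_mult_0; ring.
rewrite ps_mult_S, ps_mult_S_r, IH; ring.
Qed.

Lemma ps_mult_assoc (a b c : nat -> R) (n : nat) :
  PS_mult a (PS_mult b c) n = PS_mult (PS_mult a b) c n.
Proof.
revert a b c; induction n as [|n IH]; intros a b c.
  rewrite !ps_mult_0; ring.
rewrite !ps_mult_S.
rewrite (ps_mult_ext (ps_tail (PS_mult a b))
  (ps_add (fun k => a 0%nat * ps_tail b k) (PS_mult (ps_tail a) b)) c c) ; auto.
  2: { intros k _; unfold ps_tail at 1; rewrite ps_mult_S; reflexivity. }
rewrite ps_mult_add_l, ps_mult_scal_l, <- IH, ps_mult_0; ring.
Qed.

Lemma ps_ring_theory :
  ring_theory ps_zero ps_one ps_add PS_mult ps_sub ps_neg (@eq (nat -> R)).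
Proof.
split; intros; apply functional_extensionality; intros n;
  unfold ps_add, ps_zero, ps_sub, ps_neg; try ring.
- apply ps_mult_1_l.
- apply ps_mult_comm.
- apply ps_mult_assoc.
- apply ps_mult_add_l.
Qed.
Add Ring ps_ring : ps_ring_theory.

Lemma ps_theta_mult (a b : nat -> R) :
  ps_theta (PS_mult a b) = ps_add (PS_mult (ps_theta a) b) (PS_mult a (ps_theta b)).
Proof.
apply functional_extensionality; intros n; unfold ps_theta at 1, ps_add.
unfold PS_mult; rewrite scal_sum, <- plus_sum; apply sum_eq; intros i Hi.
unfold ps_theta; rewrite minus_INR by lia; ring.
Qed.


Lemma ps_mult_le (a b b' : nat -> R) (n : nat) :
  (forall k, 0 <= a k) -> (forall k, (k <= n)%nat -> b k <= b' k) ->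
  PS_mult a b n <= PS_mult a b' n.
Proof.
intros Ha Hb; unfold PS_mult; apply sum_Rle; intros i Hi.
apply Rmult_le_compat_l; [apply Ha|apply Hb; lia].
Qed.

Lemma ps_mult_ge0 (a b : nat -> R) (n : nat) :
  (forall k, 0 <= a k) -> (forall k, (k <= n)%nat -> 0 <= b k) -> 0 <= PS_mult a b n.
Proof.
intros Ha Hb; rewrite <- (ps_mult_0_l a n), ps_mult_comm.
apply ps_mult_le; auto.
Qed.

(** Course-of-values recursion: the list holds the first [n + 1] coefficients of the inverse
    of a series with constant term [1], the last one first. *)
Fixpoint ps_inv_list (a : nat -> R) (n : nat) : list R :=
  match n with
  | O => 1 :: nil
  | S m => let l := ps_inv_list a m in
           - sum_f_R0 (fun i => a (S i) * nth i l 0) m :: l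
  end.
Definition ps_inv (a : nat -> R) (n : nat) : R := hd 0 (ps_inv_list a n).

Lemma nth_ps_inv_list (a : nat -> R) (n i : nat) :
  (i <= n)%nat -> nth i (ps_inv_list a n) 0 = ps_inv a (n - i).
Proof.
revert i; induction n as [|n IH]; intros i Hi.
  now replace i with 0%nat by lia.
destruct i as [|i]; [reflexivity|].
change (nth i (ps_inv_list a n) 0 = ps_inv a (n - i)); apply IH; lia.
Qed.

Lemma ps_inv_S (a : nat -> R) (n : nat) :
  ps_inv a (S n) = - PS_mult (ps_tail a) (ps_inv a) n.
Proof.
unfold ps_inv at 1; simpl; f_equal; unfold PS_mult; apply sum_eq; intros i Hi.
rewrite nth_ps_inv_list by lia; reflexivity.
Qed.

Lemma ps_mult_inv_r (a : nat -> R) : a 0%nat = 1 -> PS_mult a (ps_inv a) = ps_one.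
Proof.
intros Ha; apply functional_extensionality; intros [|n].
  rewrite ps_mult_0, Ha; unfold ps_inv; simpl; ring.
rewrite ps_mult_S, Ha, ps_inv_S; simpl; ring.
Qed.

(** The series [- z a' / a].  For a product of factors [1 - x z] its coefficients are the power
    sums of the [x], and Newton's identities are the equation [ps_newton a * a = - z a']. *)
Definition ps_newton (a : nat -> R) : nat -> R := ps_neg (PS_mult (ps_theta a) (ps_inv a)).

Lemma ps_newton_mult (a : nat -> R) :
  a 0%nat = 1 -> PS_mult (ps_newton a) a = ps_neg (ps_theta a).
Proof.
intros Ha; unfold ps_newton.
replace (PS_mult (ps_neg (PS_mult (ps_theta a) (ps_inv a))) a)
  with (PS_mult (ps_neg (ps_theta a)) (PS_mult a (ps_inv a))) by ring.
rewrite ps_mult_inv_r by assumption; ring.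
Qed.

Lemma ps_newton_unique (a s : nat -> R) :
  a 0%nat = 1 -> PS_mult s a = ps_neg (ps_theta a) -> s = ps_newton a.
Proof.
intros Ha Hs; unfold ps_newton.
replace (ps_neg (PS_mult (ps_theta a) (ps_inv a)))
  with (PS_mult (ps_neg (ps_theta a)) (ps_inv a)) by ring.
rewrite <- Hs.
replace (PS_mult (PS_mult s a) (ps_inv a)) with (PS_mult s (PS_mult a (ps_inv a))) by ring.
rewrite ps_mult_inv_r by assumption; ring.
Qed.

Lemma ps_newton_0 (a : nat -> R) : ps_newton a 0 = 0.
Proof. unfold ps_newton, ps_neg; rewrite ps_mult_0; unfold ps_theta; simpl; ring. Qed.

Lemma ps_newton_prod (a b : nat -> R) : a 0%nat = 1 -> b 0%nat = 1 ->
  ps_newton (PS_mult a b) = ps_add (ps_newton a) (ps_newton b).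
Proof.
intros Ha Hb; symmetry; apply ps_newton_unique.
  rewrite ps_mult_0, Ha, Hb; ring.
rewrite ps_theta_mult.
replace (PS_mult (ps_add (ps_newton a) (ps_newton b)) (PS_mult a b)) with
 (ps_add (PS_mult (PS_mult (ps_newton a) a) b) (PS_mult a (PS_mult (ps_newton b) b))) by ring.
rewrite !ps_newton_mult by assumption; ring.
Qed.

(** When [s = - z g' / g] has nonnegative coefficients, the series [g + z g'] equals
    [g (1 - s)], and its Newton sums dominate the coefficients of [1/(1-s)], hence those of
    [s] and of [1/g].  A growth bound on the Newton sums of [g + z g'] thus makes the series
    of [s], [1/g] and [1/(1-s)] converge together. *)
Section Compare.
Variable g : nat -> R.
Hypothesis g0 : g 0%nat = 1.
Hypothesis newton_ge0 : forall n, 0 <= ps_newton g n.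

Let s := ps_newton g.
Let d := ps_inv (ps_sub ps_one s).

Lemma ps_denom_0 : ps_sub ps_one s 0 = 1.
Proof. unfold ps_sub, s; rewrite ps_newton_0; simpl; ring. Qed.

Lemma ps_inv_newton_S (n : nat) : d (S n) = PS_mult (ps_tail s) d n.
Proof.
unfold d; rewrite ps_inv_S; fold d.
replace (ps_tail (ps_sub ps_one s)) with (fun k => -1 * ps_tail s k).
  rewrite ps_mult_scal_l; ring.
apply functional_extensionality; intros k; unfold ps_tail, ps_sub; simpl; ring.
Qed.

Lemma ps_theta_inv : ps_theta (ps_inv g) = PS_mult s (ps_inv g).
Proof.
assert (Z : ps_theta (PS_mult g (ps_inv g)) = ps_zero).
  rewrite ps_mult_inv_r by assumption.
  apply functional_extensionality; intros [|n]; unfold ps_theta, ps_zero; simpl; ring.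
rewrite ps_theta_mult in Z.
transitivity (PS_mult (ps_inv g) (PS_mult g (ps_theta (ps_inv g)))).
  replace (PS_mult (ps_inv g) (PS_mult g (ps_theta (ps_inv g))))
   with (PS_mult (PS_mult g (ps_inv g)) (ps_theta (ps_inv g))) by ring.
  rewrite ps_mult_inv_r by assumption; ring.
replace (PS_mult g (ps_theta (ps_inv g))) with (ps_neg (PS_mult (ps_theta g) (ps_inv g))).
  unfold s, ps_newton; ring.
transitivity (ps_sub ps_zero (PS_mult (ps_theta g) (ps_inv g))); [ring|].
rewrite <- Z; ring.
Qed.

Lemma ps_inv_rec (n : nat) : INR (S n) * ps_inv g (S n) = PS_mult (ps_tail s) (ps_inv g) n.
Proof.
change (ps_theta (ps_inv g) (S n) = PS_mult (ps_tail s) (ps_inv g) n).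
rewrite ps_theta_inv, ps_mult_S; unfold s at 1; rewrite ps_newton_0; ring.
Qed.

(** Both series solve a recursion driven by [s]: if [e = 1/g] and [d = 1/(1-s)], then
    [n e_n] and [d_n] are the same convolutions of [s] with the earlier coefficients, and
    [e] picks up an additional division by [n] at each step. *)
Lemma ps_inv_bounds (n : nat) : 0 <= ps_inv g n <= d n.
Proof.
induction n as [n IH] using (well_founded_induction Wf_nat.lt_wf).
destruct n as [|n]; [unfold d, ps_inv; simpl; lra|].
assert (H0 : 0 <= PS_mult (ps_tail s) (ps_inv g) n).
  apply ps_mult_ge0; [intros k; apply newton_ge0|intros k Hk; apply IH; lia].
assert (H1 : PS_mult (ps_tail s) (ps_inv g) n <= d (S n)).
  rewrite ps_inv_newton_S.
  apply ps_mult_le; [intros k; apply newton_ge0|intros k Hk; apply IH; lia].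
rewrite <- ps_inv_rec in H0, H1; rewrite S_INR in H0, H1.
assert (Hn := pos_INR n).
assert (0 <= ps_inv g (S n)) by nra.
split; nra.
Qed.

Lemma ps_newton_le_inv (n : nat) : s n <= d n.
Proof.
destruct n as [|n].
  unfold s; rewrite ps_newton_0; apply Rle_trans with (ps_inv g 0); apply ps_inv_bounds.
rewrite ps_inv_newton_S.
destruct n as [|n]; [rewrite ps_mult_0; unfold ps_tail, d, ps_inv; simpl; lra|].
rewrite ps_mult_S_r.
assert (0 <= PS_mult (ps_tail s) (ps_tail d) n).
  apply ps_mult_ge0; [intros k; apply newton_ge0|].
  intros k _; apply Rle_trans with (ps_inv g (S k)); apply ps_inv_bounds.
unfold ps_tail at 1; replace (d 0%nat) with 1 by reflexivity; lra.
Qed.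

Lemma ps_factor_newton : ps_add g (ps_theta g) = PS_mult g (ps_sub ps_one s).
Proof.
replace (PS_mult g (ps_sub ps_one s)) with (ps_sub g (PS_mult s g)) by ring.
unfold s; rewrite ps_newton_mult by assumption; ring.
Qed.

(** Logarithmic differentiation of [g (1 - s)]: the factor [1 - s] contributes [z s' / (1 - s)]. *)
Lemma ps_newton_euler_op :
  ps_newton (ps_add g (ps_theta g)) = ps_add s (PS_mult (ps_theta s) d).
Proof.
rewrite ps_factor_newton, ps_newton_prod by (assumption || apply ps_denom_0).
f_equal; unfold ps_newton; fold d.
replace (ps_theta (ps_sub ps_one s)) with (ps_neg (ps_theta s)); [ring|].
apply functional_extensionality; intros [|n]; unfold ps_theta, ps_neg, ps_sub; simpl; ring.
Qed.

Lemma ps_inv_le_newton (n : nat) :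
  s 1%nat * d n <= ps_newton (ps_add g (ps_theta g)) (S n).
Proof.
assert (d0 : forall k, 0 <= d k).
  intros k; apply Rle_trans with (ps_inv g k); apply ps_inv_bounds.
rewrite ps_newton_euler_op; unfold ps_add; rewrite ps_mult_S.
unfold ps_theta at 1; simpl INR; rewrite Rmult_0_l, Rmult_0_l.
assert (H := newton_ge0 (S n)); fold s in H.
enough (s 1%nat * d n <= PS_mult (ps_tail (ps_theta s)) d n) by lra.
destruct n as [|n].
  rewrite ps_mult_0; unfold ps_tail, ps_theta; simpl; lra.
rewrite ps_mult_S.
assert (0 <= PS_mult (ps_tail (ps_tail (ps_theta s))) d n).
  apply ps_mult_ge0; auto.
  intros k; unfold ps_tail, ps_theta; apply Rmult_le_pos; [apply pos_INR|apply newton_ge0].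
unfold ps_tail at 1, ps_theta at 1; simpl; lra.
Qed.
End Compare.

(** * The Laguerre-Polya class *)

Fixpoint power_sum (l : list R) (n : nat) : R :=
  match l with nil => 0 | x :: l' => x ^ n + power_sum l' n end.

Lemma power_sum_ge0 (l : list R) (n : nat) : List.Forall (Rlt 0) l -> 0 <= power_sum l n.
Proof.
induction 1 as [|x l x0 _ IH]; simpl; [lra|].
assert (0 < x ^ n) by now apply pow_lt. lra.
Qed.

Lemma power_sum_add_le (l : list R) (m n : nat) : List.Forall (Rlt 0) l ->
  power_sum l (m + n) <= power_sum l m * power_sum l n.
Proof.
induction 1 as [|x l x0 Hl IH]; simpl; [lra|].
rewrite pow_add.
assert (0 < x ^ n) by now apply pow_lt. assert (0 < x ^ m) by now apply pow_lt.
assert (Hm := power_sum_ge0 l m Hl). assert (Hn := power_sum_ge0 l n Hl). nra.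
Qed.

Lemma prod_coef_0 (l : list R) : prod_coef l 0 = 1.
Proof. induction l as [|x l IH]; simpl; [reflexivity|rewrite IH; ring]. Qed.

Definition ps_lin (x : R) (n : nat) : R :=
  match n with O => 1 | 1%nat => - x | _ => 0 end.

Lemma ps_mult_lin (x : R) (a : nat -> R) (n : nat) :
  PS_mult (ps_lin x) a n = a n - x * match n with O => 0 | S m => a m end.
Proof.
destruct n as [|n]; [rewrite ps_mult_0; simpl; ring|].
rewrite ps_mult_S.
replace (ps_tail (ps_lin x)) with (fun k => - x * ps_one k).
  rewrite ps_mult_scal_l, ps_mult_1_l; simpl; ring.
apply functional_extensionality; intros [|k]; unfold ps_tail; simpl; ring.
Qed.

Lemma prod_coef_cons (x : R) (l : list R) :
  prod_coef (x :: l) = PS_mult (ps_lin x) (prod_coef l).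
Proof. apply functional_extensionality; intros n; now rewrite ps_mult_lin. Qed.

Lemma ps_newton_lin (x : R) :
  ps_newton (ps_lin x) = fun n => match n with O => 0 | S _ => x ^ n end.
Proof.
symmetry; apply ps_newton_unique; [reflexivity|].
apply functional_extensionality; intros n; rewrite ps_mult_comm, ps_mult_lin.
unfold ps_neg, ps_theta; destruct n as [|[|n]]; simpl; ring.
Qed.

Lemma ps_newton_prod_coef (l : list R) (n : nat) :
  (1 <= n)%nat -> ps_newton (prod_coef l) n = power_sum l n.
Proof.
intros Hn; induction l as [|x l IH].
  unfold ps_newton, ps_neg; replace (ps_theta (prod_coef nil)) with ps_zero.
    rewrite ps_mult_0_l; simpl; ring.
  apply functional_extensionality; intros [|k]; unfold ps_theta, ps_zero; simpl; ring.
rewrite prod_coef_cons, ps_newton_prod by (reflexivity || apply prod_coef_0).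
unfold ps_add; rewrite IH, ps_newton_lin; destruct n; [lia|reflexivity].
Qed.

Lemma ps_mult_lim (a b : nat -> nat -> R) (a' b' : nat -> R) (n : nat) :
  (forall k, (k <= n)%nat -> is_lim_seq (fun M => a M k) (a' k)) ->
  (forall k, (k <= n)%nat -> is_lim_seq (fun M => b M k) (b' k)) ->
  is_lim_seq (fun M => PS_mult (a M) (b M) n) (PS_mult a' b' n).
Proof.
revert a a'; induction n as [|n IH]; intros a a' Ha Hb.
  apply is_lim_seq_mult'; auto.
apply is_lim_seq_ext with (fun M => a M 0%nat * b M (S n) + PS_mult (ps_tail (a M)) (b M) n).
  intros M; now rewrite ps_mult_S.
rewrite ps_mult_S; apply is_lim_seq_plus'.
  apply is_lim_seq_mult'; [apply Ha; lia|apply Hb; lia].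
apply (IH (fun M => ps_tail (a M))); [intros k Hk; apply Ha; lia|intros k Hk; apply Hb; lia].
Qed.

Lemma is_lim_seq_opp' (u : nat -> R) (l : R) :
  is_lim_seq u l -> is_lim_seq (fun n => - u n) (- l).
Proof. intros H; now apply (is_lim_seq_opp u l). Qed.

Lemma ps_inv_lim (a : nat -> nat -> R) (a' : nat -> R) :
  (forall k, is_lim_seq (fun M => a M k) (a' k)) ->
  forall n, is_lim_seq (fun M => ps_inv (a M) n) (ps_inv a' n).
Proof.
intros Ha n; induction n as [n IH] using (well_founded_induction Wf_nat.lt_wf).
destruct n as [|n]; [apply is_lim_seq_const|].
apply is_lim_seq_ext with (fun M => - PS_mult (ps_tail (a M)) (ps_inv (a M)) n).
  intros M; now rewrite ps_inv_S.
rewrite ps_inv_S; apply is_lim_seq_opp'.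
apply (ps_mult_lim (fun M => ps_tail (a M)) (fun M => ps_inv (a M))).
  intros k _; apply Ha.
intros k Hk; apply IH; lia.
Qed.

Lemma ps_newton_lim (a : nat -> nat -> R) (a' : nat -> R) :
  (forall k, is_lim_seq (fun M => a M k) (a' k)) ->
  forall n, is_lim_seq (fun M => ps_newton (a M) n) (ps_newton a' n).
Proof.
intros Ha n; unfold ps_newton, ps_neg; apply is_lim_seq_opp'.
apply (ps_mult_lim (fun M => ps_theta (a M)) (fun M => ps_inv (a M))).
  intros k _; unfold ps_theta; apply (is_lim_seq_scal_l _ _ (Finite (a' k))); apply Ha.
intros k _; now apply ps_inv_lim.
Qed.

(** Entire functions of Laguerre-Polya type with positive zeros and value [1] at the origin,
    described by approximating polynomials.  Convergence of each coefficient is all that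
    Newton sums require. *)
Definition laguerre_polya (f : nat -> R) : Prop :=
  exists l : nat -> list R, (forall M, List.Forall (Rlt 0) (l M)) /\
    forall n, is_lim_seq (fun M => prod_coef (l M) n) (f n).

Lemma laguerre_polya_newton_lim (f : nat -> R) : laguerre_polya f ->
  exists l : nat -> list R, (forall M, List.Forall (Rlt 0) (l M)) /\
    forall n, (1 <= n)%nat -> is_lim_seq (fun M => power_sum (l M) n) (ps_newton f n).
Proof.
intros (l & l0 & Hl); exists l; split; [exact l0|intros n Hn].
apply is_lim_seq_ext with (fun M => ps_newton (prod_coef (l M)) n).
  intros M; now apply ps_newton_prod_coef.
now apply (ps_newton_lim (fun M => prod_coef (l M))).
Qed.

Lemma laguerre_polya_newton_ge0 (f : nat -> R) : laguerre_polya f -> forall n, 0 <= ps_newton f n.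
Proof.
intros Hf [|n]; [rewrite ps_newton_0; lra|].
destruct (laguerre_polya_newton_lim f Hf) as (l & l0 & Hl).
assert (H := is_lim_seq_le (fun _ => 0) _ 0 _
  (fun M => power_sum_ge0 (l M) (S n) (l0 M)) (is_lim_seq_const 0) (Hl (S n) ltac:(lia))).
exact H.
Qed.

(** For nonnegative numbers the sum of the [x^(m+n)] is at most the product of the sums of
    the [x^m] and of the [x^n]; the inequality passes to the limit. *)
Lemma laguerre_polya_newton_add_le (f : nat -> R) (m n : nat) : laguerre_polya f ->
  (1 <= m)%nat -> (1 <= n)%nat ->
  ps_newton f (m + n) <= ps_newton f m * ps_newton f n.
Proof.
intros Hf Hm Hn; destruct (laguerre_polya_newton_lim f Hf) as (l & l0 & Hl).
exact (is_lim_seq_le _ _ _ (Finite (_ * _))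
  (fun M => power_sum_add_le (l M) m n (l0 M))
  (Hl (m + n)%nat ltac:(lia)) (is_lim_seq_mult' _ _ _ _ (Hl m Hm) (Hl n Hn))).
Qed.

Lemma laguerre_polya_ext (f f' : nat -> R) : (forall n, f n = f' n) -> laguerre_polya f -> laguerre_polya f'.
Proof. intros E; now replace f' with f by now apply functional_extensionality. Qed.

Lemma prod_coef_scale (c : R) (l : list R) (n : nat) :
  prod_coef (map (Rmult c) l) n = c ^ n * prod_coef l n.
Proof.
revert n; induction l as [|x l IH]; intros n; simpl.
  destruct n; simpl; ring.
rewrite IH; destruct n as [|n]; [simpl; ring|rewrite IH; simpl; ring].
Qed.

Lemma Forall_scale (c : R) (l : list R) :
  0 < c -> List.Forall (Rlt 0) l -> List.Forall (Rlt 0) (map (Rmult c) l).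
Proof.
intros c0; induction 1; simpl; constructor; auto; now apply Rmult_lt_0_compat.
Qed.

Lemma laguerre_polya_scale (c : R) (f : nat -> R) : 0 < c ->
  laguerre_polya f -> laguerre_polya (fun n => c ^ n * f n).
Proof.
intros c0 (l & l0 & Hl); exists (fun M => map (Rmult c) (l M)); split.
  intros M; now apply Forall_scale.
intros n; apply is_lim_seq_ext with (fun M => c ^ n * prod_coef (l M) n).
  intros M; now rewrite prod_coef_scale.
apply is_lim_seq_mult'; [apply is_lim_seq_const|apply Hl].
Qed.

Lemma laguerre_polya_euler_op (b : R) (f : nat -> R) : 0 < b ->
  laguerre_polya f -> laguerre_polya (fun n => (1 + INR n / b) * f n).
Proof.
intros b0 (l & l0 & Hl).
assert (H : forall M, exists l', List.Forall (Rlt 0) l' /\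
   forall n, prod_coef l' n = (1 + INR n / b) * prod_coef (l M) n).
  intros M; apply RealRooted.prod_coef_euler_op; auto.
apply functional_choice in H; destruct H as [l' H]; exists l'; split.
  intros M; apply H.
intros n; apply is_lim_seq_ext with (fun M => (1 + INR n / b) * prod_coef (l M) n).
  intros M; symmetry; apply H.
apply is_lim_seq_mult'; [apply is_lim_seq_const|apply Hl].
Qed.

Lemma poch_pos (a : R) (n : nat) : 0 < a -> 0 < poch a n.
Proof.
intros a0; induction n as [|n IH]; simpl; [lra|].
apply Rmult_lt_0_compat; auto. assert (H := pos_INR n); lra.
Qed.

Lemma poch_add (a : R) (m n : nat) : poch a (m + n) = poch a m * poch (a + INR m) n.
Proof.
induction n as [|n IH]; [rewrite Nat.add_0_r; simpl; ring|].
rewrite Nat.add_succ_r; simpl; rewrite IH, plus_INR; ring.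
Qed.

(** Apply the operators with [b = a, a + 1, ..., a + M - 1] in turn.  The product of the factors
    [1 + n / b] telescopes, because [(a)_(n+M)] can be split after [n] or after [M] factors. *)
Lemma prod_coef_euler_iter (a : R) (M : nat) (l : list R) : 0 < a -> List.Forall (Rlt 0) l ->
  exists l', List.Forall (Rlt 0) l' /\
   forall n, prod_coef l' n = poch (a + INR M) n / poch a n * prod_coef l n.
Proof.
intros a0 l0.
enough (H : exists l', List.Forall (Rlt 0) l' /\
   forall n, prod_coef l' n = poch (a + INR n) M / poch a M * prod_coef l n).
  destruct H as (l' & H0 & H); exists l'; split; [exact H0|intros n; rewrite H].
  assert (E : poch a n * poch (a + INR n) M = poch a M * poch (a + INR M) n).
    rewrite <- !poch_add; f_equal; lia.
  assert (Hn := poch_pos a n a0); assert (HM := poch_pos a M a0).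
  f_equal; apply (Rmult_eq_reg_l (poch a n * poch a M)).
    transitivity (poch a n * poch (a + INR n) M); [field; lra|rewrite E; field; lra].
  now apply Rgt_not_eq, Rmult_lt_0_compat.
induction M as [|M (l1 & H1 & IH)].
  exists l; split; auto; intros n; simpl; field.
assert (HM := pos_INR M).
destruct (RealRooted.prod_coef_euler_op (a + INR M) l1) as (l2 & H2 & E); [lra|exact H1|].
exists l2; split; [exact H2|intros n; rewrite E, IH; simpl].
assert (Hp := poch_pos a M a0); field; lra.
Qed.

Lemma poch_shift_lim (a : R) (n : nat) :
  is_lim_seq (fun M => poch (a + INR (S M)) n * (/ INR (S M)) ^ n) 1.
Proof.
induction n as [|n IH].
  apply is_lim_seq_ext with (fun _ => 1); [intros; simpl; ring|apply is_lim_seq_const].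
apply is_lim_seq_ext with
  (fun M => poch (a + INR (S M)) n * (/ INR (S M)) ^ n * (1 + (a + INR n) * / INR (S M))).
  intros M; assert (HM : INR (S M) <> 0) by (apply not_0_INR; lia).
  cbn [poch pow]; generalize ((/ INR (S M)) ^ n); intros q; field; exact HM.
replace (Finite 1) with (Finite (1 * (1 + (a + INR n) * 0))) by (f_equal; ring).
apply is_lim_seq_mult'; [exact IH|].
apply is_lim_seq_plus'; [apply is_lim_seq_const|].
apply is_lim_seq_mult'; [apply is_lim_seq_const|].
apply (is_lim_seq_incr_1 (fun M => / INR M)).
apply (is_lim_seq_inv INR p_infty); [apply is_lim_seq_INR|discriminate].
Qed.

(** The multiplier [(a + M)_n / (a)_n] preserves the class, and after the rescaling of [z] by
    [1/M] it tends to [1 / (a)_n]. *)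
Lemma laguerre_polya_div_poch (a : R) (f : nat -> R) : 0 < a ->
  laguerre_polya f -> laguerre_polya (fun n => f n / poch a n).
Proof.
intros a0 (l & l0 & Hl).
assert (H : forall M, exists l', List.Forall (Rlt 0) l' /\
   forall n, prod_coef l' n =
     poch (a + INR (S M)) n / poch a n * prod_coef (map (Rmult (/ INR (S M))) (l M)) n).
  intros M; apply prod_coef_euler_iter; [exact a0|apply Forall_scale; [|apply l0]].
  apply Rinv_0_lt_compat, lt_0_INR; lia.
apply functional_choice in H; destruct H as [l' H]; exists l'; split.
  intros M; apply H.
intros n; apply is_lim_seq_ext with
  (fun M => poch (a + INR (S M)) n * (/ INR (S M)) ^ n * (prod_coef (l M) n / poch a n)).
  intros M; rewrite (proj2 (H M)), prod_coef_scale; unfold Rdiv; ring.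
replace (Finite (f n / poch a n)) with (Finite (1 * (f n * / poch a n))) by (f_equal; unfold Rdiv; ring).
apply is_lim_seq_mult'; [apply poch_shift_lim|].
apply is_lim_seq_mult'; [apply Hl|apply is_lim_seq_const].
Qed.

(** The binomial theorem for [(1 - x z)^M], with the binomial coefficient written as
    [(-1)^n (-M)_n / n!], which vanishes for [n > M]. *)
Lemma prod_coef_repeat (x : R) (M n : nat) :
  prod_coef (repeat x M) n = (- x) ^ n / INR (fact n) * ((-1) ^ n * poch (- INR M) n).
Proof.
revert n; induction M as [|M IH]; intros n.
  destruct n as [|n]; [simpl; field|].
  assert (E : poch (- INR 0) (S n) = 0).
    change (S n) with (1 + n)%nat; rewrite poch_add; simpl; ring.
  rewrite E; simpl; ring.
simpl repeat; simpl prod_coef; rewrite IH.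
destruct n as [|n]; [simpl; field|].
rewrite IH.
assert (E : poch (- INR (S M)) (S n) = - INR (S M) * poch (- INR M) n).
  change (S n) with (1 + n)%nat; rewrite poch_add; rewrite S_INR; simpl.
  replace (- (INR M + 1) + 1) with (- INR M) by ring; ring.
rewrite E, fact_simpl, mult_INR, !S_INR; simpl.
field; split; [apply INR_fact_neq_0|]. assert (H := pos_INR n); lra.
Qed.

(** [exp(-z)] is the limit of [(1 - z/M)^M]. *)
Lemma laguerre_polya_exp : laguerre_polya (fun n => (-1) ^ n / INR (fact n)).
Proof.
exists (fun M => repeat (/ INR (S M)) (S M)); split.
  intros M; apply List.Forall_forall; intros x Hx; apply repeat_spec in Hx; subst x.
  apply Rinv_0_lt_compat, lt_0_INR; lia.
intros n.
apply is_lim_seq_ext with (fun M => (-1) ^ n / INR (fact n) *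
   (poch (- INR (S M)) n * (- / INR (S M)) ^ n * (-1) ^ n * (-1)^n)).
  intros M; rewrite prod_coef_repeat.
  enough (E : (-1)^n * (-1)^n = 1) by (unfold Rdiv; rewrite Rmult_assoc; replace
      (poch (- INR (S M)) n * (- / INR (S M)) ^ n * (-1) ^ n * (-1) ^ n) with (poch (- INR (S M)) n * (- / INR (S M)) ^ n * ((-1) ^ n * (-1) ^ n)) by ring; rewrite E; ring).
  rewrite <- Rpow_mult_distr; replace (-1 * -1) with 1 by ring; apply pow1.
replace (Finite ((-1) ^ n / INR (fact n))) with (Finite ((-1) ^ n / INR (fact n) * 1)) by (f_equal; ring).
apply is_lim_seq_mult'; [apply is_lim_seq_const|].
induction n as [|n IH].
  apply is_lim_seq_ext with (fun _ => 1); [intros; simpl; ring|apply is_lim_seq_const].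
apply is_lim_seq_ext with
  (fun M => poch (- INR (S M)) n * (- / INR (S M)) ^ n * (-1) ^ n * (-1) ^ n * (1 - INR n * / INR (S M))).
  intros M; assert (HM : INR (S M) <> 0) by (apply not_0_INR; lia).
  cbn [poch pow]; generalize ((- / INR (S M)) ^ n); intros q; field; exact HM.
replace (Finite 1) with (Finite (1 * (1 - INR n * 0))) by (f_equal; ring).
apply is_lim_seq_mult'; [exact IH|].
apply is_lim_seq_minus'; [apply is_lim_seq_const|].
apply is_lim_seq_mult'; [apply is_lim_seq_const|].
apply (is_lim_seq_incr_1 (fun M => / INR M)).
apply (is_lim_seq_inv INR p_infty); [apply is_lim_seq_INR|discriminate].
Qed.

(** * Complex power series with real coefficients *)

Definition is_cseries (u : nat -> C) (l : C) : Prop :=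
  is_series (fun n => Re (u n)) (Re l) /\ is_series (fun n => Im (u n)) (Im l).

Lemma C_ext (z w : C) : Re z = Re w -> Im z = Im w -> z = w.
Proof. destruct z, w; simpl; congruence. Qed.

Lemma Re_RtoC_mult (x : R) (z : C) : Re (RtoC x * z)%C = x * Re z.
Proof. destruct z; unfold Re; simpl; ring. Qed.

Lemma Im_RtoC_mult (x : R) (z : C) : Im (RtoC x * z)%C = x * Im z.
Proof. destruct z; unfold Im; simpl; ring. Qed.

Lemma is_cseries_unique (u : nat -> C) (l : C) : is_cseries u l -> CSeries u = l.
Proof.
intros [H1 H2]; apply C_ext; [exact (is_series_unique _ _ H1)|exact (is_series_unique _ _ H2)].
Qed.

Lemma is_cseries_ext (u v : nat -> C) (l : C) :
  (forall n, u n = v n) -> is_cseries u l -> is_cseries v l.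
Proof.
intros E [H1 H2]; split; (eapply is_series_ext; [|eassumption]); intros n; simpl; now rewrite E.
Qed.

Lemma is_cseries_plus (u v : nat -> C) (l m : C) :
  is_cseries u l -> is_cseries v m -> is_cseries (fun n => u n + v n)%C (l + m)%C.
Proof.
intros [H1 H2] [H3 H4]; split.
  exact (is_series_plus _ _ _ _ H1 H3).
exact (is_series_plus _ _ _ _ H2 H4).
Qed.

Lemma is_series_scal_R (x : R) (u : nat -> R) (l : R) :
  is_series u l -> is_series (fun n => x * u n) (x * l).
Proof. exact (is_series_scal x u l). Qed.

Lemma is_series_R0 : is_series (fun _ : nat => 0) 0.
Proof.
assert (H : Rabs 0 < 1) by (rewrite Rabs_R0; lra).
assert (H0 := is_series_scal_R 0 _ _ (is_series_geom 0 H)).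
rewrite Rmult_0_l in H0; apply is_series_ext with (2 := H0); intros; apply Rmult_0_l.
Qed.

Lemma is_cseries_scal (c : C) (u : nat -> C) (l : C) :
  is_cseries u l -> is_cseries (fun n => c * u n)%C (c * l)%C.
Proof.
intros [H1 H2]; split.
  apply (is_series_minus (fun n => Re c * Re (u n)) (fun n => Im c * Im (u n))
    (Re c * Re l) (Im c * Im l)); now apply is_series_scal_R.
apply (is_series_plus (fun n => Re c * Im (u n)) (fun n => Im c * Re (u n))
    (Re c * Im l) (Im c * Re l)); now apply is_series_scal_R.
Qed.

Lemma Cmod_sqr (z : C) : Cmod z * Cmod z = Re z * Re z + Im z * Im z.
Proof.
unfold Cmod; rewrite sqrt_sqrt; [unfold Re, Im; simpl; ring|].
apply Rplus_le_le_0_compat; apply pow2_ge_0.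
Qed.

Lemma Re_Im_le_Cmod (x y : R) (z : C) : x * Re z + y * Im z <= Cmod (x, y) * Cmod z.
Proof.
rewrite <- (Rabs_pos_eq (Cmod (x, y))), <- (Rabs_pos_eq (Cmod z)) by apply Cmod_ge_0.
rewrite <- Rabs_mult; apply Rle_trans with (Rabs (x * Re z + y * Im z)); [apply Rle_abs|].
apply Rsqr_le_abs_0; unfold Rsqr.
replace (Cmod (x, y) * Cmod z * (Cmod (x, y) * Cmod z))
  with ((Cmod (x, y) * Cmod (x, y)) * (Cmod z * Cmod z)) by ring.
rewrite !Cmod_sqr; unfold Re, Im; simpl.
assert (H := Rle_0_sqr (x * snd z - y * fst z)); unfold Rsqr in H; lra.
Qed.

(** Pair the series with its own sum [l]: [|l|^2] is the sum of the scalar products of [l] with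
    the terms, each at most [|l|] times the modulus of the term. *)
Lemma is_cseries_Cmod_le (u : nat -> C) (l : C) (v : nat -> R) (m : R) :
  is_cseries u l -> (forall n, Cmod (u n) <= v n) -> is_series v m -> Cmod l <= m.
Proof.
intros [H1 H2] Hle Hv.
assert (m0 : 0 <= m).
  rewrite <- (is_series_unique _ _ Hv).
  rewrite <- (is_series_unique _ _ is_series_R0).
  apply Series_le; [|now exists m].
  intros n; split; [lra|]. apply Rle_trans with (2 := Hle n), Cmod_ge_0.
destruct (Req_dec (Cmod l) 0) as [E|E]; [lra|].
assert (Hl := Cmod_ge_0 l).
enough (Cmod l * Cmod l <= Cmod l * m) by nra.
rewrite Cmod_sqr.
assert (H : is_series (fun n => Re l * Re (u n) + Im l * Im (u n)) (Re l * Re l + Im l * Im l)).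
  apply (is_series_plus (fun n => Re l * Re (u n)) (fun n => Im l * Im (u n))
    (Re l * Re l) (Im l * Im l)); now apply is_series_scal_R.
assert (H' := is_series_scal_R (Cmod l) _ _ Hv).
assert (L := is_lim_seq_le (sum_n (fun n => Re l * Re (u n) + Im l * Im (u n)))
   (sum_n (fun n => Cmod l * v n)) (Finite (Re l * Re l + Im l * Im l)) (Finite (Cmod l * m))).
apply L; [|exact H|exact H'].
intros n; apply sum_n_m_le; intros k.
apply Rle_trans with (1 := Re_Im_le_Cmod _ _ _).
replace (Re l, Im l) with l by (destruct l; reflexivity).
apply Rmult_le_compat_l; [apply Cmod_ge_0|apply Hle].
Qed.

Lemma Re_le_Cmod (z : C) : Rabs (Re z) <= Cmod z.
Proof. exact (Rle_trans _ _ _ (Rmax_l _ (Rabs (snd z))) (Rmax_Cmod z)). Qed.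

Lemma Im_le_Cmod (z : C) : Rabs (Im z) <= Cmod z.
Proof. exact (Rle_trans _ _ _ (Rmax_r (Rabs (fst z)) _) (Rmax_Cmod z)). Qed.

Lemma ex_series_cseries (u : nat -> C) (v : nat -> R) :
  (forall n, Cmod (u n) <= v n) -> ex_series v -> is_cseries u (CSeries u).
Proof.
intros Hle Hv; split; apply Series_correct;
  apply (@ex_series_le R_AbsRing R_CompleteNormedModule _ v); auto; intros n;
  apply Rle_trans with (2 := Hle n).
  apply Re_le_Cmod.
apply Im_le_Cmod.
Qed.

Definition abs_conv (a : nat -> R) (r : R) : Prop := ex_series (fun n => Rabs (a n) * r ^ n).
Definition entire (a : nat -> R) : Prop := forall r, 0 <= r -> abs_conv a r.

Definition CPS (a : nat -> R) (z : C) : C := CSeries (fun n => RtoC (a n) * z ^ n)%C.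

Lemma Cmod_term (a : nat -> R) (z : C) (n : nat) :
  Cmod (RtoC (a n) * z ^ n)%C = Rabs (a n) * Cmod z ^ n.
Proof. rewrite Cmod_mult, Cmod_R, Cmod_pow; reflexivity. Qed.

Lemma abs_conv_le (a : nat -> R) (r s : R) : 0 <= r <= s -> abs_conv a s -> abs_conv a r.
Proof.
intros H; apply (@ex_series_le R_AbsRing R_CompleteNormedModule); intros n.
change (norm (Rabs (a n) * r ^ n)) with (Rabs (Rabs (a n) * r ^ n)).
rewrite Rabs_pos_eq.
  apply Rmult_le_compat_l; [apply Rabs_pos|apply pow_incr; lra].
apply Rmult_le_pos; [apply Rabs_pos|apply pow_le; lra].
Qed.

Lemma CPS_correct (a : nat -> R) (z : C) :
  abs_conv a (Cmod z) -> is_cseries (fun n => RtoC (a n) * z ^ n)%C (CPS a z).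
Proof.
intros H; apply ex_series_cseries with (2 := H); intros n; rewrite Cmod_term; lra.
Qed.

Lemma CPS_Cmod_le (a : nat -> R) (z : C) (r : R) : Cmod z <= r ->
  abs_conv a r -> Cmod (CPS a z) <= Series (fun n => Rabs (a n) * r ^ n).
Proof.
intros Hz H; assert (Hz0 := Cmod_ge_0 z).
apply is_cseries_Cmod_le with (fun n => RtoC (a n) * z ^ n)%C (fun n => Rabs (a n) * r ^ n).
- apply CPS_correct, abs_conv_le with (2 := H); lra.
- intros n; rewrite Cmod_term; apply Rmult_le_compat_l; [apply Rabs_pos|apply pow_incr; lra].
- now apply Series_correct.
Qed.

Lemma CPS_opp (a : nat -> R) (z : C) : abs_conv a (Cmod z) ->
  CPS (fun n => - a n) z = (- CPS a z)%C.
Proof.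
intros Ha; apply is_cseries_unique.
apply is_cseries_ext with (fun n => - (1) * (RtoC (a n) * z ^ n))%C.
  intros n; rewrite RtoC_opp; ring.
replace (- CPS a z)%C with (- (1) * CPS a z)%C by ring.
now apply is_cseries_scal, CPS_correct.
Qed.

Lemma ex_series_abs_part (a : nat -> R) (z : C) (p : C -> R) :
  (forall w, Rabs (p w) <= Cmod w) -> abs_conv a (Cmod z) ->
  ex_series (fun n => Rabs (a n * p (z ^ n)%C)).
Proof.
intros Hp; apply (@ex_series_le R_AbsRing R_CompleteNormedModule); intros n.
change (norm (Rabs (a n * p (z ^ n)%C))) with (Rabs (Rabs (a n * p (z ^ n)%C))).
rewrite Rabs_Rabsolu, Rabs_mult, <- Cmod_pow.
apply Rmult_le_compat_l; [apply Rabs_pos|apply Hp].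
Qed.

Lemma CPS_parts (a : nat -> R) (z : C) : abs_conv a (Cmod z) ->
  is_series (fun n => a n * Re (z ^ n)%C) (Re (CPS a z)) /\
  is_series (fun n => a n * Im (z ^ n)%C) (Im (CPS a z)).
Proof.
intros Ha; destruct (CPS_correct a z Ha) as [H1 H2]; split.
  apply is_series_ext with (2 := H1); intros n; apply Re_RtoC_mult.
apply is_series_ext with (2 := H2); intros n; apply Im_RtoC_mult.
Qed.

(** Real and imaginary parts are real Cauchy products of absolutely convergent series. *)
Lemma is_cseries_mult (a b : nat -> R) (z : C) : abs_conv a (Cmod z) -> abs_conv b (Cmod z) ->
  is_cseries (fun n => RtoC (PS_mult a b n) * z ^ n)%C (CPS a z * CPS b z)%C.
Proof.
intros Ha Hb.
destruct (CPS_parts a z Ha) as [Ar Ai]; destruct (CPS_parts b z Hb) as [Br Bi].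
assert (Aar := ex_series_abs_part a z Re Re_le_Cmod Ha).
assert (Aai := ex_series_abs_part a z Im Im_le_Cmod Ha).
assert (Abr := ex_series_abs_part b z Re Re_le_Cmod Hb).
assert (Abi := ex_series_abs_part b z Im Im_le_Cmod Hb).
assert (P : forall k n, (k <= n)%nat -> (z ^ n = z ^ k * z ^ (n - k))%C).
  intros k n Hk; rewrite <- Cpow_add_r; f_equal; lia.
split.
  apply is_series_ext with (2 := is_series_minus _ _ _ _
    (is_series_mult _ _ _ _ Ar Br Aar Abr) (is_series_mult _ _ _ _ Ai Bi Aai Abi)).
  intros n.
  change (sum_f_R0 (fun k => a k * Re (z ^ k)%C * (b (n - k)%nat * Re (z ^ (n - k))%C)) n
     - sum_f_R0 (fun k => a k * Im (z ^ k)%C * (b (n - k)%nat * Im (z ^ (n - k))%C)) n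
     = Re (RtoC (PS_mult a b n) * z ^ n)%C).
  rewrite Re_RtoC_mult, Rmult_comm; unfold PS_mult; rewrite scal_sum, <- minus_sum.
  apply sum_eq; intros k Hk; rewrite (P k n Hk); unfold Re, Im; simpl; ring.
apply is_series_ext with (2 := is_series_plus _ _ _ _
    (is_series_mult _ _ _ _ Ar Bi Aar Abi) (is_series_mult _ _ _ _ Ai Br Aai Abr)).
intros n.
change (sum_f_R0 (fun k => a k * Re (z ^ k)%C * (b (n - k)%nat * Im (z ^ (n - k))%C)) n
   + sum_f_R0 (fun k => a k * Im (z ^ k)%C * (b (n - k)%nat * Re (z ^ (n - k))%C)) n
   = Im (RtoC (PS_mult a b n) * z ^ n)%C).
rewrite Im_RtoC_mult, Rmult_comm; unfold PS_mult; rewrite scal_sum, <- plus_sum.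
apply sum_eq; intros k Hk; rewrite (P k n Hk); unfold Re, Im; simpl; ring.
Qed.

Lemma CPS_mult (a b : nat -> R) (z : C) : abs_conv a (Cmod z) -> abs_conv b (Cmod z) ->
  CPS (PS_mult a b) z = (CPS a z * CPS b z)%C.
Proof. intros Ha Hb; now apply is_cseries_unique, is_cseries_mult. Qed.

(** The derivative in epsilon-delta form, stated with the modulus itself rather than with the
    neighbourhoods of a product space. *)
Definition cderiv (f : C -> C) (z l : C) : Prop :=
  forall eps, 0 < eps -> exists delta, 0 < delta /\
    forall k : C, Cmod k < delta -> Cmod (f (z + k) - f z - l * k)%C <= eps * Cmod k.

Lemma cderiv_is_derive (f : C -> C) (z l : C) :
  cderiv f z l -> @is_derive C_AbsRing C_NormedModule f z l.
Proof.
intros H; split; [apply is_linear_scal_l|].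
intros x Hx eps.
assert (E : z = x).
  apply (@is_filter_lim_locally_unique C_AbsRing (AbsRing_NormedModule C_AbsRing) z x); exact Hx.
subst x; clear Hx.
destruct (H eps (cond_pos eps)) as (d & d0 & Hd).
exists (mkposreal (d / 2) ltac:(lra)); intros y Hy.
change (Cmod (f y - f z - (y - z) * l)%C <= eps * Cmod (y - z)%C).
change (Cmod (y - z)%C < d / 2) in Hy; change C in y.
rewrite (Cmult_comm (y - z)%C l).
replace (f y) with (f (z + (y - z))%C) by (f_equal; ring).
apply Hd; lra.
Qed.

Lemma cderiv_C_derive (f : C -> C) (z l : C) : cderiv f z l -> C_derive f z = l.
Proof. intros H; now apply is_C_derive_unique, cderiv_is_derive. Qed.

Lemma cderiv_quadratic (f : C -> C) (z l : C) (M d : R) : 0 < d ->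
  (forall k, Cmod k < d -> Cmod (f (z + k) - f z - l * k)%C <= M * (Cmod k * Cmod k)) ->
  cderiv f z l.
Proof.
intros d0 H eps e0.
assert (HM : 0 < Rabs M + 1) by (assert (h := Rabs_pos M); lra).
exists (Rmin d (eps / (Rabs M + 1))); split.
  apply Rmin_pos; [exact d0|now apply Rdiv_lt_0_compat].
intros k Hk; assert (k0 := Cmod_ge_0 k).
apply Rle_trans with (1 := H k (Rlt_le_trans _ _ _ Hk (Rmin_l _ _))).
assert (H1 : Cmod k < eps / (Rabs M + 1)) by (apply (Rlt_le_trans _ _ _ Hk), Rmin_r).
apply (Rmult_lt_compat_r (Rabs M + 1)) in H1; [|exact HM].
replace (eps / (Rabs M + 1) * (Rabs M + 1)) with eps in H1 by (field; lra).
assert (H2 := Rle_abs M).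
assert (M * Cmod k <= eps) by nra. nra.
Qed.

Definition dpow (z : C) (n : nat) : C :=
  match n with O => RtoC 0 | S m => (RtoC (INR n) * z ^ m)%C end.

(** The second-order remainder of [z^n], by induction on [n]; [|k| <= 1] lets one factor
    [(|z| + 1)^n] absorb all powers of [z + k]. *)
Lemma pow_diff_bound (z k : C) (n : nat) : Cmod k <= 1 ->
  Cmod ((z + k) ^ n - z ^ n - dpow z n * k)%C
   <= (Cmod k * Cmod k) * (INR n * INR n * (Cmod z + 1) ^ n).
Proof.
intros Hk; assert (k0 := Cmod_ge_0 k); assert (z0 := Cmod_ge_0 z).
induction n as [|n IH].
  simpl; replace (1 - 1 - 0 * k)%C with (RtoC 0) by ring; rewrite Cmod_0; lra.
set (D := dpow z n) in *.
assert (HD : (D * z)%C = (RtoC (INR n) * z ^ n)%C).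
  unfold D, dpow; destruct n; [simpl; ring|simpl; ring].
change (dpow z (S n)) with (RtoC (INR (S n)) * z ^ n)%C.
replace ((z + k) ^ S n - z ^ S n - RtoC (INR (S n)) * z ^ n * k)%C with
 ((z + k) * ((z + k) ^ n - z ^ n - D * k) + D * (k * k))%C.
  2: { rewrite S_INR, RtoC_plus; simpl.
    replace ((z + k) * ((z + k) ^ n - z ^ n - D * k) + D * (k * k))%C
      with ((z + k) * (z + k) ^ n - z * z ^ n - k * z ^ n - (D * z) * k)%C by ring.
    rewrite HD; ring. }
assert (HDn : Cmod D <= INR n * (Cmod z + 1) ^ n).
  unfold D, dpow; destruct n as [|n]; [rewrite Cmod_0; simpl; lra|cbv iota].
  rewrite Cmod_mult, Cmod_R, Cmod_pow, Rabs_pos_eq by apply pos_INR.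
  apply Rmult_le_compat_l; [apply pos_INR|].
  apply Rle_trans with ((Cmod z + 1) ^ n); [apply pow_incr; lra|].
  apply Rle_pow; [lra|lia].
apply Rle_trans with (1 := Cmod_triangle _ _); rewrite !Cmod_mult.
assert (Hzk : Cmod (z + k)%C <= Cmod z + 1) by (apply Rle_trans with (1 := Cmod_triangle _ _); lra).
assert (n0 := pos_INR n).
assert (p0 : 0 <= (Cmod z + 1) ^ n) by (apply pow_le; lra).
rewrite S_INR; simpl pow.
set (p := (Cmod z + 1) ^ n) in *; set (Q := Cmod k * Cmod k) in *.
assert (Q0 : 0 <= Q) by (unfold Q; nra).
assert (H1 : Cmod (z + k)%C * Cmod ((z + k) ^ n - z ^ n - D * k)%C <= (Cmod z + 1) * (Q * (INR n * INR n * p))).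
  apply Rmult_le_compat; auto; apply Cmod_ge_0.
assert (H2 : Cmod D * Q <= INR n * p * Q) by (apply Rmult_le_compat_r; auto).
assert (H3 : 0 <= Q * p) by nra.
assert (H4 : 0 <= Q * p * INR n) by nra.
assert (H5 : 0 <= Q * p * INR n * Cmod z) by nra.
assert (H6 : 0 <= Q * p * Cmod z) by nra.
nra.
Qed.

Lemma sqr_le_4pow (n : nat) : INR n * INR n <= 4 ^ n.
Proof.
enough (INR n <= 2 ^ n).
  replace 4 with (2 * 2) by ring; rewrite Rpow_mult_distr.
  assert (H0 := pos_INR n); nra.
induction n as [|n IH]; [simpl; lra|].
rewrite S_INR; simpl; assert (1 <= 2 ^ n) by (apply pow_R1_Rle; lra); lra.
Qed.

Lemma entire_le (a b : nat -> R) (K : R) : entire a ->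
  (forall n, Rabs (b n) <= K ^ n * Rabs (a n)) -> 0 <= K -> entire b.
Proof.
intros Ha Hb HK r r0.
assert (H := Ha (K * r) ltac:(nra)); revert H.
apply (@ex_series_le R_AbsRing R_CompleteNormedModule); intros n.
change (norm (Rabs (b n) * r ^ n)) with (Rabs (Rabs (b n) * r ^ n)).
assert (p0 : 0 <= r ^ n) by now apply pow_le.
rewrite Rabs_pos_eq by (apply Rmult_le_pos; [apply Rabs_pos|exact p0]).
rewrite Rpow_mult_distr; specialize (Hb n); nra.
Qed.

Lemma entire_theta2 (a : nat -> R) : entire a -> entire (fun n => INR n * INR n * a n).
Proof.
intros Ha; apply entire_le with a 4; [exact Ha| |lra].
intros n; rewrite Rabs_mult, Rabs_pos_eq by (assert (h := pos_INR n); nra).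
apply Rmult_le_compat_r; [apply Rabs_pos|apply sqr_le_4pow].
Qed.

Lemma entire_theta (a : nat -> R) : entire a -> entire (fun n => INR n * a n).
Proof.
intros Ha; apply entire_le with a 4; [exact Ha| |lra].
intros n; rewrite Rabs_mult, Rabs_pos_eq by apply pos_INR.
apply Rmult_le_compat_r; [apply Rabs_pos|].
apply Rle_trans with (2 := sqr_le_4pow n).
destruct n; [simpl; lra|]. rewrite S_INR; assert (h := pos_INR n); nra.
Qed.

Lemma entire_tail (a : nat -> R) : entire a -> entire (fun n => a (S n)).
Proof.
intros Ha r r0.
assert (H := Ha (r + 1) ltac:(lra)).
apply ex_series_incr_1 in H; revert H.
apply (@ex_series_le R_AbsRing R_CompleteNormedModule); intros n.
assert (p0 : 0 <= r ^ n) by now apply pow_le.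
assert (a0 := Rabs_pos (a (S n))).
match goal with |- norm ?x <= _ => change (Rabs x <= Rabs (a (S n)) * (r + 1) ^ S n) end.
rewrite Rabs_pos_eq by (apply Rmult_le_pos; nra).
assert (r ^ n <= (r + 1) ^ n) by (apply pow_incr; lra).
simpl; apply Rmult_le_compat_l; [exact a0|nra].
Qed.

Lemma entire_derive (a : nat -> R) : entire a -> entire (PS_derive a).
Proof. intros Ha; exact (entire_tail _ (entire_theta a Ha)). Qed.

Lemma is_cseries_incr (u : nat -> C) (l : C) :
  is_cseries (fun n => u (S n)) l -> is_cseries u (u O + l)%C.
Proof.
intros [H1 H2]; split.
- apply is_series_decr_1.
  match goal with |- is_series _ ?x => replace x with (Re l) end; [exact H1|].
  unfold plus, opp, Re; simpl; ring.
- apply is_series_decr_1.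
  match goal with |- is_series _ ?x => replace x with (Im l) end; [exact H2|].
  unfold plus, opp, Im; simpl; ring.
Qed.

Lemma CPS_theta_derive (a : nat -> R) (z : C) : entire a ->
  CPS (fun n => INR n * a n) z = (z * CPS (PS_derive a) z)%C.
Proof.
intros Ha; apply is_cseries_unique.
replace (z * CPS (PS_derive a) z)%C with (RtoC (INR 0 * a O) * z ^ 0 + z * CPS (PS_derive a) z)%C
  by (simpl; rewrite Rmult_0_l; ring).
apply (is_cseries_incr (fun n => RtoC (INR n * a n) * z ^ n)%C).
apply is_cseries_ext with (fun n => z * (RtoC (PS_derive a n) * z ^ n))%C.
  intros n; unfold PS_derive; simpl; ring.
apply is_cseries_scal, CPS_correct, entire_derive; [exact Ha|apply Cmod_ge_0].
Qed.

(** Summing the remainders of the monomials gives a bound of order [|k|^2]. *)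
Lemma CPS_cderiv (a : nat -> R) (z : C) : entire a -> cderiv (CPS a) z (CPS (PS_derive a) z).
Proof.
intros Ha; assert (z0 := Cmod_ge_0 z).
assert (H2 := entire_theta2 a Ha (Cmod z + 1) ltac:(lra)).
apply cderiv_quadratic with (Series (fun n => Rabs (INR n * INR n * a n) * (Cmod z + 1) ^ n)) 1; [lra|].
intros k Hk; rewrite Rmult_comm.
set (d := fun n => match n with O => RtoC 0 | S m => (RtoC (a n) * RtoC (INR n) * z ^ m)%C end).
assert (Hd : is_cseries d (CPS (PS_derive a) z)).
  replace (CPS (PS_derive a) z) with (d O + CPS (PS_derive a) z)%C by (unfold d; ring).
  apply is_cseries_incr.
  apply is_cseries_ext with (fun n => RtoC (PS_derive a n) * z ^ n)%C.
    intros n; unfold d, PS_derive; rewrite RtoC_mult; ring.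
  apply CPS_correct, entire_derive; auto.
assert (Hs := is_cseries_plus _ _ _ _
  (is_cseries_plus _ _ _ _ (CPS_correct a (z + k) (Ha _ (Cmod_ge_0 _)))
     (is_cseries_scal (- (1))%C _ _ (CPS_correct a z (Ha _ z0))))
  (is_cseries_scal (- k)%C _ _ Hd)).
replace (CPS a (z + k) - CPS a z - CPS (PS_derive a) z * k)%C with
 (CPS a (z + k) + - (1) * CPS a z + - k * CPS (PS_derive a) z)%C
 by ring.
refine (is_cseries_Cmod_le _ _ _ _ Hs _ (is_series_scal_R (Cmod k * Cmod k) _ _ (Series_correct _ H2))).
intros n; cbv beta.
replace (RtoC (a n) * (z + k) ^ n + - (1) * (RtoC (a n) * z ^ n) + - k * d n)%C with
  (RtoC (a n) * ((z + k) ^ n - z ^ n - dpow z n * k))%C.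
  2: { unfold d, dpow; destruct n; ring. }
rewrite Cmod_mult, Cmod_R, Rabs_mult, (Rabs_pos_eq (INR n * INR n)) by (assert (h := pos_INR n); nra).
assert (HB := pow_diff_bound z k n ltac:(lra)).
apply (Rmult_le_compat_l (Rabs (a n))) in HB; [|apply Rabs_pos].
lra.
Qed.

(** * The Gamma function *)

Definition gamma_integrand (x t : R) : R := Rpower t (x - 1) * exp (- t).

Lemma is_derive_Rpower (a t : R) : 0 < t ->
  is_derive (fun t => Rpower t a) t (a * Rpower t (a - 1)).
Proof. intros t0; apply is_derive_Reals; now apply derivable_pt_lim_power. Qed.

Lemma is_derive_exp_opp (t : R) : is_derive (fun t => exp (- t)) t (- exp (- t)).
Proof. auto_derive; [trivial|ring]. Qed.

Lemma gamma_integrand_pos (x t : R) : 0 < gamma_integrand x t.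
Proof. apply Rmult_lt_0_compat; apply exp_pos. Qed.

Lemma gamma_integrand_continuous (x t : R) : 0 < t -> continuous (gamma_integrand x) t.
Proof.
intros t0; apply (@continuous_mult R_UniformSpace R_AbsRing).
  apply (ex_derive_continuous (fun t => Rpower t (x - 1))); eexists; now apply is_derive_Rpower.
apply (ex_derive_continuous (fun t => exp (- t))); eexists; apply is_derive_exp_opp.
Qed.

Lemma gamma_integrand_RInt (x a b : R) : 0 < a -> 0 < b -> ex_RInt (gamma_integrand x) a b.
Proof.
intros a0 b0; apply (@ex_RInt_continuous R_CompleteNormedModule); intros t Ht.
apply gamma_integrand_continuous. assert (0 < Rmin a b) by now apply Rmin_pos. lra.
Qed.

Definition gamma_primitive (x t : R) : R := RInt (gamma_integrand x) 1 t.

Lemma gamma_primitive_derive (x t : R) : 0 < t -> is_derive (gamma_primitive x) t (gamma_integrand x t).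
Proof.
intros t0; apply is_derive_RInt with 1; [|now apply gamma_integrand_continuous].
exists (mkposreal _ t0); intros y Hy.
apply (RInt_correct (V := R_CompleteNormedModule)), gamma_integrand_RInt; [lra|].
change (Rabs (y - t) < t) in Hy; apply Rabs_def2 in Hy; lra.
Qed.

Lemma gamma_primitive_incr (x s t : R) : 0 < s <= t -> gamma_primitive x s <= gamma_primitive x t.
Proof.
intros Hst; unfold gamma_primitive.
rewrite <- (RInt_Chasles (gamma_integrand x) 1 s t) by (apply gamma_integrand_RInt; lra).
assert (0 <= RInt (gamma_integrand x) s t).
  apply RInt_ge_0; [lra|apply gamma_integrand_RInt; lra|intros; left; apply gamma_integrand_pos].
change (RInt (gamma_integrand x) 1 s <= RInt (gamma_integrand x) 1 s + RInt (gamma_integrand x) s t); lra.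
Qed.

(** On [(0, 1]] the integrand is at most [t^(x-1)], whose integral is at most [1/x]. *)
Lemma gamma_primitive_lower (x s : R) : 0 < x -> 0 < s <= 1 -> - / x <= gamma_primitive x s.
Proof.
intros x0 Hs; unfold gamma_primitive; rewrite <- opp_RInt_swap by (apply gamma_integrand_RInt; lra).
change (- / x <= - RInt (gamma_integrand x) s 1); apply Ropp_le_contravar.
assert (HI : is_RInt (fun t => Rpower t (x - 1)) s 1 (minus (Rpower 1 x / x) (Rpower s x / x))).
  apply (is_RInt_derive (fun t => Rpower t x / x)).
    intros t Ht; rewrite Rmin_left, Rmax_right in Ht by lra.
    replace (Rpower t (x - 1)) with (/ x * (x * Rpower t (x - 1))) by (field; lra).
    apply is_derive_ext with (fun t => / x * Rpower t x); [intros; unfold Rdiv; apply Rmult_comm|].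
    apply (is_derive_scal (fun t => Rpower t x)), is_derive_Rpower; lra.
  intros t Ht; rewrite Rmin_left, Rmax_right in Ht by lra.
  apply (ex_derive_continuous (fun t => Rpower t (x - 1))); eexists; apply is_derive_Rpower; lra.
apply Rle_trans with (RInt (fun t => Rpower t (x - 1)) s 1).
  apply RInt_le; [lra|apply gamma_integrand_RInt; lra|eexists; exact HI|].
  intros t Ht; unfold gamma_integrand; rewrite <- (Rmult_1_r (Rpower t (x - 1))) at 2.
  apply Rmult_le_compat_l; [left; apply exp_pos|].
  rewrite <- exp_0; left; apply exp_increasing; lra.
rewrite (is_RInt_unique _ _ _ _ HI); change (Rpower 1 x / x - Rpower s x / x <= / x).
unfold Rpower at 1; rewrite ln_1, Rmult_0_r, exp_0.
assert (0 < Rpower s x / x) by (apply Rdiv_lt_0_compat; [apply exp_pos|lra]).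
unfold Rdiv at 1; lra.
Qed.

(** From [ln (t / c) <= t / c] with [c > 2 |a|]. *)
Lemma Rpower_le_exp_half (a : R) : exists K, 0 < K /\
  forall t, 1 <= t -> Rpower t a <= K * exp (t / 2).
Proof.
set (c := 2 * Rabs a + 1). assert (a0 := Rabs_pos a). assert (c0 : 1 <= c) by (unfold c; lra).
exists (exp (Rabs a * ln c)); split; [apply exp_pos|intros t Ht].
rewrite <- exp_plus; unfold Rpower.
assert (L0 : 0 <= ln t) by (destruct Ht; [left; rewrite <- ln_1; apply ln_increasing; lra|subst; rewrite ln_1; lra]).
assert (L : ln t <= t / c + ln c).
  replace t with (t / c * c) at 1 by (field; lra).
  assert (0 < t / c) by (apply Rdiv_lt_0_compat; lra).
  rewrite ln_mult by lra.
  enough (ln (t / c) <= t / c) by lra.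
  apply Rlt_le, Rlt_le_trans with (ln (exp (t / c))).
    apply ln_increasing; [lra|]. assert (H1 := exp_ineq1 (t / c)). lra.
  rewrite ln_exp; lra.
assert (E : a * ln t <= Rabs a * ln c + t / 2).
  apply Rle_trans with (Rabs a * ln t).
    apply Rmult_le_compat_r; [exact L0|apply Rle_abs].
  apply Rle_trans with (Rabs a * (t / c + ln c)); [apply Rmult_le_compat_l; lra|].
  enough (Rabs a * (t / c) <= t / 2) by lra.
  apply Rmult_le_reg_r with (2 * c); [lra|].
  replace (Rabs a * (t / c) * (2 * c)) with (2 * Rabs a * t) by (field; lra).
  replace (t / 2 * (2 * c)) with (c * t) by field. unfold c; nra.
destruct E as [E|E]; [left; now apply exp_increasing|right; now rewrite E].
Qed.

Lemma gamma_primitive_upper (x : R) : exists K, forall t, 1 <= t -> gamma_primitive x t <= K.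
Proof.
destruct (Rpower_le_exp_half (x - 1)) as (K & K0 & HK); exists (2 * K); intros t Ht.
assert (HI : is_RInt (fun s => K * exp (- s / 2)) 1 t
   (minus (-2 * K * exp (- t / 2)) (-2 * K * exp (- (1) / 2)))).
  apply (is_RInt_derive (fun s => -2 * K * exp (- s / 2))).
    intros s _; auto_derive; [trivial|unfold Rdiv; generalize (exp (- s * / 2)); intros e; field].
  intros s _; apply (ex_derive_continuous (fun s => K * exp (- s / 2))); auto_derive; trivial.
unfold gamma_primitive; apply Rle_trans with (RInt (fun s => K * exp (- s / 2)) 1 t).
  apply RInt_le; [lra|apply gamma_integrand_RInt; lra|eexists; exact HI|].
  intros s Hs; unfold gamma_integrand.
  replace (- s / 2) with (s / 2 + - s) by field; rewrite exp_plus, <- Rmult_assoc.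
  apply Rmult_le_compat_r; [left; apply exp_pos|apply HK; lra].
rewrite (is_RInt_unique _ _ _ _ HI).
change (-2 * K * exp (- t / 2) - -2 * K * exp (- (1) / 2) <= 2 * K).
assert (H1 := Rmult_lt_0_compat _ _ K0 (exp_pos (- t / 2))).
assert (H2 : exp (- (1) / 2) <= 1) by (apply Rle_trans with (exp 0); [left; apply exp_increasing; lra|rewrite exp_0; lra]).
apply (Rmult_le_compat_l K) in H2; lra.
Qed.

Lemma mono_lim_0 (F : R -> R) (m : R) :
  (forall s t, 0 < s <= t -> F s <= F t) -> (forall s, 0 < s <= 1 -> m <= F s) ->
  exists l, filterlim F (at_right 0) (locally l) /\ l <= F 1.
Proof.
intros Hi Hm.
destruct (completeness (fun y => exists s, 0 < s <= 1 /\ y = - F s)) as [l [Hu Hl]].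
- exists (- m); intros y (s & Hs & ->); specialize (Hm s Hs); lra.
- exists (- F 1), 1; split; [lra|reflexivity].
- exists (- l); split.
  + apply filterlim_locally; intros eps.
    destruct (classic (exists s, 0 < s <= 1 /\ l - eps < - F s)) as [(s & Hs & E)|N].
    * exists (mkposreal s (proj1 Hs)); intros y Hy y0.
      change (Rabs (y - 0) < s) in Hy; rewrite Rminus_0_r, Rabs_pos_eq in Hy by lra.
      change (Rabs (F y - - l) < eps).
      assert (H1 : - F y <= l) by (apply Hu; exists y; split; [lra|reflexivity]).
      assert (H2 := Hi y s ltac:(lra)).
      apply Rabs_def1; lra.
    * exfalso; assert (e0 := cond_pos eps).
      enough (l <= l - eps) by lra.
      apply Hl; intros y (s & Hs & ->). apply Rnot_lt_le; intros H; apply N.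
      exists s; split; assumption.
  + enough (- F 1 <= l) by lra. apply Hu; exists 1; split; [lra|reflexivity].
Qed.

Lemma mono_lim_infty (F : R -> R) (m : R) :
  (forall s t, 0 < s <= t -> F s <= F t) -> (forall s, 1 <= s -> F s <= m) ->
  exists l, filterlim F (Rbar_locally p_infty) (locally l) /\ F 2 <= l.
Proof.
intros Hi Hm.
destruct (completeness (fun y => exists s, 1 <= s /\ y = F s)) as [l [Hu Hl]].
- exists m; intros y (s & Hs & ->); exact (Hm s Hs).
- exists (F 1), 1; split; [lra|reflexivity].
- exists l; split.
  + apply filterlim_locally; intros eps.
    destruct (classic (exists s, 1 <= s /\ l - eps < F s)) as [(s & Hs & E)|N].
    * exists s; intros y Hy.
      change (Rabs (F y - l) < eps).
      assert (H1 : F y <= l) by (apply Hu; exists y; split; [lra|reflexivity]).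
      assert (H2 := Hi s y ltac:(lra)).
      apply Rabs_def1; lra.
    * exfalso; assert (e0 := cond_pos eps).
      enough (l <= l - eps) by lra.
      apply Hl; intros y (s & Hs & ->). apply Rnot_lt_le; intros H; apply N.
      exists s; split; assumption.
  + apply Hu; exists 2; split; [lra|reflexivity].
Qed.

Lemma filter_prod_pos (P : R * R -> Prop) :
  (forall a b, 0 < a -> 1 < b -> P (a, b)) ->
  filter_prod (at_right 0) (Rbar_locally p_infty) P.
Proof.
intros H; apply (Filter_prod _ _ _ (fun a => 0 < a) (fun b => 1 < b)).
- exists (mkposreal 1 Rlt_0_1); intros y _ Hy; exact Hy.
- exists 1; intros y Hy; exact Hy.
- intros a b Ha Hb; now apply H.
Qed.

(** The fundamental theorem of calculus on [(0, +oo)], for a primitive having limits at both ends. *)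
Lemma is_RInt_gen_pos_Derive (F f : R -> R) (la lb : R) :
  (forall t, 0 < t -> is_derive F t (f t)) -> (forall t, 0 < t -> continuous f t) ->
  filterlim F (at_right 0) (locally la) -> filterlim F (Rbar_locally p_infty) (locally lb) ->
  is_RInt_gen f (at_right 0) (Rbar_locally p_infty) (lb - la).
Proof.
intros HF Hf Ha Hb.
assert (pos : forall a b t, 0 < a -> 1 < b -> Rmin a b <= t -> 0 < t).
  intros a b t a0 b0 Ht; assert (0 < Rmin a b) by (apply Rmin_pos; lra); lra.
apply is_RInt_gen_ext with (Derive F).
  apply filter_prod_pos; intros a b a0 b0 t Ht; simpl in Ht.
  apply is_derive_unique, HF, (pos a b); [exact a0|exact b0|lra].
apply is_RInt_gen_Derive; auto; apply filter_prod_pos; intros a b a0 b0 t Ht; simpl in Ht.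
  exists (f t); apply HF, (pos a b); lra.
assert (t0 : 0 < t) by (apply (pos a b); lra).
apply (continuous_ext_loc _ f); [|now apply Hf].
exists (mkposreal _ t0); intros y Hy; symmetry; apply is_derive_unique, HF.
change (Rabs (y - t) < t) in Hy; apply Rabs_def2 in Hy; lra.
Qed.

(** The primitive [gamma_primitive x] increases and is bounded on both sides, so it has limits at [0]
    and at infinity.  As it vanishes at [1], the first limit is at most [0] and the second is
    at least the integral over [[1, 2]]. *)
Lemma is_gamma (x : R) : 0 < x ->
  is_RInt_gen (gamma_integrand x) (at_right 0) (Rbar_locally p_infty) (Gamma x) /\ 0 < Gamma x.
Proof.
intros x0.
destruct (mono_lim_0 (gamma_primitive x) (- / x) (gamma_primitive_incr x) (fun s => gamma_primitive_lower x s x0)) as (la & Hla & La).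
destruct (gamma_primitive_upper x) as [K HK].
destruct (mono_lim_infty (gamma_primitive x) K (gamma_primitive_incr x) HK) as (lb & Hlb & Lb).
assert (H := is_RInt_gen_pos_Derive _ _ _ _ (gamma_primitive_derive x) (gamma_integrand_continuous x) Hla Hlb).
assert (E : Gamma x = lb - la)
  by exact (is_RInt_gen_unique (V := R_CompleteNormedModule) _ _ H).
rewrite E; split; [exact H|].
assert (E1 : gamma_primitive x 1 = 0) by (unfold gamma_primitive; rewrite RInt_point; reflexivity).
assert (0 < gamma_primitive x 2); [|lra].
apply RInt_gt_0; [lra|intros; apply gamma_integrand_pos|].
intros t Ht; apply gamma_integrand_continuous; lra.
Qed.

Lemma Gamma_pos (x : R) : 0 < x -> 0 < Gamma x.
Proof. intros x0; now apply is_gamma. Qed.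

(** The difference of the two integrands is the derivative of [t^x exp(-t)], which vanishes at
    both ends. *)
Lemma Gamma_succ (x : R) : 0 < x -> Gamma (x + 1) = x * Gamma x.
Proof.
intros x0.
destruct (is_gamma x x0) as [H _]; destruct (is_gamma (x + 1) ltac:(lra)) as [H1 _].
set (G := fun t => Rpower t x * exp (- t)).
assert (G0 : filterlim G (at_right 0) (locally 0)).
  apply filterlim_locally; intros eps.
  assert (d0 : 0 < Rpower eps (/ x)) by apply exp_pos.
  exists (mkposreal _ d0); intros t Ht t0.
  change (Rabs (t - 0) < Rpower eps (/ x)) in Ht; rewrite Rminus_0_r, Rabs_pos_eq in Ht by lra.
  change (Rabs (G t - 0) < eps); rewrite Rminus_0_r; unfold G.
  assert (p1 : 0 < Rpower t x) by apply exp_pos; assert (p2 : 0 < exp (- t)) by apply exp_pos.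
  rewrite Rabs_pos_eq by (apply Rlt_le, Rmult_lt_0_compat; assumption).
  assert (p3 : exp (- t) < 1) by (rewrite <- exp_0; apply exp_increasing; lra).
  assert (p4 : Rpower t x < eps).
    replace (pos eps) with (Rpower (Rpower eps (/ x)) x).
      apply Rlt_Rpower_l; lra.
    rewrite Rpower_mult, Rinv_l, Rpower_1 by (lra || apply cond_pos); reflexivity.
  nra.
assert (Ginf : filterlim G (Rbar_locally p_infty) (locally 0)).
  destruct (Rpower_le_exp_half x) as (K & K0 & HK).
  apply filterlim_locally; intros eps.
  assert (e0 := cond_pos eps).
  exists (Rmax 1 (2 * K / eps)); intros t Ht.
  assert (t1 := Rle_lt_trans _ _ _ (Rmax_l _ _) Ht).
  assert (t2 := Rle_lt_trans _ _ _ (Rmax_r _ _) Ht).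
  change (Rabs (G t - 0) < eps); rewrite Rminus_0_r; unfold G.
  assert (p1 : 0 < Rpower t x) by apply exp_pos; assert (p2 : 0 < exp (- t)) by apply exp_pos.
  rewrite Rabs_pos_eq by (apply Rlt_le, Rmult_lt_0_compat; assumption).
  apply Rle_lt_trans with (K * exp (- (t / 2))).
    replace (- (t / 2)) with (t / 2 + - t) by field; rewrite exp_plus, <- Rmult_assoc.
    apply Rmult_le_compat_r; [lra|apply HK; lra].
  rewrite exp_Ropp.
  assert (p3 : t / 2 < exp (t / 2)) by (assert (h := exp_ineq1 (t / 2)); lra).
  apply Rmult_lt_reg_r with (exp (t / 2)); [apply exp_pos|].
  replace (K * / exp (t / 2) * exp (t / 2)) with K by (field; apply Rgt_not_eq, exp_pos).
  apply (Rmult_lt_compat_r eps) in t2; [|exact e0].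
  replace (2 * K / eps * eps) with (2 * K) in t2 by (field; lra). nra.
assert (HG := is_RInt_gen_pos_Derive G (fun t => x * gamma_integrand x t - gamma_integrand (x + 1) t) 0 0).
assert (HD : is_RInt_gen (fun t => minus (scal x (gamma_integrand x t)) (gamma_integrand (x + 1) t)) (at_right 0)
     (Rbar_locally p_infty) (minus (scal x (Gamma x)) (Gamma (x + 1)))).
  exact (is_RInt_gen_minus _ _ _ _ (is_RInt_gen_scal (gamma_integrand x) x (Gamma x) H) H1).
apply (is_RInt_gen_unique (V := R_CompleteNormedModule)) in HD.
assert (E : minus (scal x (Gamma x)) (Gamma (x + 1)) = 0 - 0).
  rewrite <- HD; apply (is_RInt_gen_unique (V := R_CompleteNormedModule)).
  apply HG; [| |exact G0|exact Ginf].
    intros t t0; unfold G, gamma_integrand; replace (x + 1 - 1) with x by ring.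
    apply (is_derive_ext (fun t => mult (Rpower t x) (exp (- t)))); [reflexivity|].
    replace (x * (Rpower t (x - 1) * exp (- t)) - Rpower t x * exp (- t)) with
      (plus (mult (x * Rpower t (x - 1)) (exp (- t))) (mult (Rpower t x) (- exp (- t))))
      by (unfold plus, mult; simpl; ring).
    apply (is_derive_mult (fun t => Rpower t x) (fun t => exp (- t))).
    - now apply is_derive_Rpower.
    - apply is_derive_exp_opp.
    - intros; apply Rmult_comm.
  intros t t0; apply (@continuous_minus R_UniformSpace R_AbsRing R_NormedModule).
    apply (continuous_scal_r x (gamma_integrand x)); now apply gamma_integrand_continuous.
  now apply gamma_integrand_continuous.
change (x * Gamma x - Gamma (x + 1) = 0 - 0) in E; lra.
Qed.


(** * Principal powers *)

Definition polar (r t : R) : C := (r * cos t, r * sin t).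

Lemma Cmod_polar (r t : R) : 0 <= r -> Cmod (polar r t) = r.
Proof.
intros r0; unfold Cmod, polar; simpl.
replace (r * cos t * (r * cos t * 1) + r * sin t * (r * sin t * 1)) with (r * r).
  now apply sqrt_square.
assert (H := sin2_cos2 t); unfold Rsqr in H. nra.
Qed.

Lemma polar_mult (r s t u : R) : (polar r t * polar s u)%C = polar (r * s) (t + u).
Proof.
unfold polar; apply C_ext; unfold Re, Im; simpl; rewrite ?cos_plus, ?sin_plus; ring.
Qed.

Lemma Cpower_polar (z : C) (a : R) : z <> 0%C ->
  Cpower z a = polar (Rpower (Cmod z) a) (a * Carg z).
Proof.
intros Hz; unfold Cpower; destruct (Ceq_dec z 0) as [E|_]; [contradiction|].
unfold polar; apply C_ext; unfold Re, Im; simpl; ring.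
Qed.

Lemma polar_neq_0 (r t : R) : 0 < r -> polar r t <> 0%C.
Proof.
intros r0 E; assert (H := Cmod_polar r t ltac:(lra)); rewrite E, Cmod_0 in H; lra.
Qed.

Lemma acos_cos_abs (t : R) : - PI < t <= PI -> acos (cos t) = Rabs t.
Proof.
intros Ht; unfold Rabs; destruct (Rcase_abs t).
  rewrite <- cos_neg; apply acos_cos; lra.
apply acos_cos; lra.
Qed.

Lemma Carg_polar (r t : R) : 0 < r -> - PI < t <= PI -> Carg (polar r t) = t.
Proof.
intros r0 Ht; unfold Carg; rewrite Cmod_polar by lra.
assert (Pp := PI_RGT_0).
replace (Re (polar r t) / r) with (cos t) by (unfold Re; simpl; field; lra).
rewrite acos_cos_abs by exact Ht.
unfold Im; simpl; destruct (Rle_dec 0 (r * sin t)) as [H|H].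
  apply Rabs_pos_eq; apply Rnot_lt_le; intros t0.
  assert (H1 := sin_lt_0_var t (proj1 Ht) t0). nra.
rewrite Rabs_left; [ring|]. apply Rnot_le_lt; intros t0; apply H.
apply Rmult_le_pos; [lra|apply sin_ge_0; lra].
Qed.

Lemma Cpower_of_polar (r t a : R) : 0 < r -> - PI < t <= PI ->
  Cpower (polar r t) a = polar (Rpower r a) (a * t).
Proof.
intros r0 Ht; rewrite Cpower_polar by now apply polar_neq_0.
rewrite Cmod_polar, Carg_polar by lra; reflexivity.
Qed.

Lemma polar_exists (z : C) : z <> 0%C ->
  exists r t, 0 < r /\ - PI < t <= PI /\ z = polar r t.
Proof.
intros Hz; assert (m0 := Cmod_gt_0 z); apply m0 in Hz; clear m0.
assert (Pp := PI_RGT_0).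
set (c := Re z / Cmod z).
assert (E := Cmod_sqr z).
assert (c1 : c * c + (Im z / Cmod z) * (Im z / Cmod z) = 1).
  unfold c; replace (Re z / Cmod z * (Re z / Cmod z) + Im z / Cmod z * (Im z / Cmod z))
   with ((Re z * Re z + Im z * Im z) / (Cmod z * Cmod z)) by (field; lra).
  rewrite <- E; field; lra.
assert (cb : -1 <= c <= 1) by (set (q := Im z / Cmod z) in *; split; nra).
assert (sb : sin (acos c) = Rabs (Im z / Cmod z)).
  rewrite sin_acos by exact cb; rewrite <- sqrt_Rsqr_abs; f_equal; unfold Rsqr; lra.
assert (ab := acos_bound c).
assert (cc : Re z = Cmod z * c) by (unfold c; field; lra).
exists (Cmod z).
destruct (Rle_dec 0 (Im z)) as [H|H].
  exists (acos c); split; [exact Hz|split; [lra|]].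
  apply C_ext; unfold polar; [change (Re z = Cmod z * cos (acos c))|change (Im z = Cmod z * sin (acos c))].
    now rewrite cos_acos.
  rewrite sb, Rabs_pos_eq; [field; lra|].
  apply Rmult_le_pos; [exact H|left; now apply Rinv_0_lt_compat].
(* acos c = PI would put z on the real axis *)
assert (aPI : acos c <> PI).
  intros Ea; rewrite Ea, sin_PI in sb; symmetry in sb; apply Rabs_eq_0 in sb.
  apply H; right; replace (Im z) with (Im z / Cmod z * Cmod z) by (field; lra); rewrite sb; ring.
exists (- acos c); split; [exact Hz|split; [lra|]].
apply C_ext; unfold polar;
  [change (Re z = Cmod z * cos (- acos c))|change (Im z = Cmod z * sin (- acos c))].
  rewrite cos_neg; now rewrite cos_acos.
rewrite sin_neg, sb, Rabs_left; [field; lra|].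
apply Rmult_lt_reg_r with (Cmod z); [exact Hz|].
replace (Im z / Cmod z * Cmod z) with (Im z) by (field; lra). lra.
Qed.

Lemma differentiable_pt_lim_mul (x y : R) : differentiable_pt_lim (fun u v => u * v) x y y x.
Proof.
intros eps; exists eps; intros u v Hu Hv.
replace (u * v - x * y - (y * (u - x) + x * (v - y))) with ((u - x) * (v - y)) by ring.
rewrite Rabs_mult, Rmult_comm.
apply Rmult_le_compat; try apply Rabs_pos; [lra|apply Rmax_l].
Qed.

Lemma differentiable_pt_lim_fst (x y : R) : differentiable_pt_lim (fun u _ => u) x y 1 0.
Proof.
intros eps; exists eps; intros u v Hu Hv.
replace (u - x - (1 * (u - x) + 0 * (v - y))) with 0 by ring.
rewrite Rabs_R0; apply Rmult_le_pos; [left; apply cond_pos|].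
apply Rle_trans with (2 := Rmax_l _ _), Rabs_pos.
Qed.

Lemma differentiable_pt_lim_snd (x y : R) : differentiable_pt_lim (fun _ v => v) x y 0 1.
Proof.
intros eps; exists eps; intros u v Hu Hv.
replace (v - y - (0 * (u - x) + 1 * (v - y))) with 0 by ring.
rewrite Rabs_R0; apply Rmult_le_pos; [left; apply cond_pos|].
apply Rle_trans with (2 := Rmax_l _ _), Rabs_pos.
Qed.

Lemma differentiable_pt_lim_comp1 (g : R -> R) (f : R -> R -> R) (x y d lx ly : R) :
  is_derive g (f x y) d -> differentiable_pt_lim f x y lx ly ->
  differentiable_pt_lim (fun u v => g (f u v)) x y (d * lx) (d * ly).
Proof.
intros Hg Hf.
replace (d * lx) with (d * lx + 0 * 0) by ring; replace (d * ly) with (d * ly + 0 * 1) by ring.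
apply (differentiable_pt_lim_comp (fun u _ => g u) f (fun _ v => v)); [|exact Hf|apply differentiable_pt_lim_snd].
apply differentiable_pt_lim_proj1_0; now apply is_derive_Reals.
Qed.

Lemma differentiable_pt_lim_mult (f g : R -> R -> R) (x y fx fy gx gy : R) :
  differentiable_pt_lim f x y fx fy -> differentiable_pt_lim g x y gx gy ->
  differentiable_pt_lim (fun u v => f u v * g u v) x y
    (g x y * fx + f x y * gx) (g x y * fy + f x y * gy).
Proof.
intros Hf Hg; apply (differentiable_pt_lim_comp (fun u v => u * v)); auto.
apply differentiable_pt_lim_mul.
Qed.

Lemma differentiable_pt_lim_eq (f : R -> R -> R) (x y lx ly mx my : R) :
  differentiable_pt_lim f x y lx ly -> lx = mx -> ly = my -> differentiable_pt_lim f x y mx my.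
Proof. now intros H <- <-. Qed.

(** By the Cauchy-Riemann equations the two real differentials together are the multiplication
    by [p + i q]. *)
Lemma cderiv_of_real (u v : R -> R -> R) (x y p q : R) :
  differentiable_pt_lim u x y p (- q) -> differentiable_pt_lim v x y q p ->
  cderiv (fun z => (u (Re z) (Im z), v (Re z) (Im z))) (x, y) (p, q).
Proof.
intros Hu Hv eps e0.
destruct (Hu (mkposreal (eps / 2) ltac:(lra))) as [d1 H1].
destruct (Hv (mkposreal (eps / 2) ltac:(lra))) as [d2 H2].
exists (Rmin d1 d2); split; [apply Rmin_pos; apply cond_pos|].
intros [k1 k2] Hk.
assert (B1 := Re_le_Cmod (k1, k2)); assert (B2 := Im_le_Cmod (k1, k2)).
unfold Re, Im in *; simpl in *.
assert (M1 := Rmin_l d1 d2); assert (M2 := Rmin_r d1 d2).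
specialize (H1 (x + k1) (y + k2)); specialize (H2 (x + k1) (y + k2)).
replace (x + k1 - x) with k1 in * by ring; replace (y + k2 - y) with k2 in * by ring.
specialize (H1 ltac:(lra) ltac:(lra)); specialize (H2 ltac:(lra) ltac:(lra)).
assert (MB : Rmax (Rabs k1) (Rabs k2) <= Cmod (k1, k2)) by (apply Rmax_lub; assumption).
match goal with |- Cmod ?w <= _ =>
  replace w with ((u (x + k1) (y + k2) - u x y - (p * k1 + - q * k2)),
                  (v (x + k1) (y + k2) - v x y - (q * k1 + p * k2))) end.
  2: { apply C_ext; unfold Re, Im; simpl; ring. }
match goal with |- Cmod (?a, ?b) <= _ => replace (a, b) with (RtoC a + RtoC b * Ci)%C end.
  2: { apply C_ext; unfold Re, Im; simpl; ring. }
apply Rle_trans with (1 := Cmod_triangle _ _); rewrite Cmod_mult, !Cmod_R.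
assert (Ec : Cmod Ci = 1) by (unfold Cmod, Ci; simpl; replace (0 * (0 * 1) + 1 * (1 * 1)) with 1 by ring; apply sqrt_1).
rewrite ?Ec.
assert (eps / 2 * Rmax (Rabs k1) (Rabs k2) <= eps / 2 * Cmod (k1, k2)) by (apply Rmult_le_compat_l; lra).
lra.
Qed.

Lemma cderiv_ext_loc (f g : C -> C) (z l : C) (d : R) : 0 < d ->
  (forall k, Cmod k < d -> f (z + k)%C = g (z + k)%C) -> cderiv f z l -> cderiv g z l.
Proof.
intros d0 E H eps e0; destruct (H eps e0) as (d' & d0' & H').
exists (Rmin d d'); split; [now apply Rmin_pos|intros k Hk].
rewrite <- E by apply (Rlt_le_trans _ _ _ Hk), Rmin_l.
replace (g z) with (f z); [apply H', (Rlt_le_trans _ _ _ Hk), Rmin_r|].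
replace z with (z + 0)%C by ring; apply E; rewrite Cmod_0; exact d0.
Qed.

Lemma polar_right_half (x y : R) : 0 < x ->
  (x, y) = polar (exp (ln (x * x + y * y) / 2)) (atan (y / x)).
Proof.
intros x0.
assert (n0 : 0 < x * x + y * y) by nra.
assert (E : exp (ln (x * x + y * y) / 2) = sqrt (x * x + y * y)).
  apply Rsqr_inj; [left; apply exp_pos|apply sqrt_pos|].
  rewrite Rsqr_sqrt by lra; unfold Rsqr; rewrite <- exp_plus.
  replace (ln (x * x + y * y) / 2 + ln (x * x + y * y) / 2) with (ln (x * x + y * y)) by field.
  now apply exp_ln.
assert (S : sqrt (x * x + y * y) = x * sqrt (1 + Rsqr (y / x))).
  replace (x * x + y * y) with (x * x * (1 + Rsqr (y / x))) by (unfold Rsqr; field; lra).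
  rewrite sqrt_mult; [now rewrite sqrt_square by lra|nra|assert (h := Rle_0_sqr (y / x)); lra].
assert (s0 : 0 < sqrt (1 + Rsqr (y / x))).
  apply sqrt_lt_R0; assert (h := Rle_0_sqr (y / x)); lra.
unfold polar; rewrite E, S, cos_atan, sin_atan.
generalize dependent (sqrt (1 + Rsqr (y / x))); intros q _ q0; f_equal; field; lra.
Qed.

(** In the right half-plane the principal argument of [x + i y] is [atan (y / x)], so that
    [z^a] is [exp S (cos T + i sin T)] with smooth [S] and [T] satisfying the Cauchy-Riemann
    equations.  The value of the derivative is left open because it cancels in a
    cross-product. *)
Lemma Cpower_cderiv (z : C) (a : R) : 0 < Re z -> exists l, cderiv (fun w => Cpower w a) z l.
Proof.
destruct z as [x y]; unfold Re; simpl; intros x0.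
set (Sf := fun u v => a * (ln (u * u + v * v) / 2)).
set (Tf := fun u v => a * atan (v / u)).
assert (n0 : 0 < x * x + y * y) by nra.
remember (x * x + y * y) as N eqn:EN.
assert (DS : differentiable_pt_lim Sf x y (a * x / N) (a * y / N)).
  apply differentiable_pt_lim_eq with (a * / 2 * / N * (2 * x)) (a * / 2 * / N * (2 * y)); [|field; lra|field; lra].
  apply (differentiable_pt_lim_comp1 (fun w => a * (ln w / 2)) (fun u v => u * u + v * v)).
    cbv beta; rewrite <- EN.
    auto_derive; [exact n0|field; lra].
  apply (differentiable_pt_lim_eq _ _ _ (1 * (x * 1 + x * 1) + 1 * (y * 0 + y * 0)) (1 * (x * 0 + x * 0) + 1 * (y * 1 + y * 1))); [|ring|ring].
  apply (differentiable_pt_lim_comp (fun u v => u + v) (fun u _ => u * u) (fun _ v => v * v)).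
  - intros eps; exists eps; intros u v Hu Hv.
    match goal with |- Rabs ?e <= _ => replace e with 0 by ring end.
    rewrite Rabs_R0; apply Rmult_le_pos; [left; apply cond_pos|].
    apply Rle_trans with (2 := Rmax_l _ _), Rabs_pos.
  - apply (differentiable_pt_lim_mult (fun u _ => u) (fun u _ => u)); apply differentiable_pt_lim_fst.
  - apply (differentiable_pt_lim_mult (fun _ v => v) (fun _ v => v)); apply differentiable_pt_lim_snd.
assert (DT : differentiable_pt_lim Tf x y (- (a * y / N)) (a * x / N)).
  apply differentiable_pt_lim_eq with (a * / (1 + (y / x) * (y / x)) * (/ x * 0 + y * ((- / (x * x)) * 1)))
    (a * / (1 + (y / x) * (y / x)) * (/ x * 1 + y * ((- / (x * x)) * 0))).
    2, 3: rewrite EN; field; split; nra.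
  apply (differentiable_pt_lim_comp1 (fun w => a * atan w) (fun u v => v / u)).
    auto_derive; [trivial|]. field. assert (h := Rle_0_sqr (y / x)); unfold Rsqr in h; split; nra.
  apply (differentiable_pt_lim_mult (fun _ v => v) (fun u _ => / u)).
    apply differentiable_pt_lim_snd.
  apply (differentiable_pt_lim_comp1 Rinv (fun u _ => u)); [|apply differentiable_pt_lim_fst].
  auto_derive; [lra|field; lra].
set (e := exp (Sf x y)); set (c := cos (Tf x y)); set (s := sin (Tf x y)).
exists (e * c * (a * x / N) + e * s * (a * y / N), e * s * (a * x / N) - e * c * (a * y / N)).
apply cderiv_ext_loc with
  (fun z => (exp (Sf (Re z) (Im z)) * cos (Tf (Re z) (Im z)), exp (Sf (Re z) (Im z)) * sin (Tf (Re z) (Im z)))) x.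
- exact x0.
- intros [k1 k2] Hk; unfold Re, Im; simpl.
  assert (B := Re_le_Cmod (k1, k2)); unfold Re in B; simpl in B.
  assert (xk : 0 < x + k1).
    assert (h : Rabs k1 < x) by lra. apply Rabs_def2 in h; lra.
  change ((x, y) + (k1, k2))%C with (x + k1, y + k2).
  rewrite (polar_right_half (x + k1) (y + k2) xk).
  assert (ab := atan_bound ((y + k2) / (x + k1))); assert (pp := PI_RGT_0).
  rewrite Cpower_of_polar; [|apply exp_pos|lra].
  unfold Rpower; rewrite ln_exp; reflexivity.
- apply (cderiv_of_real (fun p q => exp (Sf p q) * cos (Tf p q)) (fun p q => exp (Sf p q) * sin (Tf p q))).
  + apply differentiable_pt_lim_eq with (c * (e * (a * x / N)) + e * (- s * - (a * y / N)))
      (c * (e * (a * y / N)) + e * (- s * (a * x / N))); [|ring|ring].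
    apply (differentiable_pt_lim_mult (fun u v => exp (Sf u v)) (fun u v => cos (Tf u v))).
      apply (differentiable_pt_lim_comp1 exp Sf); [apply is_derive_exp|exact DS].
    apply (differentiable_pt_lim_comp1 cos Tf); [apply is_derive_cos|exact DT].
  + apply differentiable_pt_lim_eq with (s * (e * (a * x / N)) + e * (c * - (a * y / N)))
      (s * (e * (a * y / N)) + e * (c * (a * x / N))); [|ring|ring].
    apply (differentiable_pt_lim_mult (fun u v => exp (Sf u v)) (fun u v => sin (Tf u v))).
      apply (differentiable_pt_lim_comp1 exp Sf); [apply is_derive_exp|exact DS].
    apply (differentiable_pt_lim_comp1 sin Tf); [apply is_derive_sin|exact DT].
Qed.

Lemma cderiv_mult (f g : C -> C) (z l m : C) : cderiv f z l -> cderiv g z m ->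
  cderiv (fun w => f w * g w)%C z (l * g z + f z * m)%C.
Proof.
intros Hf Hg eps e0.
set (K := Cmod (g z) + Cmod (f z) + Cmod l + 1 + Cmod m + 1).
assert (c1 := Cmod_ge_0 (g z)); assert (c2 := Cmod_ge_0 (f z)).
assert (c3 := Cmod_ge_0 l); assert (c4 := Cmod_ge_0 m).
assert (K0 : 1 <= K) by (unfold K; lra).
set (e1 := Rmin 1 (eps / (2 * K))).
assert (e1p : 0 < e1) by (apply Rmin_pos; [lra|apply Rdiv_lt_0_compat; lra]).
assert (e1a : e1 <= 1) by apply Rmin_l.
assert (e1b : e1 * (2 * K) <= eps).
  apply Rle_trans with (eps / (2 * K) * (2 * K)); [apply Rmult_le_compat_r; [lra|apply Rmin_r]|right; field; lra].
destruct (Hf e1 e1p) as (d1 & d1p & H1); destruct (Hg e1 e1p) as (d2 & d2p & H2).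
set (d3 := eps / (2 * (K * K))).
assert (d3p : 0 < d3) by (apply Rdiv_lt_0_compat; nra).
exists (Rmin d3 (Rmin d1 d2)); split; [repeat apply Rmin_pos; assumption|].
intros k Hk.
assert (Hk3 : Cmod k < d3) by apply (Rlt_le_trans _ _ _ Hk), Rmin_l.
assert (Hk12 : Cmod k < Rmin d1 d2) by apply (Rlt_le_trans _ _ _ Hk), Rmin_r.
specialize (H1 k (Rlt_le_trans _ _ _ Hk12 (Rmin_l _ _))).
specialize (H2 k (Rlt_le_trans _ _ _ Hk12 (Rmin_r _ _))).
set (A := (f (z + k) - f z - l * k)%C) in *; set (B := (g (z + k) - g z - m * k)%C) in *.
replace (f (z + k) * g (z + k) - f z * g z - (l * g z + f z * m) * k)%C with
  (A * g z + (f z * B + (A + l * k) * (B + m * k)))%C by (unfold A, B; ring).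
assert (k0 := Cmod_ge_0 k); assert (A0 := Cmod_ge_0 A); assert (B0 := Cmod_ge_0 B).
apply Rle_trans with (1 := Cmod_triangle _ _); rewrite Cmod_mult.
assert (T1 : Cmod (f z * B + (A + l * k) * (B + m * k))%C <=
   Cmod (f z) * Cmod B + (Cmod A + Cmod l * Cmod k) * (Cmod B + Cmod m * Cmod k)).
  apply Rle_trans with (1 := Cmod_triangle _ _); rewrite !Cmod_mult.
  apply Rplus_le_compat_l, Rmult_le_compat; try apply Cmod_ge_0;
    apply Rle_trans with (1 := Cmod_triangle _ _); rewrite Cmod_mult; lra.
assert (T2 : Cmod A * Cmod (g z) <= e1 * Cmod k * Cmod (g z)) by (apply Rmult_le_compat_r; assumption).
assert (T3 : Cmod (f z) * Cmod B <= Cmod (f z) * (e1 * Cmod k)) by (apply Rmult_le_compat_l; assumption).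
assert (T4 : (Cmod A + Cmod l * Cmod k) * (Cmod B + Cmod m * Cmod k) <= (K * Cmod k) * (K * Cmod k)).
  assert (e1k : e1 * Cmod k <= 1 * Cmod k) by (apply Rmult_le_compat_r; assumption).
  apply Rmult_le_compat; try (apply Rplus_le_le_0_compat; [assumption|now apply Rmult_le_pos]);
  unfold K; nra.
assert (T5 : K * Cmod k * (K * Cmod k) <= eps / 2 * Cmod k).
  replace (K * Cmod k * (K * Cmod k)) with (K * K * Cmod k * Cmod k) by ring.
  apply Rmult_le_compat_r; [exact k0|].
  apply Rle_trans with (K * K * d3); [apply Rmult_le_compat_l; nra|right; unfold d3; field; lra].
assert (T6 : e1 * Cmod k * Cmod (g z) + Cmod (f z) * (e1 * Cmod k) <= eps / 2 * Cmod k).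
  replace (e1 * Cmod k * Cmod (g z) + Cmod (f z) * (e1 * Cmod k))
    with (e1 * (Cmod (g z) + Cmod (f z)) * Cmod k) by ring.
  apply Rmult_le_compat_r; [exact k0|].
  apply Rle_trans with (e1 * K); [apply Rmult_le_compat_l; unfold K; lra|lra].
lra.
Qed.


(** * The cross-product of Bessel functions *)

(** The coefficients are bounded by those of a multiple of [exp (K z)]. *)
Lemma entire_of_ratio (a : nat -> R) (K : R) : 0 <= K ->
  (forall n, INR (S n) * Rabs (a (S n)) <= K * Rabs (a n)) -> entire a.
Proof.
intros K0 Hr r r0.
assert (B : forall n, Rabs (a n) <= Rabs (a O) * (K ^ n / INR (fact n))).
  induction n as [|n IH]; [simpl; lra|].
  apply Rmult_le_reg_l with (INR (S n)); [apply lt_0_INR; lia|].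
  apply Rle_trans with (1 := Hr n).
  apply Rle_trans with (K * (Rabs (a O) * (K ^ n / INR (fact n)))); [now apply Rmult_le_compat_l|].
  right; rewrite fact_simpl, mult_INR; simpl pow; field.
  split; [apply INR_fact_neq_0|apply not_0_INR; lia].
assert (He : ex_series (fun n => Rabs (a O) * (/ INR (fact n) * (K * r) ^ n))).
  apply (ex_series_scal (Rabs (a O)) (fun n => / INR (fact n) * (K * r) ^ n)).
  exists (exp (K * r)); apply is_series_ext with (2 := is_exp_Reals (K * r)).
  intros n; unfold scal; simpl; rewrite pow_n_pow; unfold mult; simpl; ring.
revert He; apply (@ex_series_le R_AbsRing R_CompleteNormedModule); intros n.
change (Rabs (Rabs (a n) * r ^ n) <= Rabs (a O) * (/ INR (fact n) * (K * r) ^ n)).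
assert (p0 : 0 <= r ^ n) by now apply pow_le.
rewrite Rabs_pos_eq by (apply Rmult_le_pos; [apply Rabs_pos|exact p0]).
specialize (B n).
apply Rle_trans with (Rabs (a O) * (K ^ n / INR (fact n)) * r ^ n); [now apply Rmult_le_compat_r|].
right; rewrite Rpow_mult_distr; unfold Rdiv; ring.
Qed.

Definition ps_X (n : nat) : R := match n with 1%nat => 1 | _ => 0 end.
Definition ps_const (c : R) (n : nat) : R := match n with O => c | S _ => 0 end.

Lemma ps_mult_X (a : nat -> R) (n : nat) :
  PS_mult ps_X a n = match n with O => 0 | S m => a m end.
Proof.
destruct n as [|n]; [rewrite ps_mult_0; simpl; ring|].
rewrite ps_mult_S; replace (ps_tail ps_X) with ps_one.
  rewrite ps_mult_1_l; simpl; ring.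
apply functional_extensionality; intros [|k]; reflexivity.
Qed.

Lemma ps_mult_const (c : R) (a : nat -> R) (n : nat) : PS_mult (ps_const c) a n = c * a n.
Proof.
replace (ps_const c) with (fun k => c * ps_one k).
  now rewrite ps_mult_scal_l, ps_mult_1_l.
apply functional_extensionality; intros [|k]; simpl; ring.
Qed.

Lemma ps_theta_add (a b : nat -> R) : ps_theta (ps_add a b) = ps_add (ps_theta a) (ps_theta b).
Proof. apply functional_extensionality; intros k; unfold ps_theta, ps_add; ring. Qed.

Lemma ps_theta_sub (a b : nat -> R) : ps_theta (ps_sub a b) = ps_sub (ps_theta a) (ps_theta b).
Proof. apply functional_extensionality; intros k; unfold ps_theta, ps_sub; ring. Qed.

(** In terms of [theta = x d/dx] the Wronskian of two series becomes [x (a b' - a' b)]. *)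
Definition ps_wronskian (a b : nat -> R) : nat -> R :=
  ps_sub (PS_mult a (ps_theta b)) (PS_mult (ps_theta a) b).

(** With [theta = x d/dx], the Bessel series solve [theta (theta + nu) a = - x a] and
    [theta (theta + nu) b = x b].  Put [P = a b], [W = a theta(b) - theta(a) b] and
    [V = theta(a) theta(b)].  The product rule gives
    [(theta + nu) W = 2 x P], [theta (theta + nu) P = 2 V] and [(theta + 2 nu) V = - x W],
    so that each coefficient of [W] is determined by the one two places before. *)
Section Wronskian.
Variables (nu : R) (a b : nat -> R).
Hypothesis Ha : forall n, INR (S n) * (INR (S n) + nu) * a (S n) = - a n.
Hypothesis Hb : forall n, INR (S n) * (INR (S n) + nu) * b (S n) = b n.

Lemma theta2_a :
  ps_theta (ps_theta a) = ps_sub (ps_neg (PS_mult ps_X a)) (PS_mult (ps_const nu) (ps_theta a)).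
Proof.
apply functional_extensionality; intros n; unfold ps_sub, ps_neg.
rewrite ps_mult_X, ps_mult_const; unfold ps_theta.
destruct n as [|n]; [simpl; ring|specialize (Ha n); nra].
Qed.

Lemma theta2_b :
  ps_theta (ps_theta b) = ps_sub (PS_mult ps_X b) (PS_mult (ps_const nu) (ps_theta b)).
Proof.
apply functional_extensionality; intros n; unfold ps_sub, ps_neg.
rewrite ps_mult_X, ps_mult_const; unfold ps_theta.
destruct n as [|n]; [simpl; ring|specialize (Hb n); nra].
Qed.

Let W := ps_wronskian a b.
Let P := PS_mult a b.
Let V := PS_mult (ps_theta a) (ps_theta b).

Lemma wronskian_rec1 (n : nat) : (INR (S n) + nu) * W (S n) = 2 * P n.
Proof.
assert (E : ps_add (ps_theta W) (PS_mult (ps_const nu) W) = PS_mult ps_X (ps_add P P)).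
  unfold W, P, ps_wronskian; rewrite ps_theta_sub, !ps_theta_mult, theta2_a, theta2_b; ring.
apply (f_equal (fun f => f (S n))) in E.
rewrite ps_mult_X in E; unfold ps_add at 1 in E; rewrite ps_mult_const in E.
unfold ps_theta, ps_add in E; lra.
Qed.

Lemma wronskian_rec2 (n : nat) : INR n * (INR n + nu) * P n = 2 * V n.
Proof.
assert (E : ps_add (ps_theta (ps_theta P)) (PS_mult (ps_const nu) (ps_theta P)) = ps_add V V).
  unfold V, P; rewrite !ps_theta_mult, ps_theta_add, !ps_theta_mult, theta2_a, theta2_b; ring.
apply (f_equal (fun f => f n)) in E.
unfold ps_add at 1 in E; rewrite ps_mult_const in E.
unfold ps_theta, ps_add in E; lra.
Qed.

Lemma wronskian_rec3 (n : nat) : (INR (S n) + 2 * nu) * V (S n) = - W n.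
Proof.
assert (E : ps_add (ps_theta V) (PS_mult (ps_const nu) (ps_add V V)) = ps_neg (PS_mult ps_X W)).
  unfold V, W, ps_wronskian; rewrite !ps_theta_mult, theta2_a, theta2_b; ring.
apply (f_equal (fun f => f (S n))) in E.
unfold ps_neg in E; rewrite ps_mult_X in E; unfold ps_add at 1 in E; rewrite ps_mult_const in E.
unfold ps_theta, ps_add in E; lra.
Qed.

Hypothesis Hab : forall n, a n = (-1) ^ n * b n.
Hypothesis Hnu : -1 < nu.

Lemma wronskian_even (k : nat) : W (2 * k) = 0.
Proof.
(* b is a at -x, so exchanging the factors multiplies the coefficient of x^n by (-1)^n *)
assert (E : forall n, PS_mult (ps_theta a) b n = (-1) ^ n * PS_mult a (ps_theta b) n).
  intros n; rewrite ps_mult_comm; unfold PS_mult; rewrite scal_sum; apply sum_eq; intros i Hi.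
  unfold ps_theta; rewrite !Hab.
  replace ((-1) ^ (n - i)) with ((-1) ^ n * (-1) ^ i).
    ring.
  replace n with (n - i + i)%nat at 1 by lia; rewrite pow_add.
  rewrite Rmult_assoc, <- Rpow_mult_distr; replace (-1 * -1) with 1 by ring; rewrite pow1; ring.
unfold W, ps_wronskian, ps_sub; rewrite E, pow_1_even; ring.
Qed.

Lemma wronskian_step (k : nat) :
  W (2 * S k + 1) * ((nu + 2 * INR (S k)) * (nu + 2 * INR (S k) + 1) * INR (S k) * (nu + INR (S k)))
   = - W (2 * k + 1).
Proof.
assert (R1 := wronskian_rec1 (2 * S k)); assert (R2 := wronskian_rec2 (2 * S k)).
assert (R3 := wronskian_rec3 (2 * k + 1)).
replace (S (2 * S k)) with (2 * S k + 1)%nat in R1 by lia.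
replace (S (2 * k + 1)) with (2 * S k)%nat in R3 by lia.
rewrite plus_INR in R1. rewrite mult_INR in R1, R2, R3.
replace (INR 2) with 2 in * by (simpl; ring); replace (INR 1) with 1 in * by reflexivity.
set (m := INR (S k)) in *.
set (w := W (2 * S k + 1)) in *; set (p := P (2 * S k)) in *; set (v := V (2 * S k)) in *.
rewrite <- R3.
replace v with (2 * m * (2 * m + nu) * p / 2) by lra.
replace p with ((2 * m + 1 + nu) * w / 2) by lra.
field.
Qed.
End Wronskian.

Definition hcoef (nu : R) (n : nat) : R :=
  / (16 ^ n * INR (fact n) * poch (nu + 1) n * poch (nu + 2) (2 * n)).

Lemma hcoef_pos (nu : R) (n : nat) : -1 < nu -> 0 < hcoef nu n.
Proof.
intros Hnu; apply Rinv_0_lt_compat.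
repeat apply Rmult_lt_0_compat;
  [apply pow_lt; lra|apply INR_fact_lt_0|apply poch_pos; lra|apply poch_pos; lra].
Qed.

Lemma hcoef_S (nu : R) (n : nat) : -1 < nu ->
  hcoef nu n = hcoef nu (S n) *
    (16 * INR (S n) * (nu + 1 + INR n) * ((nu + 2 + 2 * INR n) * (nu + 3 + 2 * INR n))).
Proof.
intros Hnu; unfold hcoef.
replace (2 * S n)%nat with (S (S (2 * n))) by lia.
cbn [poch]; rewrite fact_simpl, mult_INR, (S_INR (2 * n)), (mult_INR 2 n), !S_INR; simpl INR.
rewrite <- tech_pow_Rmult.
assert (n0 := pos_INR n).
assert (h1 := poch_pos (nu + 1) n ltac:(lra)); assert (h2 := poch_pos (nu + 2) (2 * n) ltac:(lra)).
assert (h3 := INR_fact_lt_0 n). assert (h4 : 0 < 16 ^ n) by (apply pow_lt; lra).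
field; repeat split; lra.
Qed.

Lemma hcoef_0 (nu : R) : hcoef nu 0 = 1.
Proof. unfold hcoef; simpl; field. Qed.

Definition alpha (nu : R) (n : nat) : R := 1 / (INR (fact n) * Gamma (nu + INR n + 1)).

Lemma alpha_S (nu : R) (n : nat) : -1 < nu ->
  INR (S n) * (INR (S n) + nu) * alpha nu (S n) = alpha nu n.
Proof.
intros Hnu; unfold alpha; assert (n0 := pos_INR n).
replace (nu + INR (S n) + 1) with (nu + INR n + 1 + 1) by (rewrite S_INR; ring).
rewrite Gamma_succ, fact_simpl, mult_INR, S_INR by lra.
assert (g0 := Gamma_pos (nu + INR n + 1) ltac:(lra)).
field; repeat split; try lra; apply INR_fact_neq_0.
Qed.

Definition alpha_alt (nu : R) (n : nat) : R := (-1) ^ n / (INR (fact n) * Gamma (nu + INR n + 1)).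

Lemma alpha_alt_eq (nu : R) (n : nat) : alpha_alt nu n = (-1) ^ n * alpha nu n.
Proof. unfold alpha_alt, alpha, Rdiv; ring. Qed.

Lemma alpha_alt_S (nu : R) (n : nat) : -1 < nu ->
  INR (S n) * (INR (S n) + nu) * alpha_alt nu (S n) = - alpha_alt nu n.
Proof.
intros Hnu; rewrite !alpha_alt_eq, <- (alpha_S nu n Hnu); simpl pow; ring.
Qed.

Lemma entire_alpha_gen (nu : R) (a : nat -> R) : -1 < nu ->
  (forall n, Rabs (a n) = Rabs (alpha nu n)) -> entire a.
Proof.
intros Hnu E; apply entire_of_ratio with (/ (nu + 1)).
  left; apply Rinv_0_lt_compat; lra.
intros n; rewrite !E, <- (alpha_S nu n Hnu).
assert (h := pos_INR n). assert (A0 := Rabs_pos (alpha nu (S n))).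
rewrite Rabs_mult, (Rabs_pos_eq (INR (S n) * (INR (S n) + nu))) by (rewrite S_INR; apply Rmult_le_pos; lra).
apply Rmult_le_reg_l with (nu + 1); [lra|].
rewrite <- !Rmult_assoc, Rinv_r, Rmult_1_l by lra.
apply Rmult_le_compat_r; [exact A0|]. rewrite S_INR; nra.
Qed.

Lemma entire_alpha (nu : R) : -1 < nu -> entire (alpha nu).
Proof. intros Hnu; now apply entire_alpha_gen with nu. Qed.

Lemma entire_alpha_alt (nu : R) : -1 < nu -> entire (alpha_alt nu).
Proof.
intros Hnu; apply entire_alpha_gen with nu; [exact Hnu|intros n].
now rewrite alpha_alt_eq, Rabs_mult, pow_1_abs, Rmult_1_l.
Qed.

Lemma bessel_wronskian_coef (nu : R) (k : nat) : -1 < nu ->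
  ps_wronskian (alpha_alt nu) (alpha nu) (2 * k + 1) =
  2 / (Gamma (nu + 1) * Gamma (nu + 2)) * ((-1) ^ k * (16 ^ k * hcoef nu k)).
Proof.
intros Hnu.
assert (step := wronskian_step nu (alpha_alt nu) (alpha nu) (fun n => alpha_alt_S nu n Hnu)
  (fun n => alpha_S nu n Hnu)).
induction k as [|k IH].
  assert (R1 := wronskian_rec1 nu (alpha_alt nu) (alpha nu) (fun n => alpha_alt_S nu n Hnu)
    (fun n => alpha_S nu n Hnu) 0).
  change (2 * 0 + 1)%nat with 1%nat; rewrite hcoef_0; simpl pow.
  rewrite ps_mult_0 in R1; unfold alpha_alt at 2, alpha at 2 in R1; simpl in R1.
  replace (nu + 0 + 1) with (nu + 1) in R1 by ring.
  replace (nu + 2) with (nu + 1 + 1) by ring; rewrite (Gamma_succ (nu + 1)) by lra.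
  assert (g0 := Gamma_pos (nu + 1) ltac:(lra)).
  apply Rmult_eq_reg_l with (1 + nu); [|lra]. rewrite R1; field; lra.
specialize (step k); rewrite IH in step; clear IH.
rewrite (hcoef_S nu k Hnu) in step.
assert (h := pos_INR k).
apply Rmult_eq_reg_r with
  ((nu + 2 * INR (S k)) * (nu + 2 * INR (S k) + 1) * INR (S k) * (nu + INR (S k))).
  rewrite step, !S_INR; simpl pow; ring.
rewrite S_INR; apply Rgt_not_eq; repeat apply Rmult_lt_0_compat; lra.
Qed.

(** The partial sums of the subseries are the partial sums of odd order of the whole series. *)
Lemma is_series_odd (u : nat -> R) (l : R) :
  is_series u l -> (forall k, u (2 * k)%nat = 0) -> is_series (fun k => u (2 * k + 1)%nat) l.
Proof.
intros H Z.
assert (E : forall N, sum_n u (2 * N + 1) = sum_n (fun k => u (2 * k + 1)%nat) N).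
  induction N as [|N IH].
    change (2 * 0 + 1)%nat with 1%nat; rewrite sum_Sn, !sum_O.
    change (u 0%nat) with (u (2 * 0)%nat); rewrite Z; unfold plus; simpl; ring.
  replace (2 * S N + 1)%nat with (S (S (2 * N + 1))) by lia.
  rewrite !sum_Sn, IH.
  replace (S (2 * N + 1)) with (2 * S N)%nat by lia; rewrite Z.
  replace (S (2 * S N)) with (2 * S N + 1)%nat by lia.
  unfold plus; simpl; ring.
change (is_lim_seq (sum_n (fun k => u (2 * k + 1)%nat)) l).
apply is_lim_seq_ext with (fun N => sum_n u (2 * N + 1)); [exact E|].
apply (is_lim_seq_subseq (sum_n u) l (fun N => (2 * N + 1)%nat)); [|exact H].
apply eventually_subseq; intros n; lia.
Qed.

Lemma is_cseries_odd (w : nat -> R) (z l : C) :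
  is_cseries (fun n => RtoC (w n) * z ^ n)%C l -> (forall k, w (2 * k)%nat = 0) ->
  l = (z * CPS (fun k => w (2 * k + 1)%nat) (z * z))%C.
Proof.
intros H Z; assert (H0 := H).
assert (T : forall k, (RtoC (w (2 * k + 1)%nat) * z ^ (2 * k + 1)
    = z * (RtoC (w (2 * k + 1)%nat) * (z * z) ^ k))%C).
  intros k; rewrite Cpow_add_r, Cpow_mult_r; simpl; replace (z * (z * 1))%C with (z * z)%C by ring; ring.
destruct H as [H1 H2].
apply is_series_odd in H1; [|intros k; rewrite Z, Re_RtoC_mult; ring].
apply is_series_odd in H2; [|intros k; rewrite Z, Im_RtoC_mult; ring].
destruct (Ceq_dec z 0) as [E|E].
  subst z; rewrite Cmult_0_l, <- (is_cseries_unique _ _ H0); apply is_cseries_unique.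
  apply is_cseries_ext with (fun _ => 0%C); [|split; exact is_series_R0].
  intros [|n]; [rewrite (Z 0%nat : w 0%nat = 0); ring|simpl; ring].
assert (HS : is_cseries (fun k => / z * (RtoC (w (2 * k + 1)%nat) * z ^ (2 * k + 1)))%C (/ z * l)%C).
  apply is_cseries_scal; split; assumption.
apply is_cseries_ext with (v := fun k => (RtoC (w (2 * k + 1)%nat) * (z * z) ^ k)%C) in HS.
  apply is_cseries_unique in HS; unfold CPS; rewrite HS; field; exact E.
intros k; cbv beta; rewrite T; field; exact E.
Qed.

Lemma entire_hcoef_gen (nu : R) (a : nat -> R) : -1 < nu ->
  (forall n, Rabs (a n) = hcoef nu n) -> entire a.
Proof.
intros Hnu E; apply entire_of_ratio with (/ (nu + 1)).
  left; apply Rinv_0_lt_compat; lra.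
intros n; rewrite !E, (hcoef_S nu n Hnu).
assert (h := pos_INR n). assert (A0 := hcoef_pos nu (S n) Hnu).
apply Rmult_le_reg_l with (nu + 1); [lra|].
rewrite <- !Rmult_assoc, Rinv_r, Rmult_1_l by lra.
rewrite S_INR.
apply Rle_trans with (hcoef nu (S n) * (16 * (INR n + 1) * (nu + 1) * (1 * 1))).
  assert (0 < hcoef nu (S n) * ((INR n + 1) * (nu + 1))).
    apply Rmult_lt_0_compat; [exact A0|apply Rmult_lt_0_compat; lra].
  lra.
rewrite !Rmult_assoc; repeat (apply Rmult_le_compat_l; [lra|]).
apply Rmult_le_compat; try lra; apply Rmult_le_compat; lra.
Qed.

Lemma cderiv_comp (f g : C -> C) (z l m : C) :
  cderiv g z m -> cderiv f (g z) l -> cderiv (fun w => f (g w)) z (l * m)%C.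
Proof.
intros Hg Hf eps e0.
assert (c1 := Cmod_ge_0 l); assert (c2 := Cmod_ge_0 m).
set (e1 := Rmin 1 (eps / (2 * (Cmod l + 1)))).
assert (e1p : 0 < e1) by (apply Rmin_pos; [lra|apply Rdiv_lt_0_compat; lra]).
assert (e1b : e1 * (Cmod l + 1) <= eps / 2).
  apply Rle_trans with (eps / (2 * (Cmod l + 1)) * (Cmod l + 1));
   [apply Rmult_le_compat_r; [lra|apply Rmin_r]|right; field; lra].
assert (e1a : e1 <= 1) by apply Rmin_l.
destruct (Hg e1 e1p) as (d1 & d1p & H1).
set (e2 := eps / (2 * (Cmod m + 1))).
assert (e2p : 0 < e2) by (apply Rdiv_lt_0_compat; lra).
destruct (Hf e2 e2p) as (d2 & d2p & H2).
exists (Rmin d1 (d2 / (Cmod m + 1))); split.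
  apply Rmin_pos; [exact d1p|apply Rdiv_lt_0_compat; lra].
intros k Hk; assert (k0 := Cmod_ge_0 k).
specialize (H1 k (Rlt_le_trans _ _ _ Hk (Rmin_l _ _))).
set (j := (g (z + k) - g z)%C).
assert (Hj : Cmod j <= (Cmod m + 1) * Cmod k).
  replace j with ((g (z + k) - g z - m * k) + m * k)%C by (unfold j; ring).
  apply Rle_trans with (1 := Cmod_triangle _ _); rewrite Cmod_mult; nra.
assert (Hj2 : Cmod j < d2).
  apply Rle_lt_trans with (1 := Hj).
  assert (Hk2 := Rlt_le_trans _ _ _ Hk (Rmin_r _ _)).
  apply (Rmult_lt_compat_l (Cmod m + 1)) in Hk2; [|lra].
  replace ((Cmod m + 1) * (d2 / (Cmod m + 1))) with d2 in Hk2 by (field; lra); exact Hk2.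
specialize (H2 j Hj2).
replace (g z + j)%C with (g (z + k)%C) in H2 by (unfold j; ring).
replace (f (g (z + k)) - f (g z) - l * m * k)%C with
  ((f (g (z + k)) - f (g z) - l * j) + l * (g (z + k) - g z - m * k))%C by (unfold j; ring).
apply Rle_trans with (1 := Cmod_triangle _ _); rewrite Cmod_mult.
assert (T1 : e2 * Cmod j <= eps / 2 * Cmod k).
  apply Rle_trans with (e2 * ((Cmod m + 1) * Cmod k)); [apply Rmult_le_compat_l; lra|].
  right; unfold e2; field; lra.
assert (T2 : Cmod l * Cmod (g (z + k) - g z - m * k)%C <= Cmod l * (e1 * Cmod k)) by (apply Rmult_le_compat_l; assumption).
assert (T3 : Cmod l * (e1 * Cmod k) <= eps / 2 * Cmod k).
  replace (Cmod l * (e1 * Cmod k)) with ((Cmod l * e1) * Cmod k) by ring.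
  apply Rmult_le_compat_r; [exact k0|nra].
lra.
Qed.

Lemma cderiv_half (z : C) : cderiv (fun w => w / 2)%C z (/ 2)%C.
Proof.
intros eps e0; exists 1; split; [lra|intros k _].
replace ((z + k) / 2 - z / 2 - / 2 * k)%C with (RtoC 0).
  rewrite Cmod_0; apply Rmult_le_pos; [lra|apply Cmod_ge_0].
field; intros E; apply RtoC_inj in E; lra.
Qed.

Lemma cderiv_id (z : C) : cderiv (fun w => w) z 1%C.
Proof.
intros eps e0; exists 1; split; [lra|intros k _].
replace (z + k - z - 1 * k)%C with (RtoC 0) by ring.
rewrite Cmod_0; apply Rmult_le_pos; [lra|apply Cmod_ge_0].
Qed.

Lemma besselJ_eq (nu : R) (z : C) :
  besselJ nu z = (Cpower (z / 2) nu * CPS (alpha_alt nu) (z / 2 * (z / 2)))%C.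
Proof.
unfold besselJ, CPS; f_equal; f_equal; apply functional_extensionality; intros n.
rewrite Cpow_mult_r; do 2 f_equal; simpl; ring.
Qed.

Lemma besselI_eq (nu : R) (z : C) :
  besselI nu z = (Cpower (z / 2) nu * CPS (alpha nu) (z / 2 * (z / 2)))%C.
Proof.
unfold besselI, CPS; f_equal; f_equal; apply functional_extensionality; intros n.
rewrite Cpow_mult_r; do 2 f_equal; simpl; ring.
Qed.

(** The factor [p = (z/2)^nu] is common to [J] and [I]; whatever its derivative, the
    cross-product of [p A] and [p B] is [p^2] times that of [A] and [B].  As [A] and [B] are
    series in [w^2], [w = z/2], the chain rule contributes [w]. *)
Lemma Phi_eq (nu : R) (z : C) : -1 < nu -> 0 < Re z ->
  Phi nu z = (Cpower (z / 2) nu * Cpower (z / 2) nu * (z / 2) *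
    (RtoC (2 / (Gamma (nu + 1) * Gamma (nu + 2))) *
     CPS (fun k => (-1) ^ k * hcoef nu k)%R (z * z * (z * z))))%C.
Proof.
intros Hnu Hz.
set (w := (z / 2)%C).
assert (n2 : RtoC 2 <> 0%C) by (intros E; apply RtoC_inj in E; lra).
assert (Ez : z = (2 * w)%C) by (unfold w; field; exact n2).
assert (Hw : 0 < Re w).
  rewrite Ez, Re_RtoC_mult in Hz; lra.
assert (w0 : w <> 0%C) by (intros E; rewrite E in Hw; unfold Re in Hw; simpl in Hw; lra).
destruct (Cpower_cderiv w nu Hw) as [p' Hp].
set (A := alpha_alt nu); set (B := alpha nu).
assert (eA : entire A) by now apply entire_alpha_alt.
assert (eB : entire B) by now apply entire_alpha.
assert (D : forall a, entire a ->
  C_derive (fun z => Cpower (z / 2) nu * CPS a (z / 2 * (z / 2)))%C z =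
   ((p' * CPS a (w * w) + Cpower w nu * (CPS (PS_derive a) (w * w) * (1 * w + w * 1))) * / 2)%C).
  intros a ea; apply cderiv_C_derive.
  apply (cderiv_comp (fun u => Cpower u nu * CPS a (u * u))%C (fun z => z / 2)%C).
    apply cderiv_half.
  apply (cderiv_mult (fun u => Cpower u nu) (fun u => CPS a (u * u))%C); [exact Hp|].
  apply (cderiv_comp (CPS a) (fun u => u * u)%C); [|now apply CPS_cderiv].
  apply (cderiv_mult (fun u => u) (fun u => u)); apply cderiv_id.
unfold Phi.
replace (besselJ nu) with (fun z => Cpower (z / 2) nu * CPS A (z / 2 * (z / 2)))%C
  by (apply functional_extensionality; intros; symmetry; apply besselJ_eq).
replace (besselI nu) with (fun z => Cpower (z / 2) nu * CPS B (z / 2 * (z / 2)))%C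
  by (apply functional_extensionality; intros; symmetry; apply besselI_eq).
rewrite (D A eA), (D B eB); fold w.
set (DA := CPS (PS_derive A) (w * w)); set (DB := CPS (PS_derive B) (w * w)).
assert (EW : is_cseries (fun n => RtoC (ps_wronskian A B n) * (w * w) ^ n)%C
    (w * w * (CPS A (w * w) * DB - DA * CPS B (w * w)))%C).
  assert (m0 := Cmod_ge_0 (w * w)%C).
  replace (w * w * (CPS A (w * w) * DB - DA * CPS B (w * w)))%C with
    (CPS A (w * w) * CPS (ps_theta B) (w * w) + - (1) * (CPS (ps_theta A) (w * w) * CPS B (w * w)))%C.
    2: { unfold ps_theta; rewrite !CPS_theta_derive by assumption; fold DA DB; ring. }
  apply is_cseries_ext with (fun n => RtoC (PS_mult A (ps_theta B) n) * (w * w) ^ n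
     + - (1) * (RtoC (PS_mult (ps_theta A) B n) * (w * w) ^ n))%C.
    intros n; unfold ps_wronskian, ps_sub; rewrite RtoC_minus; ring.
  apply is_cseries_plus; [|apply is_cseries_scal].
    exact (is_cseries_mult A (ps_theta B) _ (eA _ m0) (entire_theta B eB _ m0)).
  exact (is_cseries_mult (ps_theta A) B _ (entire_theta A eA _ m0) (eB _ m0)).
apply is_cseries_odd in EW.
  2: { intros k; apply wronskian_even with (1 := alpha_alt_eq nu). }
set (g := fun k => (-1) ^ k * hcoef nu k).
assert (EG : CPS (fun k => ps_wronskian A B (2 * k + 1)) (w * w * (w * w)) =
   (RtoC (2 / (Gamma (nu + 1) * Gamma (nu + 2))) * CPS g (z * z * (z * z)))%C).
  apply is_cseries_unique.
  apply is_cseries_ext with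
    (fun k => RtoC (2 / (Gamma (nu + 1) * Gamma (nu + 2))) * (RtoC (g k) * (z * z * (z * z)) ^ k))%C.
    intros k; unfold A, B; rewrite bessel_wronskian_coef by exact Hnu; unfold g.
    replace (z * z * (z * z))%C with (RtoC 16 * (w * w * (w * w)))%C.
      2: { rewrite Ez; replace 16 with (2 * 2 * (2 * 2)) by ring; rewrite !RtoC_mult; ring. }
    rewrite Cpow_mult_l, <- RtoC_pow, !RtoC_mult; ring.
  apply is_cseries_scal, CPS_correct.
  apply (entire_hcoef_gen nu g Hnu); [|apply Cmod_ge_0].
  intros k; unfold g; rewrite Rabs_mult, pow_1_abs, Rmult_1_l.
  apply Rabs_pos_eq; left; now apply hcoef_pos.
rewrite EG in EW; rewrite <- Cmult_assoc in EW.
assert (ww : (w * w)%C <> 0%C) by now apply Cmult_neq_0.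
assert (EW' : (CPS A (w * w) * DB - DA * CPS B (w * w))%C =
  (RtoC (2 / (Gamma (nu + 1) * Gamma (nu + 2))) * CPS g (z * z * (z * z)))%C).
  transitivity (/ (w * w) * (w * (w * (CPS A (w * w) * DB - DA * CPS B (w * w)))))%C.
    field; exact w0.
  rewrite EW; field; exact w0.
rewrite <- EW'; field; exact n2.
Qed.

(** * The power series of h *)

Lemma polar_scal (x r t : R) : (RtoC x * polar r t)%C = polar (x * r) t.
Proof. apply C_ext; unfold polar, Re, Im; simpl; ring. Qed.

Lemma polar_div2 (r t : R) : (polar r t / 2)%C = polar (r / 2) t.
Proof.
unfold Cdiv; rewrite <- RtoC_inv by lra; rewrite Cmult_comm, polar_scal; f_equal; field.
Qed.

(** In polar coordinates the moduli and the arguments of the principal powers multiply to those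
    of [z]: the exponents add up to [- nu/2 + 3/4 + nu/2 + 1/4 = 1].  No branch is crossed,
    since [z^(1/4)] has its argument in [(-PI/4, PI/4]]. *)
Lemma h_eq (nu : R) (z : C) : -1 < nu ->
  h nu z = (z * CPS (fun k => (-1) ^ k * hcoef nu k)%R z)%C.
Proof.
intros Hnu; unfold h; destruct (Ceq_dec z 0) as [->|Hz]; [now rewrite Cmult_0_l|].
destruct (polar_exists z Hz) as (r & t & r0 & Ht & ->).
assert (Pp := PI_RGT_0).
set (q := Rpower r (1 / 4)).
assert (q0 : 0 < q) by apply exp_pos.
assert (Q4 : q * q * (q * q) = r).
  unfold q; rewrite <- !Rpower_plus.
  replace (1 / 4 + 1 / 4 + (1 / 4 + 1 / 4)) with 1 by field; now apply Rpower_1.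
rewrite !(Cpower_of_polar r) by assumption; fold q.
set (u := 1 / 4 * t).
assert (cu : 0 < cos u) by (apply cos_gt_0; unfold u; lra).
rewrite Phi_eq; [|exact Hnu|unfold Re, polar; simpl; now apply Rmult_lt_0_compat].
rewrite polar_div2, (Cpower_of_polar (q / 2)) by (unfold u; lra).
replace (polar q u * polar q u * (polar q u * polar q u))%C with (polar r t).
  2: { rewrite !polar_mult, Q4; f_equal; unfold u; field. }
set (G := CPS _ _).
assert (g1 := Gamma_pos (nu + 1) ltac:(lra)); assert (g2 := Gamma_pos (nu + 2) ltac:(lra)).
transitivity (RtoC (Rpower 2 (2 * nu) * Gamma (nu + 1) * Gamma (nu + 2) *
     (2 / (Gamma (nu + 1) * Gamma (nu + 2)))) *
  (polar (Rpower r (- nu / 2 + 3 / 4)) ((- nu / 2 + 3 / 4) * t) *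
   (polar (Rpower (q / 2) nu) (nu * u) * polar (Rpower (q / 2) nu) (nu * u) * polar (q / 2) u)) * G)%C.
  rewrite !RtoC_mult; ring.
f_equal.
rewrite !polar_mult, polar_scal; f_equal; [|unfold u; field].
replace (Rpower 2 (2 * nu) * Gamma (nu + 1) * Gamma (nu + 2) *
     (2 / (Gamma (nu + 1) * Gamma (nu + 2)))) with (2 * Rpower 2 (2 * nu)) by (field; lra).
assert (Eq : Rpower (q / 2) nu = Rpower r (nu / 4) * / Rpower 2 nu).
  unfold q, Rdiv at 1; rewrite <- Rpower_mult_distr by (apply exp_pos || lra).
  rewrite Rpower_mult; replace (1 / 4 * nu) with (nu / 4) by field.
  f_equal; unfold Rpower; rewrite ln_Rinv by lra; rewrite <- exp_Ropp; f_equal; ring.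
rewrite Eq.
replace (2 * nu) with (nu + nu) by ring; rewrite Rpower_plus.
assert (e2 : 0 < Rpower 2 nu) by apply exp_pos.
transitivity (Rpower r (- nu / 2 + 3 / 4) * (Rpower r (nu / 4) * Rpower r (nu / 4) * q)).
  field; lra.
unfold q; rewrite <- !Rpower_plus.
replace (- nu / 2 + 3 / 4 + (nu / 4 + nu / 4 + 1 / 4)) with 1 by field; now apply Rpower_1.
Qed.

(** Coefficients of [h'].  The factor [n + 1] is written as the action [1 + n/b] of the operator
    [u + z u' / b] at [b = 1]. *)
Definition dh_coef (nu : R) (n : nat) : R := (1 + INR n / 1) * ((-1) ^ n * hcoef nu n).
(** Coefficients of [(z h')']. *)
Definition dzdh_coef (nu : R) : nat -> R := ps_add (dh_coef nu) (ps_theta (dh_coef nu)).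

Lemma entire_alt_hcoef (nu : R) : -1 < nu -> entire (fun k => (-1) ^ k * hcoef nu k).
Proof.
intros Hnu; apply (entire_hcoef_gen nu); [exact Hnu|intros k].
rewrite Rabs_mult, pow_1_abs, Rmult_1_l; apply Rabs_pos_eq; left; now apply hcoef_pos.
Qed.

Lemma entire_plus (a b : nat -> R) : entire a -> entire b -> entire (fun n => a n + b n).
Proof.
intros Ha Hb r r0.
assert (H := ex_series_plus _ _ (Ha r r0) (Hb r r0)); revert H.
apply (@ex_series_le R_AbsRing R_CompleteNormedModule); intros n.
change (Rabs (Rabs (a n + b n) * r ^ n) <= Rabs (a n) * r ^ n + Rabs (b n) * r ^ n).
assert (p0 : 0 <= r ^ n) by now apply pow_le.
rewrite Rabs_pos_eq by (apply Rmult_le_pos; [apply Rabs_pos|exact p0]).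
rewrite <- Rmult_plus_distr_r; apply Rmult_le_compat_r; [exact p0|apply Rabs_triang].
Qed.

Lemma entire_dh (nu : R) : -1 < nu -> entire (dh_coef nu).
Proof.
intros Hnu.
replace (dh_coef nu) with (fun n => (-1) ^ n * hcoef nu n + INR n * ((-1) ^ n * hcoef nu n)).
  apply entire_plus; [|apply entire_theta]; now apply entire_alt_hcoef.
apply functional_extensionality; intros n; unfold dh_coef; field.
Qed.

Lemma entire_dzdh (nu : R) : -1 < nu -> entire (dzdh_coef nu).
Proof.
intros Hnu; apply (entire_plus (dh_coef nu)); [|apply entire_theta]; now apply entire_dh.
Qed.

Lemma h_cderiv (nu : R) (z : C) : -1 < nu -> cderiv (h nu) z (CPS (dh_coef nu) z).
Proof.
intros Hnu.
set (a := fun n => match n with O => 0 | S k => (-1) ^ k * hcoef nu k end).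
assert (ea0 := entire_alt_hcoef nu Hnu).
assert (E : forall z, h nu z = CPS a z).
  intros w; rewrite h_eq by exact Hnu; symmetry; apply is_cseries_unique.
  replace (w * CPS (fun k => (-1) ^ k * hcoef nu k)%R w)%C with
   (RtoC (a O) * w ^ 0 + w * CPS (fun k => (-1) ^ k * hcoef nu k)%R w)%C by (simpl; ring).
  apply (is_cseries_incr (fun n => RtoC (a n) * w ^ n)%C).
  apply is_cseries_ext with (fun n => w * (RtoC ((-1) ^ n * hcoef nu n) * w ^ n))%C.
    intros n; simpl; ring.
  apply is_cseries_scal, CPS_correct, ea0, Cmod_ge_0.
assert (ea : entire a).
  intros r r0; apply ex_series_incr_1.
  apply ex_series_ext with (fun n => r * (Rabs ((-1) ^ n * hcoef nu n) * r ^ n)).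
    intros n; change (r * (Rabs ((-1) ^ n * hcoef nu n) * r ^ n) = Rabs ((-1) ^ n * hcoef nu n) * (r * r ^ n)); ring.
  apply (ex_series_scal r (fun n => Rabs ((-1) ^ n * hcoef nu n) * r ^ n)); now apply ea0.
replace (h nu) with (CPS a) by (apply functional_extensionality; intros; symmetry; apply E).
replace (dh_coef nu) with (PS_derive a); [now apply CPS_cderiv|].
apply functional_extensionality; intros n; unfold PS_derive, dh_coef, a; rewrite S_INR; field.
Qed.

Lemma h_derive (nu : R) : -1 < nu -> C_derive (h nu) = CPS (dh_coef nu).
Proof.
intros Hnu; apply functional_extensionality; intros z.
apply cderiv_C_derive; now apply h_cderiv.
Qed.

Lemma h_derive2 (nu : R) (z : C) : -1 < nu ->
  (z * C_derive (C_derive (h nu)) z)%C = CPS (ps_theta (dh_coef nu)) z.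
Proof.
intros Hnu; rewrite h_derive by exact Hnu.
assert (e := entire_dh nu Hnu).
rewrite (cderiv_C_derive _ _ _ (CPS_cderiv (dh_coef nu) z e)).
symmetry; now apply CPS_theta_derive.
Qed.

Lemma poch_double (a : R) (n : nat) : poch a (2 * n) = 4 ^ n * poch (a / 2) n * poch ((a + 1) / 2) n.
Proof.
induction n as [|n IH]; [simpl; ring|].
replace (2 * S n)%nat with (S (S (2 * n))) by lia; cbn [poch].
rewrite IH, (S_INR (2 * n)), mult_INR; simpl; field.
Qed.

(** By duplication, [(nu+2)_(2n) = 4^n ((nu+2)/2)_n ((nu+3)/2)_n]; so [h'] arises from [exp(-z)] by
    three divisions by Pochhammer symbols, a rescaling, and one operator [u + z u']. *)
Lemma laguerre_polya_dh (nu : R) : -1 < nu -> laguerre_polya (dh_coef nu).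
Proof.
intros Hnu; apply laguerre_polya_euler_op; [lra|].
apply laguerre_polya_ext with (fun n => (/ 64) ^ n * ((-1) ^ n / INR (fact n) / poch (nu + 1) n /
   poch ((nu + 2) / 2) n / poch ((nu + 2 + 1) / 2) n)).
  intros n; unfold hcoef; rewrite poch_double.
  replace 64 with (16 * 4) by ring; rewrite pow_inv.
  rewrite Rpow_mult_distr.
  assert (h1 := poch_pos (nu + 1) n ltac:(lra)).
  assert (h2 := poch_pos ((nu + 2) / 2) n ltac:(lra)).
  assert (h3 := poch_pos ((nu + 2 + 1) / 2) n ltac:(lra)).
  assert (h4 := INR_fact_lt_0 n).
  assert (h5 : 0 < 16 ^ n) by (apply pow_lt; lra).
  assert (h6 : 0 < 4 ^ n) by (apply pow_lt; lra).
  field; repeat split; lra.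
apply laguerre_polya_scale; [lra|].
do 3 (apply (laguerre_polya_div_poch _ (fun n => _)); [lra|]).
exact laguerre_polya_exp.
Qed.

Lemma laguerre_polya_dzdh (nu : R) : -1 < nu -> laguerre_polya (dzdh_coef nu).
Proof.
intros Hnu; apply laguerre_polya_ext with (fun n => (1 + INR n / 1) * dh_coef nu n).
  intros n; unfold dzdh_coef, ps_add, ps_theta; field.
apply laguerre_polya_euler_op; [lra|now apply laguerre_polya_dh].
Qed.

(** * Explicit polynomial estimates *)

(** Newton's identities.  The last line is twice the second elementary symmetric function of
    the squares of the numbers whose power sums are the [s k]. *)
Lemma newton_values (a : nat -> R) : a O = 1 ->
  let s := ps_newton a in
  s 1%nat = - a 1%nat /\
  s 2%nat = a 1%nat ^ 2 - 2 * a 2%nat /\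
  (s 2%nat) ^ 2 - s 4%nat = 2 * (a 2%nat ^ 2 - 2 * a 1%nat * a 3%nat + 2 * a 4%nat).
Proof.
intros a0 s.
assert (H := fun n => f_equal (fun f => f n) (ps_newton_mult a a0)); fold s in H; cbv beta in H.
assert (s0 : s O = 0) by apply ps_newton_0.
assert (H1 := H 1%nat); assert (H2 := H 2%nat); assert (H3 := H 3%nat); assert (H4 := H 4%nat); clear H.
unfold PS_mult, ps_neg, ps_theta in *; simpl in *; rewrite a0, s0 in *.
assert (E1 : s 1%nat = - a 1%nat) by lra; rewrite E1 in *.
assert (E2 : s 2%nat = a 1%nat ^ 2 - 2 * a 2%nat) by lra; simpl in E2.
assert (E3 : s 3%nat = - (1 + 1 + 1) * a 3%nat - s 2%nat * a 1%nat + a 1%nat * a 2%nat) by lra.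
assert (E4 : s 4%nat = - (1 + 1 + 1 + 1) * a 4%nat - s 3%nat * a 1%nat - s 2%nat * a 2%nat + a 1%nat * a 3%nat) by lra.
repeat split; [exact E2|rewrite E4, E3, E2; ring].
Qed.

Lemma hcoef_values (nu : R) : -1 < nu ->
  let p := (nu + 1) * (nu + 2) * (nu + 3) in
  hcoef nu 1 = / (16 * p) /\
  hcoef nu 2 = / (512 * ((nu + 1) * (nu + 2) * ((nu + 2) * (nu + 3) * (nu + 4) * (nu + 5)))) /\
  hcoef nu 3 = / (24576 * (p * ((nu + 2) * (nu + 3) * (nu + 4) * (nu + 5) * (nu + 6) * (nu + 7)))) /\
  hcoef nu 4 = / (1572864 * (p * (nu + 4) *
     ((nu + 2) * (nu + 3) * (nu + 4) * (nu + 5) * (nu + 6) * (nu + 7) * (nu + 8) * (nu + 9)))).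
Proof.
intros Hnu p; unfold hcoef, p.
change (2 * 1)%nat with 2%nat; change (2 * 2)%nat with 4%nat; change (2 * 3)%nat with 6%nat;
  change (2 * 4)%nat with 8%nat; cbn [poch]; rewrite !INR_IZR_INZ; cbn; repeat split; f_equal; ring.
Qed.

(** Applied to polynomials in [s = nu + 1 > 0], whose expansions turn out to have positive
    coefficients only. *)
Ltac poly_pos := ring_simplify;
  repeat (apply Rplus_lt_0_compat || apply Rmult_lt_0_compat || apply pow_lt || lra).

Definition poch3 (nu : R) : R := (nu + 1) * (nu + 2) * (nu + 3).

Lemma poch_3 (nu : R) : poch (nu + 1) 3 = poch3 nu.
Proof. unfold poch3; simpl; ring. Qed.

Lemma dzdh_values (nu : R) : -1 < nu ->
  dzdh_coef nu 0 = 1 /\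
  dzdh_coef nu 1 = - (4 * hcoef nu 1) /\ dzdh_coef nu 2 = 9 * hcoef nu 2 /\
  dzdh_coef nu 3 = - (16 * hcoef nu 3) /\ dzdh_coef nu 4 = 25 * hcoef nu 4.
Proof.
intros Hnu; unfold dzdh_coef, ps_add, ps_theta, dh_coef; rewrite hcoef_0; simpl; repeat split; field.
Qed.

Lemma newton2_value (nu : R) : -1 < nu ->
  ps_newton (dzdh_coef nu) 2 = nu15 nu / (256 * poch3 nu ^ 2 * poch (nu + 4) 2).
Proof.
intros Hnu.
destruct (dzdh_values nu Hnu) as (F0 & F1 & F2 & F3 & F4).
destruct (newton_values _ F0) as (_ & -> & _); rewrite F1, F2.
destruct (hcoef_values nu Hnu) as (-> & -> & _).
unfold nu15, poch3; simpl; field; repeat split; lra.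
Qed.

(** After removing positive factors, what remains is a polynomial of degree [5] in [nu + 1] with
    positive coefficients. *)
Lemma newton4_lt (nu : R) : -1 < nu ->
  ps_newton (dzdh_coef nu) 4 < ps_newton (dzdh_coef nu) 2 ^ 2.
Proof.
intros Hnu.
destruct (dzdh_values nu Hnu) as (F0 & F1 & F2 & F3 & F4).
destruct (newton_values _ F0) as (_ & _ & E).
apply Rminus_gt_0_lt; rewrite E, F1, F2, F3, F4.
destruct (hcoef_values nu Hnu) as (-> & -> & -> & ->).
remember (nu + 1) as s eqn:Es; assert (s0 : 0 < s) by lra.
replace nu with (s - 1) by lra; clear Es.
apply Rlt_le_trans with
 (s ^ 2 * (s + 2) * (243 * (s + 2) * (s + 5) * (s + 6) * (s + 7) * (s + 8)
     - 256 * (s + 1) * (s + 3) * (s + 4) * (s + 7) * (s + 8)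
     + 25 * s * (s + 1) ^ 2 * (s + 2) * (s + 4)) * 2 /
   (256 * 3072 * (s * (s + 1) * (s + 2)) ^ 4 * (s + 3) ^ 2 * (s + 4) ^ 2 * (s + 5) * (s + 6) * (s + 7) * (s + 8))).
  apply Rdiv_lt_0_compat; [|repeat (apply Rmult_lt_0_compat || apply pow_lt || lra)].
  repeat apply Rmult_lt_0_compat; try lra; [].
  poly_pos.
right; field; repeat split; lra.
Qed.

Definition dzdh_trunc (nu x : R) : R :=
  1 - 4 * hcoef nu 1 * x + 9 * hcoef nu 2 * x ^ 2 - 16 * hcoef nu 3 * x ^ 3 + 25 * hcoef nu 4 * x ^ 4.

(** The quotient [sigma_2 / sigma_3] of Newton sums of [(z h')']. *)
Definition upper_bound (nu : R) : R := 8 * poch3 nu * poch (nu + 6) 2 * nu15 nu / (3 * nu16 nu).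

Lemma poch3_pos (nu : R) : -1 < nu -> 0 < poch3 nu.
Proof. intros; unfold poch3; repeat apply Rmult_lt_0_compat; lra. Qed.

Lemma nu15_pos (nu : R) : -1 < nu -> 0 < nu15 nu.
Proof. intros; unfold nu15; nra. Qed.

Lemma nu16_pos (nu : R) : -1 < nu -> 0 < nu16 nu.
Proof.
intros; unfold nu16; replace nu with ((nu + 1) - 1) by ring; assert (0 < nu + 1) by lra.
generalize dependent (nu + 1); intros s s0; poly_pos.
Qed.

(** In the unit [4 (nu+1)_3 = 1 / sigma_1] the point is [A], close to [1] for small [nu + 1];
    clearing denominators leaves a polynomial of degree [23] in [nu + 1], divisible by
    [(nu + 1)^2], whose other coefficients are all negative. *)
Lemma dzdh_trunc_neg (nu : R) : -1 < nu -> dzdh_trunc nu (upper_bound nu) < 0.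
Proof.
intros Hnu.
set (A := 2 * ((nu + 6) * (nu + 7)) * nu15 nu / (3 * nu16 nu)).
assert (q0 := nu16_pos nu Hnu).
replace (upper_bound nu) with (4 * poch3 nu * A).
  2: { unfold upper_bound, A; simpl; field; lra. }
assert (E : dzdh_trunc nu (4 * poch3 nu * A) = 1 - A
  + 9 / 32 * ((nu + 1) * (nu + 3)) / ((nu + 4) * (nu + 5)) * A ^ 2
  - 1 / 24 * ((nu + 1) ^ 2 * (nu + 2) * (nu + 3)) / ((nu + 4) * (nu + 5) * (nu + 6) * (nu + 7)) * A ^ 3
  + 25 / 6144 * ((nu + 1) ^ 3 * (nu + 2) ^ 2 * (nu + 3) ^ 2)
     / ((nu + 4) ^ 2 * (nu + 5) * (nu + 6) * (nu + 7) * (nu + 8) * (nu + 9)) * A ^ 4).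
  unfold dzdh_trunc; destruct (hcoef_values nu Hnu) as (-> & -> & -> & ->); unfold poch3.
  clearbody A; field; repeat split; lra.
rewrite E; clear E.
unfold A; clear A; revert q0; unfold nu15, nu16.
remember (nu + 1) as s eqn:Es; assert (s0 : 0 < s) by lra.
replace nu with (s - 1) by lra; clear Es.
set (P := 7 * s ^ 2 + 94 * s + 192).
set (Q := 3 * s ^ 4 + 79 * s ^ 3 + 804 * s ^ 2 + 3108 * s + 3840).
replace (3 * (s - 1) ^ 4 + 91 * (s - 1) ^ 3 + 1059 * (s - 1) ^ 2 + 4965 * (s - 1) + 7834) with Q by (unfold Q; ring).
replace (7 * (s - 1) ^ 2 + 108 * (s - 1) + 293) with P by (unfold P; ring).
intros q0.
apply Ropp_lt_cancel; rewrite Ropp_0.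
assert (N : 0 < - (6144 * (s + 3) ^ 2 * (s + 4) * (s + 5) * (s + 6) * (s + 7) * (s + 8) * (3 * Q) ^ 4
   - 6144 * (s + 3) ^ 2 * (s + 4) * (s + 5) * (s + 6) * (s + 7) * (s + 8) * (2 * ((s + 5) * (s + 6)) * P) * (3 * Q) ^ 3
   + 1728 * s * (s + 2) * (s + 3) * (s + 5) * (s + 6) * (s + 7) * (s + 8) * (2 * ((s + 5) * (s + 6)) * P) ^ 2 * (3 * Q) ^ 2
   - 256 * s ^ 2 * (s + 1) * (s + 2) * (s + 3) * (s + 7) * (s + 8) * (2 * ((s + 5) * (s + 6)) * P) ^ 3 * (3 * Q)
   + 25 * s ^ 3 * (s + 1) ^ 2 * (s + 2) ^ 2 * (2 * ((s + 5) * (s + 6)) * P) ^ 4)).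
  unfold P, Q; poly_pos.
apply Rlt_le_trans with (1 := Rdiv_lt_0_compat _
  (6144 * (s + 3) ^ 2 * (s + 4) * (s + 5) * (s + 6) * (s + 7) * (s + 8) * (3 * Q) ^ 4) N
  ltac:(repeat (apply Rmult_lt_0_compat || apply pow_lt || lra))).
clear N; clearbody P Q.
right; field; repeat split; lra.
Qed.

Lemma upper_bound_lt_8 (nu : R) : -1 < nu -> upper_bound nu < 8 * poch3 nu.
Proof.
intros Hnu; assert (q0 := nu16_pos nu Hnu); assert (p0 := poch3_pos nu Hnu).
unfold upper_bound; apply Rmult_lt_reg_r with (3 * nu16 nu); [lra|].
replace (8 * poch3 nu * poch (nu + 6) 2 * nu15 nu / (3 * nu16 nu) * (3 * nu16 nu)) with
  (8 * poch3 nu * (poch (nu + 6) 2 * nu15 nu)) by (field; lra).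
apply Rmult_lt_compat_l; [lra|]. apply Rminus_gt_0_lt; unfold nu15, nu16; simpl poch; simpl INR.
replace nu with ((nu + 1) - 1) by ring; assert (h : 0 < nu + 1) by lra; clear - h.
generalize dependent (nu + 1); intros s s0; poly_pos.
Qed.

Lemma upper_bound_lt_ratio (nu : R) : -1 < nu -> upper_bound nu < 64 * poch (nu + 1) 5 / nu15 nu.
Proof.
intros Hnu; assert (q0 := nu16_pos nu Hnu); assert (p0 := poch3_pos nu Hnu); assert (r0 := nu15_pos nu Hnu).
unfold upper_bound; apply Rmult_lt_reg_r with (3 * nu16 nu * nu15 nu).
  repeat apply Rmult_lt_0_compat; lra.
replace (8 * poch3 nu * poch (nu + 6) 2 * nu15 nu / (3 * nu16 nu) * (3 * nu16 nu * nu15 nu)) with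
  (8 * poch3 nu * (poch (nu + 6) 2 * nu15 nu * nu15 nu)) by (field; lra).
replace (64 * poch (nu + 1) 5 / nu15 nu * (3 * nu16 nu * nu15 nu)) with
  (8 * poch3 nu * (24 * (nu + 4) * (nu + 5) * nu16 nu)) by (unfold poch3; simpl; field; lra).
apply Rmult_lt_compat_l; [lra|]. apply Rminus_gt_0_lt; unfold nu15, nu16; simpl poch; simpl INR.
replace nu with ((nu + 1) - 1) by ring; assert (h : 0 < nu + 1) by lra; clear - h.
generalize dependent (nu + 1); intros s s0; poly_pos.
Qed.

(** * The radius of convexity *)

Lemma CPS_real (a : nat -> R) (x : R) : CPS a (RtoC x) = RtoC (PSeries a x).
Proof.
apply C_ext.
  change (Series (fun n => Re (RtoC (a n) * RtoC x ^ n)%C) = Series (fun n => a n * x ^ n)).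
  apply Series_ext; intros n; now rewrite <- RtoC_pow, Re_RtoC_mult.
change (Series (fun n => Im (RtoC (a n) * RtoC x ^ n)%C) = 0).
rewrite <- (is_series_unique _ _ is_series_R0); apply Series_ext; intros n.
rewrite <- RtoC_pow, Im_RtoC_mult; simpl; ring.
Qed.

Lemma Series_term_le (a : nat -> R) (n : nat) :
  (forall k, 0 <= a k) -> ex_series a -> a n <= Series a.
Proof.
intros a0 H; apply Series_correct in H.
apply Rle_trans with (sum_n a n).
  destruct n as [|n]; [rewrite sum_O; lra|].
  rewrite sum_Sn; assert (0 <= sum_n a n); [|unfold plus; simpl; lra].
  clear H; induction n as [|n IH]; [rewrite sum_O; apply a0|].
  rewrite sum_Sn; specialize (a0 (S n)); unfold plus; simpl; lra.
apply (is_lim_seq_incr_compare (sum_n a) (Series a)); [exact H|].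
intros k; rewrite sum_Sn; specialize (a0 (S k)); unfold plus; simpl; lra.
Qed.

Lemma entire_CV_radius (a : nat -> R) (x : R) : entire a -> Rbar_lt (Rabs x) (CV_radius a).
Proof.
intros Ha; assert (x0 := Rabs_pos x).
apply Rbar_lt_le_trans with (Finite (Rabs x + 1)); [simpl; lra|].
apply (proj1 (CV_radius_bounded a)).
exists (Series (fun n => Rabs (a n) * (Rabs x + 1) ^ n)); intros n.
rewrite Rabs_mult, (Rabs_pos_eq ((Rabs x + 1) ^ n)) by (apply pow_le; lra).
apply (Series_term_le (fun n => Rabs (a n) * (Rabs x + 1) ^ n)); [|apply Ha; lra].
intros k; apply Rmult_le_pos; [apply Rabs_pos|apply pow_le; lra].
Qed.

Lemma entire_continuity (a : nat -> R) : entire a -> continuity (PSeries a).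
Proof. intros Ha x; apply PSeries_continuity; now apply entire_CV_radius. Qed.

Lemma entire_ex_pseries (a : nat -> R) (x : R) : entire a -> ex_series (fun n => a n * x ^ n).
Proof.
intros Ha; apply ex_series_Rabs.
apply ex_series_ext with (2 := Ha (Rabs x) (Rabs_pos x)).
intros n; now rewrite Rabs_mult, RPow_abs.
Qed.

(** From degree [4] on, the terms of the alternating series decrease in modulus as long as
    [x <= 8 (nu+1)_3]. *)
Lemma dzdh_le_trunc (nu x : R) : -1 < nu -> 0 <= x <= 8 * poch3 nu ->
  PSeries (dzdh_coef nu) x <= dzdh_trunc nu x.
Proof.
intros Hnu Hx.
assert (ex := entire_ex_pseries _ x (entire_dzdh nu Hnu)).
unfold PSeries; rewrite (Series_incr_n _ 4) by (lia || exact ex).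
destruct (dzdh_values nu Hnu) as (F0 & F1 & F2 & F3 & F4).
simpl sum_f_R0; rewrite F0, F1, F2, F3.
set (U := fun n => (INR (4 + n) + 1) ^ 2 * hcoef nu (4 + n) * x ^ (4 + n)).
assert (T : forall n, dzdh_coef nu (4 + n) * x ^ (4 + n) = tg_alt U n).
  intros n; unfold tg_alt, U, dzdh_coef, ps_add, ps_theta, dh_coef.
  rewrite (pow_add (-1) 4 n); simpl ((-1) ^ 4); field.
assert (U0 : forall n, 0 <= U n).
  intros n; unfold U; apply Rmult_le_pos; [|apply pow_le; lra].
  apply Rmult_le_pos; [apply pow2_ge_0|left; now apply hcoef_pos].
assert (Dec : Un_decreasing U).
  intros n; unfold U; replace (4 + S n)%nat with (S (4 + n)) by lia.
  assert (m4 : 4 <= INR (4 + n)) by (rewrite plus_INR; assert (h := pos_INR n); simpl in *; lra).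
  (* the quotient of consecutive terms is (m+2)^2 / (m+1)^2 <= 2 times x / (16 (m+1) ...) *)
  generalize dependent (4 + n)%nat; intros m m4.
  rewrite (hcoef_S nu m Hnu), S_INR, <- (tech_pow_Rmult x m).
  assert (H0 := hcoef_pos nu (S m) Hnu); set (c := hcoef nu (S m)) in *.
  assert (X0 : 0 <= x ^ m) by (apply pow_le; lra).
  apply Rle_trans with ((c * x ^ m) * ((INR m + 1 + 1) ^ 2 * x)); [right; ring|].
  apply Rle_trans with ((c * x ^ m) * ((INR m + 1) ^ 2 * (16 * (INR m + 1)) * ((nu + 1 + INR m) * ((nu + 2 + 2 * INR m) * (nu + 3 + 2 * INR m))))); [|right; ring].
  apply Rmult_le_compat_l; [apply Rmult_le_pos; lra|].
  assert (B : x <= 8 * ((nu + 1 + INR m) * ((nu + 2 + 2 * INR m) * (nu + 3 + 2 * INR m)))).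
    apply Rle_trans with (1 := proj2 Hx); apply Rmult_le_compat_l; [lra|].
    unfold poch3; rewrite Rmult_assoc.
    apply Rmult_le_compat; try lra; [apply Rmult_le_pos; lra|apply Rmult_le_compat; lra].
  set (K := (nu + 1 + INR m) * ((nu + 2 + 2 * INR m) * (nu + 3 + 2 * INR m))) in *.
  apply Rle_trans with (2 * (INR m + 1) ^ 2 * (8 * K)).
    apply Rmult_le_compat; try lra; [apply pow2_ge_0|nra].
  assert (K0 : 0 <= (INR m + 1) ^ 2 * K) by (apply Rmult_le_pos; [apply pow2_ge_0|lra]).
  nra.
assert (exT : ex_series (tg_alt U)).
  apply ex_series_ext with (1 := T).
  apply (ex_series_incr_n (fun n => dzdh_coef nu n * x ^ n) 4); exact ex.
assert (cvU : Un_cv U 0).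
  apply is_lim_seq_Reals.
  apply ex_series_lim_0 in exT; apply is_lim_seq_abs_0 in exT.
  apply is_lim_seq_abs_0; apply is_lim_seq_ext with (2 := exT).
  intros n; unfold tg_alt; now rewrite Rabs_mult, pow_1_abs, Rmult_1_l.
rewrite (Series_ext _ _ T).
assert (L := Series_correct _ exT); apply is_series_Reals in L.
assert (Alt := alternated_series_ineq U (Series (tg_alt U)) 0 Dec cvU L); simpl in Alt.
destruct Alt as [_ Alt]; unfold tg_alt at 2, U at 2 in Alt.
simpl in Alt; unfold dzdh_trunc. lra.
Qed.

Definition convexity_disk (f : C -> C) (r : R) : Prop :=
  0 < r /\
    forall z : C, Cmod z < r ->
      ex_derive (K := C_AbsRing) (V := C_NormedModule) f z /\
      C_derive f z <> 0%C /\
      0 < Re (1 + z * C_derive (C_derive f) z / C_derive f z)%C.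

Lemma PSeries_dzdh (nu x : R) : -1 < nu ->
  PSeries (dzdh_coef nu) x = PSeries (dh_coef nu) x + PSeries (ps_theta (dh_coef nu)) x.
Proof.
intros Hnu; assert (e := entire_dh nu Hnu); unfold PSeries.
rewrite <- Series_plus by (apply entire_ex_pseries; try apply entire_theta; exact e).
apply Series_ext; intros n; unfold dzdh_coef, ps_add; ring.
Qed.

Lemma dh_coef_0 (nu : R) : dh_coef nu 0 = 1.
Proof. unfold dh_coef; rewrite hcoef_0; simpl; field. Qed.

(** If [x < r] then [h'] has no zero on [[0, x]], so it is positive there, and the expression
    [1 + z h'' / h' = (z h')' / h'] vanishes at [x]. *)
Lemma convexity_disk_le_root (nu r x : R) : -1 < nu -> convexity_disk (h nu) r ->
  0 < x -> PSeries (dzdh_coef nu) x = 0 -> r <= x.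
Proof.
intros Hnu [r0 H] x0 Fx; apply Rnot_lt_le; intros xr.
assert (e := entire_dh nu Hnu).
assert (Cm : forall y, 0 <= y -> Cmod (RtoC y) = y) by (intros y y0; rewrite Cmod_R; now apply Rabs_pos_eq).
assert (nz : forall y, 0 <= y <= x -> PSeries (dh_coef nu) y <> 0).
  intros y Hy E; destruct (H (RtoC y)) as (_ & N & _); [rewrite Cm; lra|].
  apply N; rewrite h_derive, CPS_real, E by exact Hnu; reflexivity.
assert (Gx : 0 < PSeries (dh_coef nu) x).
  destruct (Rlt_or_le 0 (PSeries (dh_coef nu) x)) as [p|n]; [exact p|exfalso].
  destruct (IVT_cor (PSeries (dh_coef nu)) 0 x) as (y & Hy & E).
  - now apply entire_continuity.
  - lra.
  - rewrite PSeries_0, dh_coef_0; lra.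
  - exact (nz y Hy E).
destruct (H (RtoC x)) as (_ & _ & Pos); [rewrite Cm; lra|].
rewrite h_derive2, h_derive, !CPS_real in Pos by exact Hnu.
unfold Cdiv in Pos; rewrite <- RtoC_inv, <- RtoC_mult, <- RtoC_plus in Pos by lra.
unfold Re in Pos; simpl in Pos.
rewrite PSeries_dzdh in Fx by exact Hnu.
replace (1 + PSeries (ps_theta (dh_coef nu)) x * / PSeries (dh_coef nu) x) with
 ((PSeries (dh_coef nu) x + PSeries (ps_theta (dh_coef nu)) x) / PSeries (dh_coef nu) x) in Pos by (field; lra).
rewrite Fx in Pos; unfold Rdiv in Pos; rewrite Rmult_0_l in Pos; lra.
Qed.

Lemma radius_lt_upper_bound (nu : R) : -1 < nu ->
  Rbar_lt (radius_of_convexity (h nu)) (upper_bound nu).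
Proof.
intros Hnu.
assert (q0 := nu16_pos nu Hnu); assert (p0 := poch3_pos nu Hnu); assert (r0 := nu15_pos nu Hnu).
assert (xu0 : 0 < upper_bound nu).
  unfold upper_bound; apply Rdiv_lt_0_compat; [|lra].
  assert (c0 : 0 < poch (nu + 6) 2) by (apply poch_pos; lra).
  apply Rmult_lt_0_compat; [apply Rmult_lt_0_compat|]; lra.
assert (F := dzdh_le_trunc nu (upper_bound nu) Hnu (conj (Rlt_le _ _ xu0) (Rlt_le _ _ (upper_bound_lt_8 nu Hnu)))).
assert (N := dzdh_trunc_neg nu Hnu).
destruct (dzdh_values nu Hnu) as (F0 & _).
destruct (IVT_cor (PSeries (dzdh_coef nu)) 0 (upper_bound nu)) as (x & Hx & E).
- now apply entire_continuity, entire_dzdh.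
- lra.
- rewrite PSeries_0, F0; lra.
- assert (x0 : 0 < x).
    destruct (proj1 Hx) as [p|p]; [exact p|subst x; rewrite PSeries_0, F0 in E; lra].
  assert (xl : x < upper_bound nu).
    destruct (proj2 Hx) as [p|p]; [exact p|subst x; lra].
  apply Rbar_le_lt_trans with (Finite x); [|exact xl].
  apply (proj2 (Lub_Rbar_correct _)); intros r Hr.
  exact (convexity_disk_le_root nu r x Hnu Hr x0 E).
Qed.

Lemma is_cseries_one (z : C) : is_cseries (fun n => RtoC (ps_one n) * z ^ n)%C 1%C.
Proof.
replace (RtoC 1) with (RtoC (ps_one 0) * z ^ 0 + 0)%C by (simpl; ring).
apply (is_cseries_incr (fun n => RtoC (ps_one n) * z ^ n)%C).
apply is_cseries_ext with (fun _ => 0%C); [intros n; simpl; ring|].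
split; exact is_series_R0.
Qed.

(** Since [sigma_(n+4) r^(n+4) <= (sigma_4 r^4) (sigma_n r^n)], the maximum is attained among the
    first four terms, and their sum is a bound. *)
Lemma newton_bounded (nu r : R) : -1 < nu -> 0 < r ->
  ps_newton (dzdh_coef nu) 4 * r ^ 4 <= 1 ->
  exists M, forall n, ps_newton (dzdh_coef nu) (S n) * r ^ S n <= M.
Proof.
intros Hnu r0 H4; assert (lp := laguerre_polya_dzdh nu Hnu).
set (s := ps_newton (dzdh_coef nu)) in *.
assert (v0 : forall n, 0 <= s n * r ^ n).
  intros n; apply Rmult_le_pos; [now apply laguerre_polya_newton_ge0|apply pow_le; lra].
exists (s 1%nat * r ^ 1 + s 2%nat * r ^ 2 + s 3%nat * r ^ 3 + s 4%nat * r ^ 4).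
intros n; induction n as [n IH] using (well_founded_induction Wf_nat.lt_wf).
assert (v1 := v0 1%nat); assert (v2 := v0 2%nat); assert (v3 := v0 3%nat); assert (v4 := v0 4%nat).
destruct n as [|[|[|[|n]]]]; try lra.
apply Rle_trans with (2 := IH n ltac:(lia)).
assert (A := laguerre_polya_newton_add_le _ 4 (S n) lp ltac:(lia) ltac:(lia)); fold s in A.
assert (vn := v0 (S n)).
change (S (S (S (S (S n))))) with (4 + S n)%nat; rewrite pow_add.
apply Rle_trans with (s 4%nat * s (S n) * (r ^ 4 * r ^ S n)).
  apply Rmult_le_compat_r; [|exact A].
  apply Rmult_le_pos; apply pow_le; lra.
replace (s 4%nat * s (S n) * (r ^ 4 * r ^ S n)) with ((s 4%nat * r ^ 4) * (s (S n) * r ^ S n)) by ring.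
rewrite <- (Rmult_1_l (s (S n) * r ^ S n)) at 2.
now apply Rmult_le_compat_r.
Qed.

(** Here [s = - z h'' / h'] and [d = 1/(1-s)] as power series, and [t = |z|].  The Newton sums of
    [(z h')'] dominate [s_1 d], so the series of [d], [s] and [1/h'] converge at [t].  The
    equation [d = 1 + s d] at [t] gives [s(t) < 1], and [|s(z)| <= s(t)]. *)
Lemma convexity_disk_newton (nu r : R) : -1 < nu -> 0 < r ->
  ps_newton (dzdh_coef nu) 4 * r ^ 4 <= 1 -> convexity_disk (h nu) r.
Proof.
intros Hnu r0 H4; split; [exact r0|intros z Hz].
set (g := dh_coef nu); set (s := ps_newton g); set (d := ps_inv (ps_sub ps_one s)).
assert (g0 : g O = 1) by apply dh_coef_0.
assert (lp := laguerre_polya_dh nu Hnu).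
assert (s0 : forall n, 0 <= s n) by (intros n; now apply laguerre_polya_newton_ge0).
assert (eg := entire_dh nu Hnu); fold g in eg.
assert (z0 := Cmod_ge_0 z); set (t := Cmod z) in *.
assert (s1 : 0 < s 1%nat).
  unfold s; destruct (newton_values g g0) as (-> & _).
  unfold g, dh_coef; assert (hp := hcoef_pos nu 1 Hnu); simpl; lra.
assert (db := ps_inv_bounds g g0 s0); fold s d in db.
assert (sd := ps_newton_le_inv g g0 s0); fold s d in sd.
assert (d0 : forall n, 0 <= d n).
  intros n; destruct (db n); lra.
assert (cd : abs_conv d t).
  destruct (newton_bounded nu r Hnu r0 H4) as [M HM].
  assert (gs : ex_series (fun n => M / (s 1%nat * r) * (t / r) ^ n)).
    apply (ex_series_scal (M / (s 1%nat * r)) (fun n => (t / r) ^ n)).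
    apply ex_series_geom; rewrite Rabs_pos_eq by (apply Rdiv_le_0_compat; lra).
    apply Rmult_lt_reg_r with r; [exact r0|].
    replace (t / r * r) with t by (field; lra); lra.
  revert gs; apply (@ex_series_le R_AbsRing R_CompleteNormedModule); intros n.
  change (Rabs (Rabs (d n) * t ^ n) <= M / (s 1%nat * r) * (t / r) ^ n).
  assert (tn : 0 <= t ^ n) by (apply pow_le; lra).
  rewrite (Rabs_pos_eq (d n)) by apply d0.
  rewrite Rabs_pos_eq by (apply Rmult_le_pos; [apply d0|exact tn]).
  assert (A := ps_inv_le_newton g g0 s0 n); fold s d in A; fold (dzdh_coef nu) in A.
  assert (rn : 0 < r ^ n) by now apply pow_lt.
  assert (B : s 1%nat * d n * r ^ S n <= M).
    apply Rle_trans with (2 := HM n); apply Rmult_le_compat_r; [apply pow_le; lra|exact A].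
  replace (M / (s 1%nat * r) * (t / r) ^ n) with (M * (t ^ n / (s 1%nat * r * r ^ n))).
    2: { unfold Rdiv; rewrite Rpow_mult_distr, pow_inv; field; repeat split; lra. }
  replace (d n * t ^ n) with (s 1%nat * d n * r ^ S n * (t ^ n / (s 1%nat * r * r ^ n))).
    2: { simpl; field; repeat split; lra. }
  apply Rmult_le_compat_r; [|exact B].
  apply Rdiv_le_0_compat; [exact tn|repeat apply Rmult_lt_0_compat; lra].
assert (dom : forall a : nat -> R, (forall n, Rabs (a n) <= d n) -> abs_conv a t).
  intros a Ha; revert cd; apply (@ex_series_le R_AbsRing R_CompleteNormedModule); intros n.
  change (Rabs (Rabs (a n) * t ^ n) <= Rabs (d n) * t ^ n).
  assert (tn : 0 <= t ^ n) by (apply pow_le; lra).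
  rewrite Rabs_pos_eq by (apply Rmult_le_pos; [apply Rabs_pos|exact tn]).
  apply Rmult_le_compat_r; [exact tn|]. rewrite (Rabs_pos_eq (d n)) by apply d0; apply Ha.
assert (cs : abs_conv s t) by (apply dom; intros n; rewrite Rabs_pos_eq by apply s0; apply sd).
assert (ce : abs_conv (ps_inv g) t).
  apply dom; intros n; rewrite Rabs_pos_eq by apply db; apply db.
assert (Gz : CPS g z <> 0%C).
  intros E.
  assert (P := is_cseries_mult g (ps_inv g) z (eg _ z0) ce).
  rewrite ps_mult_inv_r, E in P by exact g0.
  assert (P1 := is_cseries_unique _ _ (is_cseries_one z)).
  rewrite (is_cseries_unique _ _ P), Cmult_0_l in P1.
  apply RtoC_inj in P1; lra.
assert (St : PSeries s t < 1).
  assert (Ct : Cmod (RtoC t) = t) by (rewrite Cmod_R; now apply Rabs_pos_eq).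
  assert (E : d = ps_add ps_one (PS_mult s d)).
    assert (I := ps_mult_inv_r _ (ps_denom_0 g)); fold s d in I.
    rewrite <- I; ring.
  assert (P := is_cseries_plus _ _ _ _ (is_cseries_one (RtoC t))
     (is_cseries_mult s d (RtoC t) ltac:(now rewrite Ct) ltac:(now rewrite Ct))).
  apply (is_cseries_ext _ (fun n => RtoC (d n) * RtoC t ^ n)%C) in P.
    2: { intros n; assert (En : d n = ps_one n + PS_mult s d n) by exact (f_equal (fun f => f n) E).
      rewrite En, RtoC_plus; ring. }
  apply is_cseries_unique in P.
  change (CPS d (RtoC t) = (1 + CPS s (RtoC t) * CPS d (RtoC t))%C) in P.
  rewrite !CPS_real, <- RtoC_mult, <- RtoC_plus in P; apply RtoC_inj in P.
  assert (D1 : 1 <= PSeries d t).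
    replace 1 with (d O * t ^ 0) by (unfold d, ps_inv; simpl; ring).
    apply (Series_term_le (fun n => d n * t ^ n)).
      intros k; apply Rmult_le_pos; [apply d0|apply pow_le; exact z0].
    apply ex_series_ext with (2 := cd); intros n; now rewrite (Rabs_pos_eq (d n)) by apply d0.
  nra.
assert (Sz : Cmod (CPS s z) < 1).
  apply Rle_lt_trans with (2 := St).
  apply Rle_trans with (1 := CPS_Cmod_le s z t (Rle_refl _) cs).
  right; apply Series_ext; intros n; now rewrite Rabs_pos_eq by apply s0.
split; [eexists; now apply cderiv_is_derive, h_cderiv|].
split; [rewrite h_derive by exact Hnu; exact Gz|].
rewrite h_derive2, h_derive by exact Hnu; fold g.
assert (Th : CPS (ps_theta g) z = (- (CPS s z * CPS g z))%C).
  rewrite <- CPS_mult by (exact cs || apply eg, z0).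
  unfold s; rewrite (ps_newton_mult g g0); unfold ps_neg.
  rewrite CPS_opp; [ring|apply entire_theta; assumption].
rewrite Th.
replace (1 + - (CPS s z * CPS g z) / CPS g z)%C with (1 - CPS s z)%C by (field; exact Gz).
assert (B := Rle_trans _ _ _ (Rle_abs _) (Re_le_Cmod (CPS s z))).
change (0 < 1 + - Re (CPS s z)); lra.
Qed.

(** The strict inequality [sigma_4 < sigma_2^2] leaves room for a disk of convexity of radius
    larger than [sigma_2^(-1/2)]. *)
Lemma lower_lt_radius (nu x : R) : -1 < nu -> 0 <= x ->
  x ^ 2 * ps_newton (dzdh_coef nu) 2 <= 1 -> Rbar_lt x (radius_of_convexity (h nu)).
Proof.
intros Hnu x0 Hx.
set (s4 := ps_newton (dzdh_coef nu) 4).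
assert (s2p : 0 < ps_newton (dzdh_coef nu) 2).
  rewrite newton2_value by exact Hnu; apply Rdiv_lt_0_compat; [now apply nu15_pos|].
  assert (p0 := poch3_pos nu Hnu).
  apply Rmult_lt_0_compat; [|apply poch_pos; lra].
  apply Rmult_lt_0_compat; [lra|now apply pow_lt].
assert (H4 : s4 < ps_newton (dzdh_coef nu) 2 ^ 2) by now apply newton4_lt.
assert (s40 : 0 <= s4) by now apply laguerre_polya_newton_ge0, laguerre_polya_dzdh.
(* any u > 0 with s4 <= u < sigma_2^2 gives a radius r = u^(-1/4) that works *)
set (u := (s4 + ps_newton (dzdh_coef nu) 2 ^ 2) / 2).
assert (u0 : 0 < u) by (unfold u; lra).
assert (u1 : s4 < u < ps_newton (dzdh_coef nu) 2 ^ 2) by (unfold u; lra).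
set (r := sqrt (sqrt (/ u))).
assert (iu : 0 < / u) by now apply Rinv_0_lt_compat.
assert (r0 : 0 < r) by (apply sqrt_lt_R0, sqrt_lt_R0, iu).
assert (r2 : r ^ 2 = sqrt (/ u)) by (unfold r; rewrite pow2_sqrt; [reflexivity|apply sqrt_pos]).
assert (r4 : r ^ 4 = / u).
  replace (r ^ 4) with ((r ^ 2) ^ 2) by ring; rewrite r2, pow2_sqrt; lra.
assert (disk : convexity_disk (h nu) r).
  apply convexity_disk_newton; [exact Hnu|exact r0|].
  fold s4; rewrite r4; apply Rmult_le_reg_r with u; [exact u0|].
  rewrite Rmult_assoc, Rinv_l, Rmult_1_l by lra; lra.
apply Rbar_lt_le_trans with (Finite r).
  apply Rnot_le_lt; intros rx.
  assert (x4 : r ^ 4 <= x ^ 4) by (apply pow_incr; lra).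
  rewrite r4 in x4.
  assert (E : x ^ 4 * u < 1).
    set (w := ps_newton (dzdh_coef nu) 2) in *.
    assert (X : 0 < x ^ 4) by lra.
    apply Rlt_le_trans with (x ^ 4 * w ^ 2); [now apply Rmult_lt_compat_l|].
    replace (x ^ 4 * w ^ 2) with ((x ^ 2 * w) * (x ^ 2 * w)) by ring.
    assert (Y : 0 <= x ^ 2 * w) by (apply Rmult_le_pos; [apply pow2_ge_0|lra]). nra.
  apply (Rmult_le_compat_r u) in x4; [|lra]. rewrite Rinv_l in x4 by lra; lra.
apply (proj1 (Lub_Rbar_correct _)); exact disk.
Qed.

Theorem theorem15 (nu : R) (hnu : -1 < nu) :
  Rbar_lt (radius_of_convexity (h nu)) (8 * poch (nu + 1) 3) /\
  (Rbar_lt (4 * poch (nu + 1) 3) (radius_of_convexity (h nu)) /\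
   Rbar_lt (radius_of_convexity (h nu))
           (64 * poch (nu + 1) 5 / (7 * nu ^ 2 + 108 * nu + 293))) /\
  (Rbar_lt (16 * poch (nu + 1) 3 * sqrt (poch (nu + 4) 2 / nu15 nu))
           (radius_of_convexity (h nu)) /\
   Rbar_lt (radius_of_convexity (h nu))
           (8 * poch (nu + 1) 3 * poch (nu + 6) 2 * nu15 nu / (3 * nu16 nu))).
Proof.
assert (U := radius_lt_upper_bound nu hnu).
assert (p0 := poch3_pos nu hnu); assert (r0 := nu15_pos nu hnu).
assert (q0 : 0 < poch (nu + 4) 2) by (apply poch_pos; lra).
assert (up : forall y, upper_bound nu < y -> Rbar_lt (radius_of_convexity (h nu)) y).
  intros y Hy; exact (Rbar_lt_trans _ (Finite (upper_bound nu)) (Finite y) U Hy).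
rewrite poch_3; split; [|split; split].
- apply up; now apply upper_bound_lt_8.
- apply lower_lt_radius; [exact hnu|lra|].
  rewrite newton2_value by exact hnu.
  apply Rmult_le_reg_r with (16 * poch (nu + 4) 2); [lra|].
  replace ((4 * poch3 nu) ^ 2 * (nu15 nu / (256 * poch3 nu ^ 2 * poch (nu + 4) 2)) * (16 * poch (nu + 4) 2))
    with (nu15 nu) by (field; lra).
  unfold nu15; simpl; nra.
- apply (up (64 * poch (nu + 1) 5 / nu15 nu)); now apply upper_bound_lt_ratio.
- apply lower_lt_radius; [exact hnu| |].
    apply Rmult_le_pos; [lra|apply sqrt_pos].
  rewrite newton2_value, Rpow_mult_distr, pow2_sqrt by (exact hnu || (apply Rlt_le, Rdiv_lt_0_compat; assumption)).
  right; field; lra.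
- exact U.
Qed.
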